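(* Let $k$ be a $\sigma$-field, $G$ a $\sigma$-algebraic group over $k$ and $G\hookrightarrow\mathcal G$ a $\sigma$-closed embedding of $G$ into an algebraic group $\mathcal G$ over $k$. Then the size of the growth group of $G$ with respect to the embedding $G\hookrightarrow\mathcal G$ does not depend on the choice of $\mathcal G$ and the $\sigma$-closed embedding.
   Context: All rings are commutative and unital. A $\sigma$-ring is a ring with a ring endomorphism $\sigma$; a $\sigma$-field is a $\sigma$-ring that is a field. A $k$-$\sigma$-algebra is a $\sigma$-ring $R$ with a morphism of $\sigma$-rings $k\to R$; morphisms are $k$-algebra morphisms commuting with $\sigma$. It is finitely $\sigma$-generated if there is a finite $B\subseteq R$ such that $B,\sigma(B),\sigma^2(B),\dots$ generate $R$ as a $k$-algebra. A $\sigma$-algebraic group over $k$ is a functor $G$ from $k$-$\sigma$-algebras to groups representable by a finitely $\sigma$-generated $k$-$\sigma$-algebra $k\{G\}$. A $\sigma$-closed embedding $G\hookrightarrow G'$ is a morphism of $\sigma$-algebraic groups whose dual $k\{G'\}\to k\{G\}$ is surjective; $G$ is then identified with the $\sigma$-closed subgroup of $G'$ defined by the $\sigma$-ideal (ideal stable under $\sigma$) $\mathbb I(G)=\ker(k\{G'\}\to k\{G\})$. An algebraic group over $k$ is an affine group scheme of finite type over $k$ (not necessarily reduced). The size of an algebraic group $\mathcal H$ is $|\mathcal H|=\dim_kk[\mathcal H]\in\mathbb N\cup\{\infty\}$ (vector space dimension of the coordinate ring). For a $k$-scheme $\mathcal X$, ${}^{\sigma^i}\!\mathcal X$ is its base change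 along $\sigma^i\colon k\to k$. Put $\mathcal G[i]=\mathcal G\times{}^{\sigma}\mathcal G\times\cdots\times{}^{\sigma^i}\!\mathcal G$. The functor $R\mapsto\mathcal G(R)$ on $k$-$\sigma$-algebras (forgetting $\sigma$ on $R$) is a $\sigma$-algebraic group, again denoted $\mathcal G$, with $k\{\mathcal G\}=\bigcup_ik[\mathcal G[i]]$ (inclusions dual to the projections onto the first factors; $\sigma$ sends $(r_0\otimes\lambda_0)\otimes\cdots\otimes(r_i\otimes\lambda_i)$, where $r_j\otimes\lambda_j\in k[\mathcal G]\otimes_{k,\sigma^j}k$, to $(1\otimes1)\otimes(r_0\otimes\sigma(\lambda_0))\otimes\cdots\otimes(r_i\otimes\sigma(\lambda_i))$). For $G\leq\mathcal G$ $\sigma$-closed, let $G[i]\leq\mathcal G[i]$ be the closed subgroup defined by $\mathbb I(G)\cap k[\mathcal G[i]]$. Let $\mathcal G_0=G[0]$ and, for $i\geq1$, let $\mathcal G_i$ be the kernel of the projection $G[i]\to G[i-1]$, $(x_0,\dots,x_i)\mapsto(x_0,\dots,x_{i-1})$. The maps $(x_0,\dots,x_i)\mapsto(x_1,\dots,x_i)$ induce morphisms $\sigma_i\colon\mathcal G_i\to{}^\sigma(\mathcal G_{i-1})$, which are isomorphisms for all large $i$. If $m\geq0$ is the smallest integer such that $\sigma_i$ is an isomorphism for all $i>m$, then $\mathcal G_m$ is the growth group of $G$ with respect to $G\hookrightarrow\mathcal G$. *)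

(* Defs.v *)
From HB Require Import structures.
From mathcomp Require Import all_boot ssralg matrix vector.
From mathcomp Require Import boolp.

Set Implicit Arguments.
Unset Strict Implicit.
Unset Printing Implicit Defensive.

Import GRing.Theory.
Local Open Scope ring_scope.
Local Open Scope quotient_scope.

Record category := Category {
  ob :> Type;
  mor : ob -> ob -> Type;
  idm : forall X, mor X X;
  compm : forall X Y Z, mor Y Z -> mor X Y -> mor X Z;
  comp1m : forall X Y (f : mor X Y), compm (idm Y) f = f;
  compm1 : forall X Y (f : mor X Y), compm f (idm X) = f;
  compmA : forall X Y Z T (f : mor Z T) (g : mor Y Z) (h : mor X Y),
    compm f (compm g h) = compm (compm f g) h }.

Record group_functor (C : category) := GroupFunctor {
  points :> C -> groupType;
  fmap : forall R S, mor R S -> points R -> points S;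
  fmapM : forall R S (f : mor R S) (x y : points R),
    fmap f (x * y)%g = (fmap f x * fmap f y)%g;
  fmap_id : forall R (x : points R), fmap (idm R) x = x;
  fmap_comp : forall R S T (f : mor S T) (g : mor R S) (x : points R),
    fmap (compm f g) x = fmap f (fmap g x) }.

(* F is representable by A: the universal point of F(A) and, for each x in
   F(R), the unique morphism A -> R that maps the universal point to x. *)
Record representation (C : category) (F : group_functor C) (A : C) :=
  Representation {
  universal : F A;
  classify : forall R, F R -> mor A R;
  classifyK : forall R (x : F R), fmap (classify x) universal = x;
  fmapK : forall R (f : mor A R), classify (fmap f universal) = f }.

Record group_nat (C : category) (F G : group_functor C) := GroupNat {
  nat_map :> forall R, F R -> G R;
  nat_mapM : forall R (x y : F R), nat_map (x * y)%g = (nat_map x * nat_map y)%g;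
  nat_natural : forall R S (f : mor R S) (x : F R),
    nat_map (fmap f x) = fmap f (nat_map x) }.

Section Functor.
Variables (C : category) (F : group_functor C).

Lemma fmap1 R S (f : mor R S) : fmap f (1%g : F R) = 1%g.
Proof.
by apply: (@mulgI _ (fmap f (1%g : F R))); rewrite -fmapM !mulg1.
Qed.

Lemma classify_natural A (r : representation F A) R S (f : mor R S) (x : F R) :
  classify r (fmap f x) = compm f (classify r x).
Proof. by rewrite -{1}[x](classifyK r) -fmap_comp fmapK. Qed.
End Functor.

Section Algebras.
Variable k : fieldType.

(* comPzRingType rather than comNzRingType: the zero ring is a k-algebra. *)
Record kalg := KAlg {
  kcar :> comPzRingType;
  kstr : {rmorphism k -> kcar} }.

Record khom (A B : kalg) := KHom {
  kfun :> {rmorphism A -> B};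
  kfunE : forall c, kfun (kstr A c) = kstr B c }.

Lemma khom_ext (A B : kalg) (f g : khom A B) : f =1 g -> f = g.
Proof.
case: f g => [[f [[f1] [f2]]] fE] [[g [[g1] [g2]]] gE] /= /funext eq_fg.
case: _ / eq_fg in g1 g2 gE *.
have -> : g1 = f1 by exact: Prop_irrelevance.
have e2 : g2 = f2 by exact: Prop_irrelevance.
move: gE; rewrite e2 => gE; congr KHom; exact: Prop_irrelevance.
Qed.

Definition kid (A : kalg) : khom A A := @KHom A A idfun (fun=> erefl).

Lemma kcomp_subproof (A B C : kalg) (f : khom B C) (g : khom A B) c :
  (f \o g) (kstr A c) = kstr C c.
Proof. by rewrite /= !kfunE. Qed.

Definition kcomp (A B C : kalg) (f : khom B C) (g : khom A B) : khom A C :=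
  @KHom A C (f \o g) (kcomp_subproof f g).

Definition kalg_category : category.
Proof.
by refine (@Category kalg khom kid kcomp _ _ _) => *; exact: khom_ext.
Defined.

Inductive generated (A : kalg) (S : A -> Prop) : A -> Prop :=
  | generated_in a : S a -> generated S a
  | generated_str c : generated S (kstr A c)
  | generated_add a b : generated S a -> generated S b -> generated S (a + b)
  | generated_mul a b : generated S a -> generated S b -> generated S (a * b).

Definition finitely_generated (A : kalg) :=
  exists B : seq A, forall a, generated (fun b => b \in B) a.

(* An affine group scheme of finite type over k, as a functor of points. *)
Record alg_group := AlgGroup {
  alg_functor :> group_functor kalg_category;
  alg_coord : kalg;
  alg_rep : representation alg_functor alg_coord;
  alg_fin : finitely_generated alg_coord }.

Definition kbase : kalg := @KAlg k idfun.

Definition kmod (A : kalg) : Type := kcar A.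
HB.instance Definition _ (A : kalg) := GRing.ComPzRing.on (kmod A).

Section Kmod.
Variable A : kalg.
Let scale (c : k) (v : kmod A) : kmod A := kstr A c * v.
Fact kscalerA a b v : scale a (scale b v) = scale (a * b) v.
Proof. by rewrite /scale rmorphM mulrA. Qed.
Fact kscale1r : left_id 1 scale.
Proof. by move=> v; rewrite /scale rmorph1 mul1r. Qed.
Fact kscalerDr : right_distributive scale +%R.
Proof. by move=> c u v; rewrite /scale mulrDr. Qed.
Fact kscalerDl v : {morph scale^~ v : a b / a + b}.
Proof. by move=> a b; rewrite /scale rmorphD mulrDl. Qed.
HB.instance Definition _ := GRing.Zmodule_isLmodule.Build k (kmod A)
  kscalerA kscale1r kscalerDr kscalerDl.
End Kmod.

Definition has_dim (A : kalg) (n : nat) := inhabited (Vector.axiom n (kmod A)).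

(* dim_k A in N u {oo}, where None stands for oo. *)
Definition kdim (A : kalg) : option nat :=
  if pselect (exists n, has_dim A n) is left h then Some (projT1 (cid h))
  else None.

Section Presentation.
Variable X : Type.

Inductive term :=
  | TConst of k
  | TVar of X
  | TAdd of term & term
  | TOpp of term
  | TMul of term & term.

HB.instance Definition _ := gen_eqMixin term.
HB.instance Definition _ := gen_choiceMixin term.

Fixpoint eval (R : kalg) (v : X -> R) (t : term) : R :=
  match t with
  | TConst c => kstr R c
  | TVar x => v x
  | TAdd t u => eval v t + eval v u
  | TOpp t => - eval v t
  | TMul t u => eval v t * eval v u
  end.

Variable rel : term -> term -> Prop.

Inductive eqv : term -> term -> Prop :=
  | eqv_rel t u : rel t u -> eqv t u
  | eqv_refl t : eqv t t
  | eqv_sym t u : eqv t u -> eqv u t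
  | eqv_trans t u v : eqv t u -> eqv u v -> eqv t v
  | eqv_add t t' u u' : eqv t t' -> eqv u u' -> eqv (TAdd t u) (TAdd t' u')
  | eqv_opp t t' : eqv t t' -> eqv (TOpp t) (TOpp t')
  | eqv_mul t t' u u' : eqv t t' -> eqv u u' -> eqv (TMul t u) (TMul t' u')
  | eqv_constD c d : eqv (TConst (c + d)) (TAdd (TConst c) (TConst d))
  | eqv_constM c d : eqv (TConst (c * d)) (TMul (TConst c) (TConst d))
  | eqv_addA t u v : eqv (TAdd t (TAdd u v)) (TAdd (TAdd t u) v)
  | eqv_addC t u : eqv (TAdd t u) (TAdd u t)
  | eqv_add0 t : eqv (TAdd (TConst 0) t) t
  | eqv_addN t : eqv (TAdd (TOpp t) t) (TConst 0)
  | eqv_mulA t u v : eqv (TMul t (TMul u v)) (TMul (TMul t u) v)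
  | eqv_mulC t u : eqv (TMul t u) (TMul u t)
  | eqv_mul1 t : eqv (TMul (TConst 1) t) t
  | eqv_mulD t u v : eqv (TMul (TAdd t u) v) (TAdd (TMul t v) (TMul u v)).

Let eqvb t u : bool := `[< eqv t u >].
Fact eqvb_refl : reflexive eqvb.
Proof. by move=> t; apply/asboolP; exact: eqv_refl. Qed.
Fact eqvb_sym : symmetric eqvb.
Proof. by move=> t u; apply/asboolP/asboolP; exact: eqv_sym. Qed.
Fact eqvb_trans : transitive eqvb.
Proof.
by move=> u t v /asboolP tu /asboolP uv; apply/asboolP; exact: eqv_trans uv.
Qed.
Canonical eqvb_equiv := EquivRel eqvb eqvb_refl eqvb_sym eqvb_trans.

Definition pres := {eq_quot eqvb_equiv}.
HB.instance Definition _ := Choice.on pres.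

Definition cls (t : term) : pres := \pi t.

Lemma clsP t u : (cls t = cls u) <-> eqv t u.
Proof.
split=> [/eqP|tu]; first by rewrite /cls eqmodE => /asboolP.
by apply/eqP; rewrite /cls eqmodE; apply/asboolP.
Qed.

Lemma reprP t : eqv (repr (cls t)) t.
Proof. by apply/clsP; rewrite /cls reprK. Qed.

Lemma clsK p : cls (repr p) = p. Proof. exact: reprK. Qed.

Definition padd (p q : pres) := cls (TAdd (repr p) (repr q)).
Definition popp (p : pres) := cls (TOpp (repr p)).
Definition pmul (p q : pres) := cls (TMul (repr p) (repr q)).

Lemma paddE t u : padd (cls t) (cls u) = cls (TAdd t u).
Proof. by apply/clsP; apply: eqv_add; exact: reprP. Qed.
Lemma poppE t : popp (cls t) = cls (TOpp t).
Proof. by apply/clsP; apply: eqv_opp; exact: reprP. Qed.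
Lemma pmulE t u : pmul (cls t) (cls u) = cls (TMul t u).
Proof. by apply/clsP; apply: eqv_mul; exact: reprP. Qed.

Fact paddA : associative padd.
Proof.
move=> p q r; rewrite -[p]clsK -[q]clsK -[r]clsK !paddE.
by apply/clsP; exact: eqv_addA.
Qed.
Fact paddC : commutative padd.
Proof.
by move=> p q; rewrite -[p]clsK -[q]clsK !paddE; apply/clsP; exact: eqv_addC.
Qed.
Fact padd0 : left_id (cls (TConst 0)) padd.
Proof. by move=> p; rewrite -[p]clsK paddE; apply/clsP; exact: eqv_add0. Qed.
Fact paddN : left_inverse (cls (TConst 0)) popp padd.
Proof.
by move=> p; rewrite -[p]clsK poppE paddE; apply/clsP; exact: eqv_addN.
Qed.
HB.instance Definition _ := GRing.isZmodule.Build pres paddA paddC padd0 paddN.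

Fact pmulA : associative pmul.
Proof.
move=> p q r; rewrite -[p]clsK -[q]clsK -[r]clsK !pmulE.
by apply/clsP; exact: eqv_mulA.
Qed.
Fact pmulC : commutative pmul.
Proof.
by move=> p q; rewrite -[p]clsK -[q]clsK !pmulE; apply/clsP; exact: eqv_mulC.
Qed.
Fact pmul1 : left_id (cls (TConst 1)) pmul.
Proof. by move=> p; rewrite -[p]clsK pmulE; apply/clsP; exact: eqv_mul1. Qed.
Fact pmulD : left_distributive pmul padd.
Proof.
move=> p q r; rewrite -[p]clsK -[q]clsK -[r]clsK !(paddE, pmulE).
by apply/clsP; exact: eqv_mulD.
Qed.
HB.instance Definition _ :=
  GRing.Zmodule_isComPzRing.Build pres pmulA pmulC pmul1 pmulD.

Lemma clsD t u : cls (TAdd t u) = cls t + cls u.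
Proof. by rewrite -paddE. Qed.
Lemma clsN t : cls (TOpp t) = - cls t.
Proof. by rewrite -poppE. Qed.
Lemma clsM t u : cls (TMul t u) = cls t * cls u.
Proof. by rewrite -pmulE. Qed.

Definition pconst (c : k) : pres := cls (TConst c).
Fact pconst_nmod : nmod_morphism pconst.
Proof. by split=> // c d; rewrite -clsD; apply/clsP; exact: eqv_constD. Qed.
Fact pconst_monoid : monoid_morphism pconst.
Proof. by split=> // c d; rewrite -clsM; apply/clsP; exact: eqv_constM. Qed.
HB.instance Definition _ :=
  GRing.isNmodMorphism.Build k pres pconst pconst_nmod.
HB.instance Definition _ :=
  GRing.isMonoidMorphism.Build k pres pconst pconst_monoid.

(* The k-algebra with generators X and relations t = u for rel t u. *)
Definition presented : kalg := @KAlg pres pconst.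

Definition gen (x : X) : presented := cls (TVar x).

Lemma eval_gen t : eval gen t = cls t.
Proof.
elim: t => //= [t -> u ->|t ->|t -> u ->].
- by rewrite -clsD.
- by rewrite -clsN.
- by rewrite -clsM.
Qed.

Lemma gen_rel t u : rel t u -> eval gen t = eval gen u.
Proof. by move=> tu; rewrite !eval_gen; apply/clsP; exact: eqv_rel. Qed.

Section Lift.
Variables (R : kalg) (v : X -> R).
Hypothesis v_rel : forall t u, rel t u -> eval v t = eval v u.

Lemma eval_eqv t u : eqv t u -> eval v t = eval v u.
Proof.
elim=> {t u} /= [t u /v_rel|//|t u _ ->|t u w _ -> _ ->|t t' u u' _ -> _ ->
  |t t' _ ->|t t' u u' _ -> _ ->|c d|c d|t u w|t u|t|t|t u w|t u|t|t u w] //.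
- exact: rmorphD.
- exact: rmorphM.
- exact: addrA.
- exact: addrC.
- by rewrite rmorph0 add0r.
- by rewrite rmorph0 addNr.
- exact: mulrA.
- exact: mulrC.
- by rewrite rmorph1 mul1r.
- exact: mulrDl.
Qed.

Definition pres_lift_fun (p : presented) : R := eval v (repr (p : pres)).

Lemma pres_lift_cls t : pres_lift_fun (cls t) = eval v t.
Proof. exact: eval_eqv (reprP t). Qed.

Fact pres_lift_nmod : nmod_morphism pres_lift_fun.
Proof.
split=> [|p q]; first by rewrite (pres_lift_cls (TConst 0)) /= rmorph0.
by rewrite -[p]clsK -[q]clsK -clsD !pres_lift_cls.
Qed.
Fact pres_lift_monoid : monoid_morphism pres_lift_fun.
Proof.
split=> [|p q]; first by rewrite (pres_lift_cls (TConst 1)) /= rmorph1.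
by rewrite -[p]clsK -[q]clsK -clsM !pres_lift_cls.
Qed.
HB.instance Definition _ :=
  GRing.isNmodMorphism.Build presented R pres_lift_fun pres_lift_nmod.
HB.instance Definition _ :=
  GRing.isMonoidMorphism.Build presented R pres_lift_fun pres_lift_monoid.

Fact pres_lift_str c : pres_lift_fun (kstr presented c) = kstr R c.
Proof. exact: pres_lift_cls (TConst c). Qed.

Definition pres_lift : khom presented R := KHom pres_lift_str.

Lemma pres_lift_gen x : pres_lift (gen x) = v x.
Proof. exact: pres_lift_cls (TVar x). Qed.
End Lift.

Lemma presented_ind (Q : presented -> Prop) :
  (forall x, Q (gen x)) -> (forall c, Q (kstr presented c)) ->
  (forall p q, Q p -> Q q -> Q (p + q)) -> (forall p, Q p -> Q (- p)) ->
  (forall p q, Q p -> Q q -> Q (p * q)) -> forall p, Q p.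
Proof.
move=> Qg Qc QD QN QM p; rewrite -[p]clsK.
elim: (repr _) => [c|x|t IHt u IHu|t IHt|t IHt u IHu].
- exact: Qc.
- exact: Qg.
- by rewrite clsD; exact: QD.
- by rewrite clsN; exact: QN.
- by rewrite clsM; exact: QM.
Qed.

Lemma presented_ext (R : kalg) (f g : khom presented R) :
  (forall x, f (gen x) = g (gen x)) -> f =1 g.
Proof.
move=> fg; apply: presented_ind => [//|c|p q fgp fgq|p fgp|p q fgp fgq].
- by rewrite !kfunE.
- by rewrite !rmorphD fgp fgq.
- by rewrite !rmorphN fgp.
- by rewrite !rmorphM fgp fgq.
Qed.
End Presentation.

Section Quotient.
Variables (A : kalg) (S : A -> Prop).

Inductive quot_rel : term A -> term A -> Prop :=
  | quot_str c : quot_rel (TVar (kstr A c)) (TConst A c)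
  | quot_add a b : quot_rel (TVar (a + b)) (TAdd (TVar a) (TVar b))
  | quot_mul a b : quot_rel (TVar (a * b)) (TMul (TVar a) (TVar b))
  | quot_kill a : S a -> quot_rel (TVar a) (TConst A 0).

(* A / (S), where (S) is the ideal generated by S. *)
Definition quot : kalg := presented quot_rel.

Definition quot_fun (a : A) : quot := gen quot_rel a.
Fact quot_nmod : nmod_morphism quot_fun.
Proof.
split=> [|a b]; last exact: (gen_rel (quot_add a b)).
by rewrite -(rmorph0 (kstr A)) -(rmorph0 (kstr quot)); exact: (gen_rel (quot_str 0)).
Qed.
Fact quot_monoid : monoid_morphism quot_fun.
Proof.
split=> [|a b]; last exact: (gen_rel (quot_mul a b)).
by rewrite -(rmorph1 (kstr A)) -(rmorph1 (kstr quot)); exact: (gen_rel (quot_str 1)).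
Qed.
HB.instance Definition _ := GRing.isNmodMorphism.Build A quot quot_fun quot_nmod.
HB.instance Definition _ :=
  GRing.isMonoidMorphism.Build A quot quot_fun quot_monoid.
Fact quot_strE c : quot_fun (kstr A c) = kstr quot c.
Proof. exact: (gen_rel (quot_str c)). Qed.

Definition quot_map : khom A quot := KHom quot_strE.

Lemma quot_map0 a : S a -> quot_map a = 0.
Proof.
by move=> Sa; rewrite -(rmorph0 (kstr quot)); exact: (gen_rel (quot_kill Sa)).
Qed.

Section Lift.
Variables (R : kalg) (f : khom A R).
Hypothesis f_kill : forall a, S a -> f a = 0.
Fact quot_lift_rel t u : quot_rel t u -> eval f t = eval f u.
Proof.
case=> /= *; rewrite ?(kfunE, rmorphD, rmorphM) //.
by rewrite f_kill // rmorph0.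
Qed.
Definition quot_lift : khom quot R := pres_lift quot_lift_rel.
Lemma quot_liftE a : quot_lift (quot_map a) = f a.
Proof. exact: pres_lift_gen. Qed.
End Lift.
End Quotient.

(* R with k acting through t: the points of a base change are
   ({}^t X)(R) = X(twist t R). *)
Definition twist (t : {rmorphism k -> k}) (R : kalg) : kalg :=
  @KAlg R (kstr R \o t).

Fact twist_map_subproof t (A B : kalg) (f : khom A B) c :
  f (kstr (twist t A) c) = kstr (twist t B) c.
Proof. by rewrite /= kfunE. Qed.
Definition twist_map t (A B : kalg) (f : khom A B) :
  khom (twist t A) (twist t B) :=
  @KHom (twist t A) (twist t B) (kfun f) (twist_map_subproof t f).

Section BaseChange.
Variables (t : {rmorphism k -> k}) (A : kalg).

Inductive bchange_rel : term A -> term A -> Prop :=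
  | bchange_str c : bchange_rel (TVar (kstr A c)) (TConst A (t c))
  | bchange_add a b : bchange_rel (TVar (a + b)) (TAdd (TVar a) (TVar b))
  | bchange_mul a b : bchange_rel (TVar (a * b)) (TMul (TVar a) (TVar b)).

(* A (x)_{k,t} k: the generator a is a (x) 1, and the k-algebra structure is
   the one of the right factor. *)
Definition bchange : kalg := presented bchange_rel.

Definition bchange_fun (a : A) : twist t bchange := gen bchange_rel a.
Fact bchange_nmod : nmod_morphism bchange_fun.
Proof.
split=> [|a b]; last exact: (gen_rel (bchange_add a b)).
rewrite -(rmorph0 (kstr A)) -(rmorph0 (kstr (twist t bchange))).
exact: (gen_rel (bchange_str 0)).
Qed.
Fact bchange_monoid : monoid_morphism bchange_fun.
Proof.
split=> [|a b]; last exact: (gen_rel (bchange_mul a b)).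
rewrite -(rmorph1 (kstr A)) -(rmorph1 (kstr (twist t bchange))).
exact: (gen_rel (bchange_str 1)).
Qed.
HB.instance Definition _ :=
  GRing.isNmodMorphism.Build A (twist t bchange) bchange_fun bchange_nmod.
HB.instance Definition _ :=
  GRing.isMonoidMorphism.Build A (twist t bchange) bchange_fun bchange_monoid.
Fact bchange_strE c : bchange_fun (kstr A c) = kstr (twist t bchange) c.
Proof. exact: (gen_rel (bchange_str c)). Qed.

(* a |-> a (x) 1 *)
Definition bchange_map : khom A (twist t bchange) := KHom bchange_strE.

Section Lift.
Variables (R : kalg) (f : khom A (twist t R)).
Fact bchange_lift_rel u v :
  bchange_rel u v -> eval (f : A -> R) u = eval (f : A -> R) v.
Proof. by case=> /= *; rewrite ?(kfunE, rmorphD, rmorphM). Qed.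
Definition bchange_lift : khom bchange R := pres_lift bchange_lift_rel.
Lemma bchange_liftE a : bchange_lift (bchange_map a) = f a.
Proof. exact: pres_lift_gen. Qed.
End Lift.

Lemma bchange_ext (R : kalg) (f g : khom bchange R) :
  (forall a, f (bchange_map a) = g (bchange_map a)) -> f =1 g.
Proof. exact: presented_ext. Qed.
End BaseChange.

Section Tensor.
Variables (I : Type) (B : I -> kalg).

Notation TIn j b := (TVar (existT (fun j => kcar (B j)) j b)).

Inductive tensor_rel :
    term {j : I & kcar (B j)} -> term {j : I & kcar (B j)} -> Prop :=
  | tensor_str j c : tensor_rel (TIn j (kstr (B j) c)) (TConst _ c)
  | tensor_add j a b : tensor_rel (TIn j (a + b)) (TAdd (TIn j a) (TIn j b))
  | tensor_mul j a b : tensor_rel (TIn j (a * b)) (TMul (TIn j a) (TIn j b)).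

(* For infinite I this is the union of the tensor products over the finite
   subsets of I. *)
Definition tensor : kalg := presented tensor_rel.

Section Inclusion.
Variable j : I.
Definition tensor_fun (b : B j) : tensor :=
  gen tensor_rel (existT (fun j => kcar (B j)) j b).
Fact tensor_nmod : nmod_morphism tensor_fun.
Proof.
split=> [|a b]; last exact: (gen_rel (tensor_add a b)).
rewrite -(rmorph0 (kstr (B j))) -(rmorph0 (kstr tensor)).
exact: (gen_rel (tensor_str j 0)).
Qed.
Fact tensor_monoid : monoid_morphism tensor_fun.
Proof.
split=> [|a b]; last exact: (gen_rel (tensor_mul a b)).
rewrite -(rmorph1 (kstr (B j))) -(rmorph1 (kstr tensor)).
exact: (gen_rel (tensor_str j 1)).
Qed.
HB.instance Definition _ :=
  GRing.isNmodMorphism.Build (B j) tensor tensor_fun tensor_nmod.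
HB.instance Definition _ :=
  GRing.isMonoidMorphism.Build (B j) tensor tensor_fun tensor_monoid.
Fact tensor_strE c : tensor_fun (kstr (B j) c) = kstr tensor c.
Proof. exact: (gen_rel (tensor_str j c)). Qed.

(* b |-> ... (x) 1 (x) b (x) 1 (x) ..., with b in position j *)
Definition tensor_in : khom (B j) tensor := KHom tensor_strE.
End Inclusion.

Section Lift.
Variables (R : kalg) (f : forall j, khom (B j) R).
Let v (x : {j : I & kcar (B j)}) : R := f (projT1 x) (projT2 x).
Fact tensor_lift_rel t u : tensor_rel t u -> eval v t = eval v u.
Proof. by case=> /= *; rewrite /v /= ?(kfunE, rmorphD, rmorphM). Qed.
Definition tensor_lift : khom tensor R := pres_lift tensor_lift_rel.
Lemma tensor_liftE j b : tensor_lift (tensor_in j b) = f j b.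
Proof. by rewrite /tensor_lift [LHS]pres_lift_gen. Qed.
End Lift.

Lemma tensor_ext (R : kalg) (f g : khom tensor R) :
  (forall j b, f (tensor_in j b) = g (tensor_in j b)) -> f =1 g.
Proof. by move=> fg; apply: presented_ext => -[j b]; exact: fg. Qed.
End Tensor.

End Algebras.

Fixpoint rpow (R : pzRingType) (s : {rmorphism R -> R}) (n : nat) :
    {rmorphism R -> R} :=
  if n is m.+1 then s \o rpow s m else idfun.

Section Difference.
Variables (k : fieldType) (s : {rmorphism k -> k}).

Record sigalg := SigAlg {
  scar :> kalg k;
  sact : {rmorphism scar -> scar};
  sactE : forall c, sact (kstr scar c) = kstr scar (s c) }.

Record sighom (A B : sigalg) := SigHom {
  sfun :> khom A B;
  sfunE : forall a, sfun (sact A a) = sact B (sfun a) }.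

Lemma sighom_ext (A B : sigalg) (f g : sighom A B) : f =1 g -> f = g.
Proof.
case: f g => [f fE] [g gE] /= /khom_ext eq_fg.
by case: _ / eq_fg in gE *; congr SigHom; exact: Prop_irrelevance.
Qed.

Definition sid (A : sigalg) : sighom A A := @SigHom A A (kid A) (fun=> erefl).

Fact scomp_subproof (A B C : sigalg) (f : sighom B C) (g : sighom A B) a :
  kcomp f g (sact A a) = sact C (kcomp f g a).
Proof. by rewrite /= !sfunE. Qed.

Definition scomp (A B C : sigalg) (f : sighom B C) (g : sighom A B) :
  sighom A C := SigHom (scomp_subproof f g).

Definition sigalg_category : category.
Proof.
by refine (@Category sigalg sighom sid scomp _ _ _) => *; exact: sighom_ext.
Defined.

Definition finitely_sigma_generated (A : sigalg) :=
  exists B : seq A, forall a,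
    generated (fun x => exists2 b, b \in B & exists n, x = rpow (sact A) n b) a.

Record sig_group := SigGroup {
  sig_functor :> group_functor sigalg_category;
  sig_coord : sigalg;
  sig_rep : representation sig_functor sig_coord;
  sig_fin : finitely_sigma_generated sig_coord }.

Definition dual (G H : sig_group) (e : group_nat G H) :
  sighom (sig_coord H) (sig_coord G) :=
  classify (sig_rep H) (e _ (universal (sig_rep G))).

Definition sigma_closed_embedding (G H : sig_group) (e : group_nat G H) :=
  forall a, exists f, dual e f = a.

Section Forget.
Variable GG : alg_group k.
Let A := alg_coord GG.

Definition power_factor (j : nat) : kalg k := bchange (rpow s j) A.

(* k{GG}, as the tensor product of k[{}^(sigma^j) GG] over all j in nat *)
Definition sigcoord_alg : kalg k := tensor power_factor.

Definition factor_in (j : nat) (a : A) : sigcoord_alg :=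
  tensor_in power_factor j (bchange_map (rpow s j) A a).

Fact factor_str j c :
  factor_in j (kstr A c) = kstr sigcoord_alg (rpow s j c).
Proof.
exact: etrans (congr1 (tensor_in power_factor j)
  (kfunE (bchange_map (rpow s j) A) c)) (kfunE (tensor_in power_factor j) _).
Qed.

Fact sigcoord_shift_subproof j c :
  (tensor_in power_factor j.+1 \o bchange_map (rpow s j.+1) A) (kstr A c)
    = kstr (twist (rpow s j) (twist s sigcoord_alg)) c.
Proof. exact: factor_str. Qed.

Definition sigcoord_shift j :
  khom A (twist (rpow s j) (twist s sigcoord_alg)) :=
  @KHom _ A (twist (rpow s j) (twist s sigcoord_alg))
    (tensor_in power_factor j.+1 \o bchange_map (rpow s j.+1) A)
    (sigcoord_shift_subproof j).

(* As a sigma-semilinear endomorphism of k{GG}, this sends r (x) lambda in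
   position j to r (x) sigma(lambda) in position j.+1. *)
Definition sigcoord_act : khom sigcoord_alg (twist s sigcoord_alg) :=
  tensor_lift (fun j => bchange_lift (sigcoord_shift j)).

Lemma sigcoord_actE j a : sigcoord_act (factor_in j a) = factor_in j.+1 a.
Proof. by rewrite /factor_in tensor_liftE bchange_liftE. Qed.

Definition sigcoord : sigalg :=
  @SigAlg sigcoord_alg (kfun sigcoord_act) (kfunE sigcoord_act).

Fact base_in_subproof c :
  (tensor_in power_factor 0 \o bchange_map (rpow s 0) A) (kstr A c)
    = kstr sigcoord c.
Proof. exact: factor_str. Qed.

(* The inclusion of k[GG] = k[GG[0]] in k{GG}. *)
Definition base_in : khom A sigcoord := KHom base_in_subproof.

Section Lift.
Variables (R : sigalg) (f : khom A R).

Fact sigcoord_iter_subproof j c :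
  (rpow (sact R) j \o f) (kstr A c) = kstr (twist (rpow s j) R) c.
Proof.
rewrite /= kfunE; elim: j => //= j ->.
by rewrite sactE.
Qed.

Definition sigcoord_iter j : khom A (twist (rpow s j) R) :=
  @KHom _ A (twist (rpow s j) R) (rpow (sact R) j \o f)
    (sigcoord_iter_subproof j).

Definition sigcoord_lift_khom : khom sigcoord_alg R :=
  tensor_lift (fun j => bchange_lift (sigcoord_iter j)).

Lemma sigcoord_liftE j a :
  sigcoord_lift_khom (factor_in j a) = rpow (sact R) j (f a).
Proof. by rewrite /factor_in tensor_liftE bchange_liftE. Qed.

Fact sact_twist_subproof c : sact R (kstr R c) = kstr (twist s R) c.
Proof. exact: sactE. Qed.
Definition sact_twist : khom R (twist s R) :=
  @KHom _ R (twist s R) (sact R) sact_twist_subproof.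

Fact sigcoord_lift_subproof p :
  sigcoord_lift_khom (sact sigcoord p) = sact R (sigcoord_lift_khom p).
Proof.
pose h1 : khom sigcoord_alg (twist s R) :=
  kcomp (twist_map s sigcoord_lift_khom) sigcoord_act.
pose h2 : khom sigcoord_alg (twist s R) := kcomp sact_twist sigcoord_lift_khom.
suff: h1 =1 h2 by exact.
apply: tensor_ext => j b.
pose g1 := kcomp h1 (tensor_in power_factor j).
pose g2 := kcomp h2 (tensor_in power_factor j).
suff: g1 =1 g2 by exact.
apply: bchange_ext => a.
change (sigcoord_lift_khom (sigcoord_act (factor_in j a))
  = sact R (sigcoord_lift_khom (factor_in j a))).
by rewrite sigcoord_actE !sigcoord_liftE.
Qed.

Definition sigcoord_lift : sighom sigcoord R := SigHom sigcoord_lift_subproof.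
End Lift.

Lemma factor_in_iter j a : factor_in j a = rpow (sact sigcoord) j (base_in a).
Proof. by elim: j => //= j <-; rewrite -sigcoord_actE. Qed.

Lemma sigcoord_ext (R : sigalg) (f g : sighom sigcoord R) :
  (forall a, f (base_in a) = g (base_in a)) -> f =1 g.
Proof.
move=> fg; apply: tensor_ext => j b.
pose f' := kcomp f (tensor_in power_factor j).
pose g' := kcomp g (tensor_in power_factor j).
suff: f' =1 g' by exact.
apply: bchange_ext => a; change (f (factor_in j a) = g (factor_in j a)).
rewrite factor_in_iter {b f' g'}; elim: j => [|j IHj] /=; first exact: fg.
exact: etrans (sfunE f _) (etrans (congr1 _ IHj) (esym (sfunE g _))).
Qed.

Definition forget_functor : group_functor sigalg_category.
Proof.
refine (@GroupFunctor sigalg_category (fun R : sigalg => GG (scar R))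
  (fun (R S : sigalg) (f : sighom R S) =>
     @fmap (kalg_category k) GG R S (sfun f)) _ _ _).
- by move=> R S f x y; exact: fmapM.
- by move=> R x; exact: (@fmap_id (kalg_category k)).
- by move=> R S T f g x; exact: (@fmap_comp (kalg_category k)).
Defined.

Definition forget_rep : representation forget_functor sigcoord.
Proof.
refine (@Representation sigalg_category forget_functor sigcoord
  (@fmap (kalg_category k) GG A sigcoord base_in (universal (alg_rep GG)))
  (fun (R : sigalg) x => sigcoord_lift (classify (alg_rep GG) x)) _ _).
- move=> R x /=.
  rewrite -(@fmap_comp (kalg_category k)) -[RHS](classifyK (alg_rep GG)).
  congr fmap; apply: khom_ext => a.
  exact: (sigcoord_liftE (classify (alg_rep GG) x) 0 a).
- move=> R f; apply: sighom_ext; apply: sigcoord_ext => a /=.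
  rewrite -(@fmap_comp (kalg_category k)) fmapK.
  exact: (sigcoord_liftE (kcomp f base_in) 0 a).
Defined.

Fact forget_fin : finitely_sigma_generated sigcoord.
Proof.
have [B genB] := alg_fin GG.
exists (map base_in B) => p; set S := (X in generated X).
pose T (q : sigcoord) := generated S q.
have genN q : T q -> T (- q).
  move=> Tq; rewrite -mulN1r -(rmorph1 (kstr sigcoord)) -rmorphN.
  exact: generated_mul (generated_str _ _) Tq.
apply: (presented_ind (Q := T)) => [[j b]|c|||]; rewrite /T.
- change (T (tensor_in power_factor j b)).
  apply: (presented_ind (Q := fun b => T (tensor_in power_factor j b))).
  + move=> a; change (T (factor_in j a)).
    elim: {a}(genB a) => [a aB|c|a d _ Ta _ Td|a d _ Ta _ Td].
    * apply: generated_in; exists (base_in a); first exact: map_f.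
      by exists j; exact: factor_in_iter.
    * by rewrite factor_str; exact: (generated_str (A := sigcoord)).
    * by rewrite /factor_in !rmorphD; exact: generated_add.
    * by rewrite /factor_in !rmorphM; exact: generated_mul.
  + by move=> c; rewrite kfunE; exact: generated_str.
  + by move=> a c Ta Tc; rewrite rmorphD; exact: generated_add.
  + by move=> a Ta; rewrite rmorphN; exact: genN.
  + by move=> a c Ta Tc; rewrite rmorphM; exact: generated_mul.
- exact: generated_str.
- by move=> a b; exact: generated_add.
- exact: genN.
- by move=> a b; exact: generated_mul.
Qed.

(* The functor R |-> GG(R), represented by k{GG}. *)
Definition forget : sig_group := SigGroup forget_rep forget_fin.

(* k[GG[i]] *)
Definition ncoord (i : nat) : kalg k :=
  tensor (fun j : 'I_i.+1 => power_factor j).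

Definition nfactor_in i (j : 'I_i.+1) (a : A) : ncoord i :=
  tensor_in (fun j : 'I_i.+1 => power_factor j) j (bchange_map (rpow s j) A a).

(* The inclusion of k[GG[i]] in k{GG}. *)
Definition ncoord_in i : khom (ncoord i) sigcoord :=
  tensor_lift (fun j : 'I_i.+1 => tensor_in power_factor j).

(* Dual to (x_0, ..., x_(i+1)) |-> (x_0, ..., x_i). *)
Definition proj_dual i : khom (ncoord i) (ncoord i.+1) :=
  tensor_lift (fun j : 'I_i.+1 =>
    tensor_in (fun l : 'I_i.+2 => power_factor l) (widen_ord (leqnSn i.+1) j)).

Fact nfactor_str i (j : 'I_i.+1) c :
  nfactor_in j (kstr A c) = kstr (ncoord i) (rpow s j c).
Proof.
exact: etrans (congr1 (tensor_in (fun j : 'I_i.+1 => power_factor j) j)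
    (kfunE (bchange_map (rpow s j) A) c))
  (kfunE (tensor_in (fun j : 'I_i.+1 => power_factor j) j) _).
Qed.

Fact shift_factor_subproof i (j : 'I_i.+1) c :
  (tensor_in (fun l : 'I_i.+2 => power_factor l) (lift ord0 j)
     \o bchange_map (rpow s (lift ord0 j)) A) (kstr A c)
    = kstr (twist (rpow s j) (twist s (ncoord i.+1))) c.
Proof. exact: (nfactor_str (lift ord0 j)). Qed.

Definition shift_factor i (j : 'I_i.+1) :
  khom A (twist (rpow s j) (twist s (ncoord i.+1))) :=
  @KHom _ A (twist (rpow s j) (twist s (ncoord i.+1)))
    (tensor_in (fun l : 'I_i.+2 => power_factor l) (lift ord0 j)
     \o bchange_map (rpow s (lift ord0 j)) A)
    (shift_factor_subproof j).

(* Dual to (x_0, ..., x_(i+1)) |-> (x_1, ..., x_(i+1)), a morphism from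
   GG[i+1] to {}^sigma (GG[i]). *)
Definition shift_dual i : khom (ncoord i) (twist s (ncoord i.+1)) :=
  tensor_lift (fun j : 'I_i.+1 => bchange_lift (shift_factor j)).

Lemma ncoord_ext i (R : kalg k) (f g : khom (ncoord i) R) :
  (forall j a, f (nfactor_in j a) = g (nfactor_in j a)) -> f =1 g.
Proof.
move=> fg; apply: tensor_ext => j b.
pose f' := kcomp f (tensor_in (fun j : 'I_i.+1 => power_factor j) j).
pose g' := kcomp g (tensor_in (fun j : 'I_i.+1 => power_factor j) j).
suff: f' =1 g' by exact.
by apply: bchange_ext => a; exact: fg.
Qed.

Lemma ncoord_inE i j a : ncoord_in i (nfactor_in j a) = factor_in j a.
Proof. exact: tensor_liftE. Qed.

Lemma proj_dualE i (j : 'I_i.+1) a :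
  proj_dual i (nfactor_in j a) = nfactor_in (widen_ord (leqnSn i.+1) j) a.
Proof. exact: tensor_liftE. Qed.

Lemma shift_dualE i (j : 'I_i.+1) a :
  shift_dual i (nfactor_in j a) = nfactor_in (lift ord0 j) a.
Proof. by rewrite /shift_dual /nfactor_in tensor_liftE bchange_liftE. Qed.

Lemma ncoord_in_shift i f :
  ncoord_in i.+1 (shift_dual i f) = sact sigcoord (ncoord_in i f).
Proof.
pose h1 := kcomp (twist_map s (ncoord_in i.+1)) (shift_dual i).
pose h2 := kcomp sigcoord_act (ncoord_in i).
suff: h1 =1 h2 by exact.
apply: ncoord_ext => j a.
change (ncoord_in i.+1 (shift_dual i (nfactor_in j a))
  = sigcoord_act (ncoord_in i (nfactor_in j a))).
by rewrite shift_dualE !ncoord_inE sigcoord_actE.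
Qed.

Lemma shift_proj_dual i f :
  shift_dual i.+1 (proj_dual i f) = proj_dual i.+1 (shift_dual i f).
Proof.
pose h1 := kcomp (shift_dual i.+1) (proj_dual i).
pose h2 := kcomp (twist_map s (proj_dual i.+1)) (shift_dual i).
suff: h1 =1 h2 by exact.
apply: ncoord_ext => j a.
change (shift_dual i.+1 (proj_dual i (nfactor_in j a))
  = proj_dual i.+1 (shift_dual i (nfactor_in j a))).
rewrite proj_dualE !shift_dualE proj_dualE.
by congr (nfactor_in _ a); exact: val_inj.
Qed.

(* Evaluation at the identity (1, ..., 1) of GG[i](k), whose j-th component is
   the identity of {}^(sigma^j) GG (k) = GG(twist (sigma^j) k). *)
Definition unit_point i : khom (ncoord i) (kbase k) :=
  tensor_lift (fun j : 'I_i.+1 => bchange_lift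
    (classify (alg_rep GG) (1%g : GG (twist (rpow s j) (kbase k))))).

Lemma unit_pointE i (j : 'I_i.+1) a :
  unit_point i (nfactor_in j a)
    = classify (alg_rep GG) (1%g : GG (twist (rpow s j) (kbase k))) a.
Proof. by rewrite /unit_point /nfactor_in tensor_liftE bchange_liftE. Qed.

Lemma unit_point_shift i f :
  unit_point i.+1 (shift_dual i f) = s (unit_point i f).
Proof.
have s_twist c : s (kstr (kbase k) c) = kstr (twist s (kbase k)) c by [].
pose sh : khom (kbase k) (twist s (kbase k)) :=
  @KHom _ (kbase k) (twist s (kbase k)) s s_twist.
pose h1 := kcomp (twist_map s (unit_point i.+1)) (shift_dual i).
pose h2 := kcomp sh (unit_point i).
suff: h1 =1 h2 by exact.
apply: ncoord_ext => j a.
change (unit_point i.+1 (shift_dual i (nfactor_in j a))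
  = s (unit_point i (nfactor_in j a))).
rewrite shift_dualE !unit_pointE.
have shj_str c : s (kstr (twist (rpow s j) (kbase k)) c)
  = kstr (twist (rpow s (lift ord0 j)) (kbase k)) c by [].
pose shj : khom (twist (rpow s j) (kbase k))
                (twist (rpow s (lift ord0 j)) (kbase k)) :=
  @KHom _ (twist (rpow s j) (kbase k))
    (twist (rpow s (lift ord0 j)) (kbase k)) s shj_str.
rewrite -(fmap1 GG (shj : @mor (kalg_category k) _ _)).
by rewrite classify_natural.
Qed.

End Forget.

Section Growth.
Variables (G : sig_group) (GG : alg_group k) (e : group_nat G (forget GG)).

(* The ideal I(G) n k[GG[i]] defining G[i] in GG[i]. *)
Definition trunc_ideal i (f : ncoord GG i) : Prop :=
  dual e (ncoord_in GG i f) = 0.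

(* Generators of the ideal of k[GG[i]] defining GG_i: for i > 0, GG_i is the
   fibre of G[i] -> G[i-1] <= GG[i-1] over the identity, so one adds to the
   ideal of G[i] the pullbacks of the functions on GG[i-1] that vanish at the
   identity. *)
Definition kernel_eqs i : ncoord GG i -> Prop :=
  if i is i'.+1 return ncoord GG i -> Prop then
    fun f => trunc_ideal f
      \/ exists2 g, unit_point GG i' g = 0 & f = proj_dual GG i' g
  else @trunc_ideal 0.

(* k[GG_i] *)
Definition kernel_coord i : kalg k := quot (@kernel_eqs i).

Fact sigma_kernel_subproof i (f : ncoord GG i) : kernel_eqs f ->
  kcomp (twist_map s (quot_map (@kernel_eqs i.+1))) (shift_dual GG i) f = 0.
Proof.
have trunc_shift l (h : ncoord GG l) :
    trunc_ideal h -> trunc_ideal (shift_dual GG l h : ncoord GG l.+1).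
  by rewrite /trunc_ideal ncoord_in_shift sfunE => ->; exact: rmorph0.
move=> eq_f.
change (quot_map (@kernel_eqs i.+1) (shift_dual GG i f) = 0).
apply: quot_map0; case: i f eq_f => [|i] f; first by move=> /trunc_shift; left.
case=> [/trunc_shift|[g g1 ->]]; first by left.
right; exists (shift_dual GG i g); last exact: shift_proj_dual.
change (unit_point GG i.+1 (shift_dual GG i g) = 0).
by rewrite unit_point_shift [unit_point GG i g]g1; exact: rmorph0.
Qed.

(* Dual to sigma_(i+1) : GG_(i+1) -> {}^sigma (GG_i); note the index shift. *)
Definition sigma_dual i :
    khom (bchange s (kernel_coord i)) (kernel_coord i.+1) :=
  bchange_lift (quot_lift (@sigma_kernel_subproof i)).

(* sigma_i is an isomorphism for all i > m. *)
Definition sigma_iso_above m :=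
  forall i, (m <= i)%N -> bijective (sigma_dual i).

(* GG_m is the growth group of G with respect to e. *)
Definition growth_index m :=
  sigma_iso_above m /\ forall m', sigma_iso_above m' -> (m <= m')%N.

End Growth.
End Difference.

(* Main.v *)
Require Import Defs.
From HB Require Import structures.
From mathcomp Require Import all_boot ssralg poly matrix mxalgebra vector.
From mathcomp Require Import boolp classical_sets ring zify.

Set Implicit Arguments.
Unset Strict Implicit.
Unset Printing Implicit Defensive.

Import GRing.Theory.
Local Open Scope ring_scope.

(** The size of the growth group is the growth rate of the coordinate rings
    [k[G[i]]], and this rate does not depend on the embedding.

    Write [W i] for the image of [k[G[i]]] in [k{G}].  For two embeddings these
    chains of Hopf subalgebras interlace: [W1 i] is contained in [W2 (i + p)] and
    [W2 i] in [W1 (i + q)], with [p] and [q] independent of [i]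
    ([trunc_cofinal]).  Beyond the growth index all kernels of
    [G[i+1] -> G[i]] have coordinate rings of the same dimension [d], because base
    change preserves dimensions ([kernel_dim_above]).  If each step from [W i] to
    [W (i+1)] multiplies a suitable notion of size by exactly [d], then comparing
    the two chains gives [d2 ^ n <= const * d1 ^ n] for all [n], so [d2 <= d1], and
    equality follows by symmetry ([growth_dim_le]).

    The size used is the dimension, over the field of fractions of a fixed domain
    [P], of the localization of [W i] at the nonzero elements of [P]; here [P] is a
    maximal domain inside the first ring of the chain, which makes its localization
    finite-dimensional ([maximal_domain], [generic_dim_exists]).  The groups may be
    non-reduced, so these finite-dimensional algebras can have nilpotent elements.

    That one step multiplies the dimension by [d] is a matter of counting.  For an
    inclusion [B] in [C] of Hopf algebras whose quotient
    [C / B^+ C] has dimension [d], the map [(x, y) |-> (x, x * y)] of the group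
    shows that [C (x)_B C] is free of rank [d] over [C]; this is what a complete
    coframe records ([coframe_exists]), and it survives localization
    ([coframe_localize]).  Let now [B] and [C] be finite-dimensional.  Over the
    residue field of a maximal ideal [m] of [B], the algebra [C / mC] has dimension
    at most [d] ([free_mod_le]).  By induction along a composition series,
    [C (x)_B M] has dimension at most [d * dim M] for every [B]-module [M]
    ([chain_bound]).  The case [M = B] gives [dim C <= d * dim B].  For [M = C]
    there is equality, so no dimension can be lost on [M = C / B] either, and the
    exactness of [C (x)_B B -> C (x)_B C -> C (x)_B C / B -> 0] gives
    [d * dim B <= dim C] ([dim_full_le], [dim_full_ge]).  The last step
    is where the injectivity of [B -> C] enters. *)

(** * Submodules and complements *)

(** Subrings are predicates on one fixed ring, so that a chain of them can be
    compared, localized and measured inside a common ambient ring. *)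
Record subring (T : comPzRingType) := SubRing {
  smem :> T -> Prop;
  smem1 : smem 1;
  smemN1 : smem (-1);
  smemD : forall x y, smem x -> smem y -> smem (x + y);
  smemM : forall x y, smem x -> smem y -> smem (x * y) }.

Lemma smemN (T : comPzRingType) (B : subring T) x : B x -> B (- x).
Proof. by move=> Bx; rewrite -mulN1r; apply: smemM => //; exact: smemN1. Qed.

Lemma smem0 (T : comPzRingType) (B : subring T) : B 0.
Proof. by rewrite -(subrr 1); apply: smemD; [exact: smem1 | exact: smemN1]. Qed.

Definition full_subring (T : comPzRingType) : subring T :=
  @SubRing T (fun _ => True) I I (fun _ _ _ _ => I) (fun _ _ _ _ => I).

Record submod (T : comPzRingType) (B : subring T) (V : lmodType T)
    (U : V -> Prop) : Prop := SubMod {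
  submod0 : U 0;
  submodD : forall x y, U x -> U y -> U (x + y);
  submodZ : forall b x, B b -> U x -> U (b *: x) }.

Section Submod.
Variables (T : comPzRingType) (B : subring T) (V : lmodType T) (U : V -> Prop).
Hypothesis sU : submod B U.

Lemma submodN x : U x -> U (- x).
Proof. by move=> Ux; rewrite -scaleN1r; apply: (submodZ sU) => //; exact: smemN1. Qed.

Lemma submodB x y : U x -> U y -> U (x - y).
Proof. by move=> Ux Uy; apply: (submodD sU) => //; exact: submodN. Qed.

Lemma submodDl x y : U x -> U (x + y) -> U y.
Proof. by move=> Ux Uxy; rewrite -[y](addKr x) addrC; exact: submodB. Qed.

Lemma submod_sum (I : Type) (r : seq I) (P : pred I) (f : I -> V) :
  (forall i, P i -> U (f i)) -> U (\sum_(i <- r | P i) f i).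
Proof.
by move=> Uf; elim/big_ind: _ => //; [exact: (submod0 sU) | exact: (submodD sU)].
Qed.

End Submod.

Section Complement.
Local Open Scope classical_set_scope.
Variables (T : comPzRingType) (B : subring T) (V : lmodType T).
Variables (m : T -> Prop) (U Y : V -> Prop).
Hypothesis m_max : forall b, B b -> ~ m b ->
  exists c, [/\ B c & m (1 - c * b)].
Hypotheses (sU : submod B U) (sY : submod B Y).
Hypothesis mU : forall b v, m b -> U (b *: v).

(** Modulo [U] the ring [B] acts through the field [B / m], so Zorn's lemma gives
    complements as for vector spaces.  The case [m = 0] of a field yields
    functionals and projections; a maximal ideal [m] of a subring [B] yields
    [B]-linear coordinates modulo [m]. *)
Lemma complement_exists : exists W : V -> Prop,
  [/\ submod B W, forall v, U v -> W v, forall v, W v -> Y v -> U v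
    & forall v, exists2 y, Y y & W (v - y)].
Proof.
(* The alternative [W = set0] is only there for the union of the empty chain. *)
pose P (W : set V) :=
  W = set0 \/ [/\ submod B W, forall v, U v -> W v & forall v, W v -> Y v -> U v].
have Pchain (F : set (set V)) : F `<=` P -> total_on F subset ->
    P (\bigcup_(X in F) X).
  move=> FP Ftot; have [[X FX X0]|noX] := pselect (exists2 X, F X & X <> set0).
    right; have [//|[sX UX XY]] := FP X FX; split.
    - split.
      + by exists X => //; exact: (submod0 sX).
      + move=> x y [X1 FX1 X1x] [X2 FX2 X2y].
        have [le12|le21] := Ftot _ _ FX1 FX2.
          have [X20|[s2 _ _]] := FP _ FX2; first by move: X2y; rewrite X20.
          by exists X2 => //; apply: (submodD s2) => //; exact: le12.
        have [X10|[s1 _ _]] := FP _ FX1; first by move: X1x; rewrite X10.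
        by exists X1 => //; apply: (submodD s1) => //; exact: le21.
      + move=> b x Bb [X1 FX1 X1x].
        have [X10|[s1 _ _]] := FP _ FX1; first by move: X1x; rewrite X10.
        by exists X1 => //; exact: (submodZ s1).
    - by move=> v Uv; exists X => //; exact: UX.
    - move=> v [X1 FX1 X1v].
      by have [X10|[_ _]] := FP _ FX1; [move: X1v; rewrite X10 | exact].
  left; rewrite -subset0 => v [X FX Xv].
  by have [X0|X0] := pselect (X = set0); [rewrite -X0 | case: noX; exists X].
have [W [PW Wmax]] := Zorn_bigcup Pchain.
have PU : P U by right; split.
case: PW => [W0|[sW UW WY]].
  have WU : (W `<` U).
    rewrite W0; split; first by move=> x [].
    by move=> /(_ 0); apply; exact: (submod0 sU).
  by case: (Wmax U WU).
exists W; split=> // v; apply: contrapT => Wv.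
pose W' x := exists2 b, B b & W (x - b *: v).
apply: (Wmax W').
  split=> [x Wx|]; first by exists 0; [exact: smem0 | rewrite scale0r subr0].
  move=> /(_ v) W'W; apply: Wv; exists 0; first exact: (submod0 sY).
  rewrite subr0; apply: W'W; exists 1; first exact: smem1.
  by rewrite scale1r subrr; exact: (submod0 sW).
right; split.
- split.
  + by exists 0; [exact: smem0 | rewrite scale0r subr0; exact: (submod0 sW)].
  + move=> x y [b Bb Wx] [c Bc Wy]; exists (b + c); first exact: smemD.
    by rewrite scalerDl opprD addrACA; exact: (submodD sW).
  + move=> b x Bb [c Bc Wx]; exists (b * c); first exact: smemM.
    by rewrite -scalerA -scalerBr; exact: (submodZ sW).
- by move=> u Uu; exists 0; [exact: smem0 | rewrite scale0r subr0; exact: UW].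
- move=> y [b Bb Wy] Yy; have [mb|mb] := pselect (m b).
    apply: WY => //; rewrite -[y](subrK (b *: v)); apply: (submodD sW) Wy _.
    by apply: UW; apply: mU.
  have [c [Bc mc]] := m_max Bb mb; case: Wv; exists (c *: y).
    exact: (submodZ sY).
  have -> : v - c *: y = (1 - c * b) *: v - c *: (y - b *: v).
    rewrite scalerBl scale1r scalerBr scalerA.
    by rewrite opprB addrA subrK.
  apply: (submodB sW); first by apply: UW; apply: mU.
  exact: (submodZ sW).
Qed.

End Complement.

(** * Dimension of a subspace modulo another *)

Definition subspace (F : fieldType) (V : lmodType F) (U : V -> Prop) :=
  submod (full_subring F) U.

Section Dimension.
Variables (F : fieldType) (V : lmodType F).
Implicit Types (U X Y : V -> Prop).

Definition span_mod U (I : finType) (b : I -> V) v :=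
  exists c : I -> F, U (v - \sum_i c i *: b i).

Definition indep_mod U (I : finType) (b : I -> V) :=
  forall c : I -> F, U (\sum_i c i *: b i) -> forall i, c i = 0.

(** Dimensions are relations, relative to a subspace [U] of a possibly
    infinite-dimensional space: finiteness will be a conclusion, not a
    hypothesis. *)
Definition dim_mod U X n := exists b : 'I_n -> V,
  [/\ forall i, X (b i), indep_mod U b & forall x, X x -> span_mod U b x].

Definition zero_space : V -> Prop := fun v => v = 0.

Lemma zero_subspace : subspace zero_space.
Proof.
split=> [//|x y -> ->|b x _ ->]; first by rewrite /zero_space addr0.
by rewrite /zero_space scaler0.
Qed.

Lemma subspace_sum U (I : finType) (c : I -> F) (b : I -> V) :
  subspace U -> (forall i, U (b i)) -> U (\sum_i c i *: b i).
Proof. by move=> sU Ub; apply: (submod_sum sU) => i _; exact: (submodZ sU). Qed.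

(** With more vectors than generators, the matrix of coefficients has a nonzero
    row kernel, which is a relation modulo [U]. *)
Lemma indep_le U (I J : finType) (a : J -> V) (b : I -> V) : subspace U ->
  indep_mod U a -> (forall j, span_mod U b (a j)) -> (#|J| <= #|I|)%N.
Proof.
move=> sU ia /choice [c cP]; rewrite leqNgt; apply/negP => ltIJ.
pose A := \matrix_(j < #|J|, i < #|I|) c (enum_val j) (enum_val i).
have : kermx A != 0.
  by rewrite kermx_eq0 -row_leq_rank -ltnNge (leq_ltn_trans (rank_leq_col A)).
case/rowV0Pn=> x /sub_kermxP xA; apply/negP; rewrite negbK; apply/eqP/rowP => j.
rewrite mxE -(enum_valK j); pose y j := x ord0 (enum_rank j).
suff : y (enum_val j) = 0 by [].
apply: ia; have -> : \sum_j y j *: a j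
    = \sum_j y j *: (a j - \sum_i c j i *: b i).
  rewrite -[LHS]subr0; under [RHS]eq_bigr do rewrite scalerBr.
  rewrite big_split /= sumrN; congr (_ - _).
  under eq_bigr do rewrite scaler_sumr.
  rewrite exchange_big /= big1 // => i _.
  under eq_bigr do rewrite scalerA.
  rewrite -scaler_suml (_ : \sum_j _ = 0) ?scale0r //.
  have := congr1 (fun B : 'rV_ _ => B ord0 (enum_rank i)) xA.
  rewrite !mxE => xA0; rewrite -[RHS]xA0.
  rewrite [RHS](reindex_onto enum_rank enum_val) => [|? _]; last exact: enum_valK.
  by apply: eq_big => [l|l _]; rewrite ?enum_rankK ?eqxx // mxE !enum_rankK.
by apply: subspace_sum.
Qed.

Definition fcons n (x : V) (a : 'I_n -> V) (i : 'I_n.+1) : V :=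
  if unlift ord0 i is Some j then a j else x.

Lemma sum_fcons n x (a : 'I_n -> V) c :
  \sum_i c i *: fcons x a i = c ord0 *: x + \sum_i c (lift ord0 i) *: a i.
Proof.
rewrite big_ord_recl /fcons unlift_none; congr (_ + _).
by apply: eq_bigr => i _; rewrite liftK.
Qed.

Lemma indep_fcons U n x (a : 'I_n -> V) : subspace U ->
  indep_mod U a -> ~ span_mod U a x -> indep_mod U (fcons x a).
Proof.
move=> sU ia nx c; rewrite sum_fcons => Uc.
have [c0|c0] := eqVneq (c ord0) 0; last first.
  case: nx; exists (fun i => - ((c ord0)^-1 * c (lift ord0 i))).
  under eq_bigr do rewrite scaleNr -scalerA.
  rewrite sumrN opprK -scaler_sumr -[x in x + _](scalerK c0) -scalerDr.
  exact: (submodZ sU).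
move: Uc; rewrite c0 scale0r add0r => /ia ci i.
by case: (unliftP ord0 i) => [j|] ->.
Qed.

(** A maximal independent family spans. *)
Lemma dim_exists U X (I : finType) (b : I -> V) : subspace U ->
  (forall x, X x -> span_mod U b x) -> exists2 n, (n <= #|I|)%N & dim_mod U X n.
Proof.
move=> sU bX.
pose P n := `[< exists a : 'I_n -> V, (forall i, X (a i)) /\ indep_mod U a >].
have P0 : exists n, P n.
  by exists 0%N; apply/asboolP; exists (fun=> 0); split=> [[]|c _ []].
have Pmax n : P n -> (n <= #|I|)%N.
  move=> /asboolP[a [Xa ia]]; rewrite -(card_ord n).
  by apply: indep_le sU ia _ => j; exact: bX.
have [n /asboolP[a [Xa ia]] nmax] := ex_maxnP P0 Pmax.
exists n; first by apply: Pmax; apply/asboolP; exists a.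
exists a; split=> // x Xx; apply: contrapT => nx.
suff : P n.+1 by move=> /nmax; rewrite ltnn.
apply/asboolP; exists (fcons x a); split; last exact: indep_fcons.
by move=> i; rewrite /fcons; case: unlift.
Qed.

Lemma dim_sub U X Y n : subspace U -> (forall x, X x -> Y x) ->
  dim_mod U Y n -> exists2 m, (m <= n)%N & dim_mod U X m.
Proof.
move=> sU XY [b [_ _ bY]]; rewrite -(card_ord n).
by apply: (dim_exists (b := b)) => // x /XY; exact: bY.
Qed.

Lemma dim_le U X Y n m : subspace U -> (forall x, X x -> Y x) ->
  dim_mod U X n -> dim_mod U Y m -> (n <= m)%N.
Proof.
move=> sU XY [a [Xa ia _]] [b [_ _ bY]]; rewrite -(card_ord n) -(card_ord m).
by apply: indep_le sU ia _ => j; exact/bY/XY.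
Qed.

Lemma dim_unique U X n m : subspace U ->
  dim_mod U X n -> dim_mod U X m -> n = m.
Proof.
move=> sU dn dm; apply/eqP.
by rewrite eqn_leq !(dim_le sU _ dn dm, dim_le sU _ dm dn).
Qed.

Lemma dim0_sub U X : dim_mod U X 0 -> forall x, X x -> U x.
Proof. by move=> [b [_ _ bX]] x /bX[c]; rewrite big_ord0 subr0. Qed.

Definition fcat n m (a : 'I_n -> V) (b : 'I_m -> V) (i : 'I_(n + m)) : V :=
  match split i with inl j => a j | inr j => b j end.

Lemma sum_fcat n m (a : 'I_n -> V) (b : 'I_m -> V) c :
  \sum_i c i *: fcat a b i =
  \sum_i c (lshift m i) *: a i + \sum_i c (rshift n i) *: b i.
Proof.
rewrite big_split_ord /fcat; congr (_ + _); apply: eq_bigr => i _.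
  by rewrite (unsplitK (inl i)).
by rewrite (unsplitK (inr i)).
Qed.

Definition coef_cat n m (c : 'I_n -> F) (d : 'I_m -> F) (i : 'I_(n + m)) : F :=
  match split i with inl j => c j | inr j => d j end.

Lemma sum_coef_cat n m (a : 'I_n -> V) (b : 'I_m -> V) c d :
  \sum_i coef_cat c d i *: fcat a b i =
  \sum_i c i *: a i + \sum_i d i *: b i.
Proof.
rewrite sum_fcat; congr (_ + _); apply: eq_bigr => i _; rewrite /coef_cat.
  by rewrite (unsplitK (inl i)).
by rewrite (unsplitK (inr i)).
Qed.

Lemma dim_add U X Y n m : subspace U -> subspace X ->
  (forall x, U x -> X x) -> (forall x, X x -> Y x) ->
  dim_mod U X n -> dim_mod X Y m -> dim_mod U Y (n + m).
Proof.
move=> sU sX UX XY [a [Xa ia aX]] [b [Yb ib bY]]; exists (fcat a b); split.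
- by move=> i; rewrite /fcat; case: split => j //; exact: XY.
- move=> c; rewrite sum_fcat => Uc.
  have cb : forall i, c (rshift n i) = 0.
    by apply: ib; apply: (submodDl sX) (UX _ Uc); exact: subspace_sum.
  have ca : forall i, c (lshift m i) = 0.
    apply: ia; move: Uc; rewrite [X in _ + X]big1 ?addr0 // => i _.
    by rewrite cb scale0r.
  by move=> i; case: (split_ordP i) => j ->.
- move=> y /bY[d /aX[c Uc]]; exists (coef_cat c d).
  by rewrite sum_coef_cat opprD addrA addrAC.
Qed.

Lemma dim_exists_mod U X Y n : subspace U -> subspace X ->
  (forall x, U x -> X x) -> (forall x, X x -> Y x) -> dim_mod U Y n ->
  exists m l, [/\ dim_mod U X m, dim_mod X Y l & n = (m + l)%N].
Proof.
move=> sU sX UX XY dY; have [m _ dX] := dim_sub sU XY dY.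
have [b [_ _ bY]] := dY.
have [|l _ dXY] := @dim_exists X Y _ b sX.
  by move=> y /bY[c /UX]; exists c.
exists m, l; split=> //; apply: (dim_unique sU dY); exact: (dim_add sU sX).
Qed.

Lemma dim_mod_eq0 U X n : subspace U -> (forall x, X x -> U x) ->
  dim_mod U X n -> n = 0%N.
Proof.
move=> sU XU [b [Xb ib _]]; case: n b Xb ib => // n b Xb ib.
have : U (\sum_i (i == ord0)%:R *: b i).
  apply: (submod_sum sU) => i _; apply: (submodZ sU) => //; exact/XU.
by move=> /ib/(_ ord0)/eqP; rewrite eqxx oner_eq0.
Qed.

Lemma span_trans U X n m (y : 'I_n -> V) (z : 'I_m -> V) v :
  (forall x, X x -> span_mod U y x) -> span_mod X z v ->
  span_mod U (fcat y z) v.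
Proof.
move=> yX [d /yX[c Uc]]; exists (coef_cat c d).
by rewrite sum_coef_cat opprD addrA addrAC.
Qed.

Lemma span_reindex U (I : finType) (y : I -> V) v :
  span_mod U y v -> span_mod U (fun i : 'I_#|I| => y (enum_val i)) v.
Proof.
move=> [c Uc]; exists (fun i => c (enum_val i)).
rewrite (reindex_onto enum_rank enum_val) => [|? _]; last exact: enum_valK.
rewrite (eq_big xpredT (fun j => c j *: y j)) // => [j|j _].
  by rewrite enum_rankK eqxx.
by rewrite enum_rankK.
Qed.

Definition whole : V -> Prop := fun=> True.

Definition has_dim_in X n := dim_mod zero_space X n.

Lemma dim_bounded N :
  (forall m (b : 'I_m -> V), indep_mod zero_space b -> (m <= N)%N) ->
  exists m, has_dim_in whole m.
Proof.
move=> bound; pose P m := `[< exists b : 'I_m -> V, indep_mod zero_space b >].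
have P0 : exists m, P m.
  by exists 0%N; apply/asboolP; exists (fun=> 0) => c _ [].
have Pmax m : P m -> (m <= N)%N by move=> /asboolP[b]; exact: bound.
have [m /asboolP[b ib] mmax] := ex_maxnP P0 Pmax; exists m, b; split=> // x _.
apply: contrapT => nx; suff : P m.+1 by move=> /mmax; rewrite ltnn.
apply/asboolP; exists (fcons x b).
exact: indep_fcons zero_subspace ib nx.
Qed.

(** The coordinates along [b], read modulo a complement of its span that contains
    [U]. *)
Lemma dual_family U (I : finType) (b : I -> V) : subspace U -> indep_mod U b ->
  exists nu : I -> V -> F,
  [/\ forall i x y, nu i (x + y) = nu i x + nu i y,
      forall i c x, nu i (c *: x) = c * nu i x,
      forall i u, U u -> nu i u = 0 & forall i j, nu i (b j) = (i == j)%:R].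
Proof.
move=> sU ib; pose Y v := exists c : I -> F, v = \sum_i c i *: b i.
have sY : subspace Y.
  split.
  - by exists (fun=> 0); rewrite big1 // => i _; rewrite scale0r.
  - move=> _ _ [c ->] [d ->]; exists (fun i => c i + d i).
    by rewrite -big_split; apply: eq_bigr => i _; rewrite scalerDl.
  - move=> e _ _ [c ->]; exists (fun i => e * c i).
    by rewrite scaler_sumr; apply: eq_bigr => i _; rewrite scalerA.
have [] := @complement_exists F (full_subring F) V (fun c => c = 0) U Y _ sU sY.
- move=> c _ /eqP c0; exists c^-1; split=> //; by rewrite mulVf // subrr.
- by move=> c v ->; rewrite scale0r; exact: (submod0 sU).
move=> W [sW UW WY WYV].
have /choice[c cW] : forall v, exists c : I -> F, W (v - \sum_i c i *: b i).
  by move=> v; have [_ [c ->] Wc] := WYV v; exists c.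
have uniq v d : W (v - \sum_i d i *: b i) -> forall i, c v i = d i.
  move=> Wd i; apply/subr0_eq; move: i.
  apply: (ib (fun i => c v i - d i)); apply: WY; last by eexists.
  have -> : \sum_i (c v i - d i) *: b i
      = (v - \sum_i d i *: b i) - (v - \sum_i c v i *: b i).
    under eq_bigr do rewrite scalerBl.
    by rewrite sumrB opprB [RHS]addrC subrKA.
  exact: (submodB sW).
exists (fun i v => c v i); split.
- move=> i x y; apply: (uniq _ (fun i => c x i + c y i)).
  under eq_bigr do rewrite scalerDl.
  by rewrite big_split opprD addrACA; exact: (submodD sW).
- move=> i e x; apply: (uniq _ (fun i => e * c x i)).
  under eq_bigr do rewrite -scalerA.
  by rewrite -scaler_sumr -scalerBr; exact: (submodZ sW).
- move=> i u Uu; apply: (uniq _ (fun=> 0)).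
  by rewrite big1 ?subr0 => [|j _]; [exact: UW | rewrite scale0r].
- move=> i j; apply: (uniq _ (fun i => (i == j)%:R)).
  rewrite (bigD1 j) //= eqxx scale1r big1 ?addr0 ?subrr; first exact: (submod0 sW).
  by move=> l /negPf->; rewrite scale0r.
Qed.

Lemma linear_projection X : subspace X -> exists p : V -> V,
  [/\ forall x y, p (x + y) = p x + p y, forall c x, p (c *: x) = c *: p x,
      forall x, X (p x) & forall x, X x -> p x = x].
Proof.
move=> sX.
have [] := @complement_exists F (full_subring F) V (fun c => c = 0) zero_space X
  _ zero_subspace sX.
- move=> c _ /eqP c0; exists c^-1; split=> //; by rewrite mulVf // subrr.
- by move=> c v ->; rewrite scale0r.
move=> W [sW _ WX WXV].
have /choice[p pP] : forall v, exists y, X y /\ W (v - y).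
  by move=> v; have [y Xy Wy] := WXV v; exists y.
have uniq v x : X x -> W (v - x) -> p v = x.
  move=> Xx Wx; have [Xp Wp] := pP v; apply/subr0_eq/WX; last first.
    exact: (submodB sX).
  have -> : p v - x = (v - x) - (v - p v) by rewrite opprB [RHS]addrC subrKA.
  exact: (submodB sW).
exists p; split.
- move=> x y; have [[Xx Wx] [Xy Wy]] := (pP x, pP y); apply: uniq.
    exact: (submodD sX).
  by rewrite opprD addrACA; exact: (submodD sW).
- move=> c x; have [Xx Wx] := pP x; apply: uniq; first exact: (submodZ sX).
  by rewrite -scalerBr; exact: (submodZ sW).
- by move=> x; have [] := pP x.
- by move=> x Xx; apply: uniq => //; rewrite subrr; exact: (submod0 sW).
Qed.

End Dimension.

Arguments zero_space {F V}.
Arguments whole {F V}.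

(** * Ideals and quotient algebras *)

(** Adding one multiple at a time makes membership directly amenable to
    induction. *)
Inductive ideal (A : comPzRingType) (S : A -> Prop) : A -> Prop :=
  | ideal0 : ideal S 0
  | ideal_cons s c a : S s -> ideal S a -> ideal S (s * c + a).

Section Ideal.
Variables (A : comPzRingType) (S : A -> Prop).

Lemma ideal_gen s : S s -> ideal S s.
Proof. by move=> Ss; rewrite -[s]mulr1 -[_ * _]addr0; exact/ideal_cons/ideal0. Qed.

Lemma idealD a b : ideal S a -> ideal S b -> ideal S (a + b).
Proof.
move=> Ia Ib; elim: Ia => [|s c {}a Ss _ IH]; first by rewrite add0r.
by rewrite -addrA; exact: ideal_cons.
Qed.

Lemma idealM c a : ideal S a -> ideal S (c * a).
Proof.
elim=> [|s d b Ss _ IH]; first by rewrite mulr0; exact: ideal0.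
by rewrite mulrDr mulrCA; exact: ideal_cons.
Qed.

Lemma idealMr c a : ideal S a -> ideal S (a * c).
Proof. by rewrite mulrC; exact: idealM. Qed.

Lemma idealN a : ideal S a -> ideal S (- a).
Proof. by rewrite -mulN1r; exact: idealM. Qed.

Lemma ideal_ind_closed (J : A -> Prop) : J 0 ->
  (forall a b, J a -> J b -> J (a + b)) -> (forall c a, J a -> J (c * a)) ->
  (forall s, S s -> J s) -> forall a, ideal S a -> J a.
Proof.
move=> J0 JD JM SJ a; elim=> // s c b Ss _ Jb.
by apply: JD => //; rewrite mulrC; exact/JM/SJ.
Qed.

Lemma ideal_submod (B : subring A) : submod B (ideal S : A^o -> Prop).
Proof.
split=> [|x y|b x _]; [exact: ideal0 | exact: idealD | exact: idealM].
Qed.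

End Ideal.

(** The relations presenting the quotient hold in [A] modulo the ideal when terms
    are evaluated in [A] itself, hence so do all their consequences. *)
Lemma quot_map_ker (k : fieldType) (A : kalg k) (S : A -> Prop) a :
  quot_map S a = 0 -> ideal S a.
Proof.
have eqvI t u : eqv (quot_rel S) t u ->
    ideal S (eval (@id A) t - eval (@id A) u).
  { elim=> {t u} /= [t u|t|t u _ IH|t u v _ IH1 _ IH2|t t' u u' _ IH1 _ IH2
    |t t' _ IH|t t' u u' _ IH1 _ IH2|c d|c d|t u w|t u|t|t|t u w|t u|t|t u w].
  - case=> [c|x y|x y|x Sx] /=; rewrite ?subrr; try exact: ideal0.
    by rewrite rmorph0 subr0; exact: ideal_gen.
  - by rewrite subrr; exact: ideal0.
  - by rewrite -opprB; exact: idealN.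
  - by rewrite -(subrKA (eval id u)); exact: idealD.
  - by rewrite opprD addrACA; exact: idealD.
  - by rewrite -opprD; exact: idealN.
  - have -> : eval id t * eval id u - eval id t' * eval id u'
      = eval id t * (eval id u - eval id u')
        + eval id u' * (eval id t - eval id t') by ring.
    by apply: idealD; exact: idealM.
  all: rewrite ?(rmorph0, rmorph1, rmorphD, rmorphM).
  all: rewrite (_ : _ - _ = 0);
    first [exact: ideal0 | apply/eqP; rewrite subr_eq0; apply/eqP].
  all: first [by [] | exact: addrA | exact: addrC | exact: add0r | exact: addNr
    | exact: mulrA | exact: mulrC | exact: mul1r | exact: mulrDl]. }
rewrite -(rmorph0 (kstr (quot S))) => /clsP/eqvI /=.
by rewrite rmorph0 subr0.
Qed.

(** * Coframes *)

(** A coframe and its completeness say that [C (x)_B C] is free of rank [d] over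
    its left factor, without forming this tensor product: [delta] lists the
    coordinates of [1 (x) c], the sum over [s] is the value of the [j]-th
    coordinate on the [i]-th basis vector, and completeness is the universal
    property, tested on maps into [C]-algebras. *)
Record coframe (C : comPzRingType) (B : subring C) (d : nat)
    (delta : 'I_d -> C -> C) : Prop := Coframe {
  coframeD : forall i x y, delta i (x + y) = delta i x + delta i y;
  coframeM : forall i b x, B b -> delta i (b * x) = b * delta i x;
  coframe_dual : forall i, exists s : seq (C * C),
    forall j, \sum_(z <- s) z.1 * delta j z.2 = (i == j)%:R }.

Definition complete (C : comPzRingType) (B : subring C) (d : nat)
    (delta : 'I_d -> C -> C) : Prop :=
  forall (M : comPzRingType) (h : {rmorphism C -> M}) (g : C -> M),
    (forall x y, g (x + y) = g x + g y) ->
    (forall b x, B b -> g (b * x) = h b * g x) ->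
  exists m : 'I_d -> M, forall c, g c = \sum_i h (delta i c) * m i.

Lemma left_inverse_le (M : comPzRingType) r d (Y : 'M[M]_(r, d))
  (X : 'M[M]_(d, r)) : 1 != 0 :> M -> Y *m X = 1%:M -> (r <= d)%N.
Proof.
move=> nz; pose N : comNzRingType :=
  HB.pack (GRing.ComPzRing.sort M) (GRing.PzSemiRing_isNonZero.Build M nz).
exact: (@mulmx1_min N).
Qed.

Section Rank.
Variables (F : fieldType) (C : kalg F) (B : subring C).
Variables (d : nat) (delta : 'I_d -> C -> C).
Hypothesis cpl : complete B delta.
Variable m : C -> Prop.
Hypothesis m1 : ~ m 1.
Hypothesis m_max : forall b, B b -> ~ m b ->
  exists c, [/\ B c & m (1 - c * b)].

(** Linear independence in [C / mC] over the field [B / m]. *)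
Definition free_mod r (w : 'I_r -> C) := forall b : 'I_r -> C,
  (forall i, B (b i)) -> ideal m (\sum_i b i * w i) -> forall i, m (b i).

(** The [r] coordinates along [w] extend to [B]-linear maps from [C] to [C / mC].
    By completeness each of them is a combination of the [d] maps [delta], so the
    identity matrix of size [r] over [C / mC] factors through size [d]. *)
Lemma free_mod_le r (w : 'I_r -> C) : free_mod w -> (r <= d)%N.
Proof.
move=> fw; have [->//|r0] := posnP r.
pose Y (v : C^o) := exists2 b : 'I_r -> C, forall i, B (b i) & v = \sum_i b i * w i.
have sY : submod B Y.
  split.
  - exists (fun=> 0); [by move=> i; exact: smem0 | by rewrite big1 // => i; rewrite mul0r].
  - move=> _ _ [b Bb ->] [c Bc ->]; exists (fun i => b i + c i).
      by move=> i; exact: smemD.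
    by rewrite -big_split; apply: eq_bigr => i _; rewrite mulrDl.
  - move=> e _ Be [b Bb ->]; exists (fun i => e * b i).
      by move=> i; exact: smemM.
    by rewrite scaler_sumr; apply: eq_bigr => i _; rewrite -mulrA.
have mU (b : C) (v : C^o) : m b -> ideal m (b *: v).
  by move=> mb; apply: idealMr; exact: ideal_gen.
have [W [sW UW WY WYV]] := complement_exists m_max (ideal_submod m B) sY mU.
have /choice[c cP] : forall v : C^o, exists b : 'I_r -> C,
    (forall i, B (b i)) /\ W (v - \sum_i b i * w i).
  by move=> v; have [_ [b Bb ->] Wb] := WYV v; exists b.
have uniq v b : (forall i, B (b i)) -> W (v - \sum_i b i * w i) ->
    forall i, quot_map m (c v i) = quot_map m (b i).
  move=> Bb Wb i; have [Bc Wc] := cP v; apply/subr0_eq.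
  rewrite -rmorphB; apply: quot_map0; move: i.
  apply: (fw (fun i => c v i - b i)).
    by move=> i; apply: smemD => //; exact: smemN.
  apply: WY; last first.
    by eexists; last reflexivity; move=> i; apply: smemD => //; exact: smemN.
  have -> : \sum_i (c v i - b i) * w i
      = (v - \sum_i b i * w i) - (v - \sum_i c v i * w i).
    under eq_bigr do rewrite mulrBl.
    by rewrite sumrB opprB [RHS]addrC subrKA.
  exact: (submodB sW).
have /choice[M MP] : forall i, exists M : 'I_d -> quot m,
    forall x, quot_map m (c x i) = \sum_j quot_map m (delta j x) * M j.
  move=> i; apply: (cpl (h := quot_map m) (g := fun x => quot_map m (c x i))).
    move=> x y; have [[Bx Wx] [By Wy]] := (cP x, cP y).
    rewrite -rmorphD; apply: (uniq _ (fun i => c x i + c y i)).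
      by move=> j; exact: smemD.
    under eq_bigr do rewrite mulrDl.
    by rewrite big_split opprD addrACA; exact: (submodD sW).
  move=> b x Bb; have [Bx Wx] := cP x.
  rewrite -rmorphM; apply: (uniq _ (fun i => b * c x i)).
    by move=> j; exact: smemM.
  under eq_bigr do rewrite -mulrA.
  by rewrite -mulr_sumr -mulrBr; exact: (submodZ sW).
have [q0|] := eqVneq (1 : quot m) 0.
  have I1 : ideal m 1 by apply: quot_map_ker; rewrite rmorph1.
  case: m1; apply: (fw (fun=> 1) _ _ (Ordinal r0)); first by move=> _; exact: smem1.
  by rewrite -[X in ideal m X]mulr1; exact: idealM.
move=> q1; apply: (@left_inverse_le _ _ _ (\matrix_(i, j) M i j)
  (\matrix_(j, i) quot_map m (delta j (w i))) q1).
apply/matrixP => i j; rewrite !mxE; under eq_bigr do rewrite !mxE mulrC.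
rewrite -MP -(rmorph_nat (quot_map m)).
apply: (uniq _ (fun i => (i == j)%:R)).
  by move=> l; case: (l == j); [exact: smem1 | exact: smem0].
rewrite (bigD1 j) //= eqxx mul1r big1 ?addr0 ?subrr; first exact: (submod0 sW).
by move=> l /negPf->; rewrite mul0r.
Qed.

(** A free family of maximal size generates [C / mC] over [B / m]; multiplying it
    by generators [f] of [B / m] over [F] gives generators over [F]. *)
Lemma generators_mod q (f : 'I_q -> C) : (forall i, B (f i)) ->
  (forall b, B b -> span_mod (m : kmod C -> Prop) f b) ->
  exists2 r, (r <= d)%N & exists y : 'I_q * 'I_r -> kmod C,
    forall c, span_mod (ideal m : kmod C -> Prop) y c.
Proof.
move=> Bf fB; pose P r := `[< exists w : 'I_r -> C, free_mod w >].
have P0 : exists r, P r.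
  by exists 0%N; apply/asboolP; exists (fun=> 0) => b _ _ [].
have [r /asboolP[w fw] rmax] := ex_maxnP P0 (fun r Pr =>
  let: ex_intro w fw := asboolW Pr in free_mod_le fw).
exists r; first exact: free_mod_le fw.
have wP c : exists2 b : 'I_r -> C, (forall i, B (b i)) &
    ideal m (c - \sum_i b i * w i).
  apply: contrapT => nc; suff : P r.+1 by move=> /rmax; rewrite ltnn.
  apply/asboolP; exists (fun i => if unlift ord0 i is Some j then w j else c).
  move=> b Bb; rewrite big_ord_recl unlift_none.
  under eq_bigr do rewrite liftK.
  move=> Ib; have [mb|mb] := pselect (m (b ord0)).
    have mb' : forall i, m (b (lift ord0 i)).
      apply: fw => [i|]; first exact: Bb.
      rewrite -[\sum_i _](addKr (b ord0 * c)).
      by apply: idealD => //; apply/idealN/idealMr/ideal_gen.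
    by move=> i; case: (unliftP ord0 i) => [j|] ->.
  have [e [Be me]] := m_max (Bb ord0) mb; case: nc.
  exists (fun i => - (e * b (lift ord0 i))).
    by move=> i; apply: smemN; exact: smemM.
  under eq_bigr do rewrite mulNr -mulrA.
  rewrite sumrN opprK -mulr_sumr.
  have -> : c = (1 - e * b ord0) * c + e * (b ord0 * c) by ring.
  rewrite -addrA -mulrDr; apply: idealD; last exact: idealM.
  by apply/idealMr/ideal_gen.
exists (fun ij => f ij.1 * w ij.2) => c; change (kcar C : Type) in c.
have [b Bb Ib] := wP c.
have /choice[e eP] : forall j, exists e : 'I_q -> F,
  m (b j - \sum_i kstr C (e i) * f i) by move=> j; exact/fB/Bb.
exists (fun ij => e ij.2 ij.1).
change (ideal m (c - \sum_ij kstr C (e ij.2 ij.1) * (f ij.1 * w ij.2))).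
rewrite -(pair_bigA _ (fun i j => kstr C (e j i) * (f i * w j))) /=.
rewrite exchange_big /=.
have -> : c - \sum_j \sum_i kstr C (e j i) * (f i * w j) =
    (c - \sum_j b j * w j)
    + \sum_j (b j - \sum_i kstr C (e j i) * f i) * w j.
  rewrite [X in _ = _ + X](eq_bigr (fun j => b j * w j -
    (\sum_i kstr C (e j i) * f i) * w j)); last by move=> j _; rewrite mulrBl.
  rewrite sumrB addrA subrK; congr (_ - _); apply: eq_bigr => j _.
  by rewrite mulr_suml; apply: eq_bigr => i _; exact: mulrA.
apply: idealD => //; elim/big_ind: _ => [|x y|j _].
- exact: ideal0.
- exact: idealD.
- by apply/idealMr/ideal_gen.
Qed.

End Rank.

(** * Dimension counts along a coframe *)

(** An alias that lets a [C]-module carry the scalars of the base field too. *)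
Definition base_module (F : fieldType) (C : kalg F) (L : lmodType C) : Type := L.
HB.instance Definition _ F C L := GRing.Zmodule.on (@base_module F C L).

Section BaseModule.
Variables (F : fieldType) (C : kalg F) (L : lmodType C).
Let scale (c : F) (v : base_module L) : base_module L := kstr C c *: (v : L).
Fact base_scalerA a b v : scale a (scale b v) = scale (a * b) v.
Proof. by rewrite /scale rmorphM scalerA. Qed.
Fact base_scale1r : left_id 1 scale.
Proof. by move=> v; rewrite /scale rmorph1 scale1r. Qed.
Fact base_scalerDr : right_distributive scale +%R.
Proof. by move=> c u v; exact: scalerDr. Qed.
Fact base_scalerDl v : {morph scale^~ v : a b / a + b}.
Proof. by move=> a b; rewrite /scale rmorphD scalerDl. Qed.
HB.instance Definition _ := GRing.Zmodule_isLmodule.Build F (base_module L)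
  base_scalerA base_scale1r base_scalerDr base_scalerDl.

Lemma base_scaleE (a : F) (v : base_module L) : a *: v = kstr C a *: (v : L).
Proof. by []. Qed.

End BaseModule.

Section Chain.
Variables (F : fieldType) (C : kalg F) (B : subring C).
Hypothesis FB : forall c, B (kstr C c).
Variables (d : nat) (delta : 'I_d -> C -> C).
Hypothesis cpl : complete B delta.

Lemma kmod_subspace (U : C -> Prop) :
  submod B (U : C^o -> Prop) -> subspace (U : kmod C -> Prop).
Proof.
move=> sU; split=> [|x y|b x _]; [exact: (submod0 sU) | exact: (submodD sU)|].
exact: (submodZ sU).
Qed.

(** A composition series of [M2 / M1] filters [C (x)_B M2 / M1] by the modules
    [C (x)_B B / m = C / mC], whose dimensions [generators_mod] bounds.  The map
    [phi] and the modules [L1], [L2] stand for quotients of this tensor product: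
    [L2 / L1] is generated by the image of [M2 / M1]. *)
Lemma chain_bound (L : lmodType C) (phi : C -> L) n (M1 M2 : C -> Prop)
    (L1 : L -> Prop) :
  (forall x y, phi (x + y) = phi x + phi y) ->
  (forall b x, B b -> phi (b * x) = b *: phi x) ->
  submod B (M1 : C^o -> Prop) -> submod B (M2 : C^o -> Prop) ->
  (forall x, M1 x -> M2 x) ->
  dim_mod (M1 : kmod C -> Prop) (M2 : kmod C -> Prop) n ->
  submod (full_subring C) L1 -> (forall x, M1 x -> L1 (phi x)) ->
  exists L2 : L -> Prop, [/\ submod (full_subring C) L2,
    forall x, M2 x -> L2 (phi x) &
    exists N, (N <= d * n)%N /\ exists y : 'I_N -> base_module L,
      forall l, L2 l -> span_mod (L1 : base_module L -> Prop) y l].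
Proof.
move=> phiD phiM; elim/ltn_ind: n M1 L1 => n IHn M1 L1 sM1 sM2 M12 dn sL1 phiL1.
have [n0|n_gt0] := posnP n.
  exists L1; split=> //; first by move: dn; rewrite n0 => /dim0_sub M21 x /M21/phiL1.
  exists 0%N; split=> //; exists (fun=> 0) => l Ll; exists (fun=> 0).
  by rewrite big_ord0 subr0.
pose Q q := `[< (0 < q)%N /\ exists M' : C -> Prop,
  [/\ submod B (M' : C^o -> Prop), forall x, M1 x -> M' x, forall x, M' x -> M2 x
    & dim_mod (M1 : kmod C -> Prop) M' q] >].
(* A submodule [M'] of minimal dimension [q] above [M1] makes [M' / M1] simple. *)
have Qn : exists q, Q q by exists n; apply/asboolP; split=> //; exists M2.
have [q /asboolP[q_gt0 [M' [sM' M1' M'2 dq]]] qmin] := ex_minnP Qn.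
have ssM1 := kmod_subspace sM1; have ssM' := kmod_subspace sM'.
have [v M'v M1v] : exists2 v, M' v & ~ M1 v.
  apply: contrapT => nv; suff q0 : q = 0%N by rewrite q0 in q_gt0.
  apply: (dim_mod_eq0 ssM1 _ dq) => x M'x; apply: contrapT => M1x.
  by apply: nv; exists x.
have M'gen b : B b -> ~ M1 (b * v) -> forall x, M' x ->
    exists2 c, B c & M1 (x - c * (b * v)).
  move=> Bb nbv; pose M'' x := exists2 c, B c & M1 (x - c * (b * v)).
  have M''M' x : M'' x -> M' x.
    move=> [c Bc M1x]; rewrite -[x](subrK (c * (b * v))).
    apply: (submodD sM') (M1' _ M1x) _; apply: (submodZ sM') Bc _.
    exact: (submodZ sM').
  have M1M'' x : M1 x -> M'' x.
    by move=> M1x; exists 0; [exact: smem0 | rewrite mul0r subr0].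
  have sM'' : submod B (M'' : C^o -> Prop).
    split=> [|x y [c Bc Mx] [e Be My]|a x Ba [c Bc Mx]].
    - exact/M1M''/(submod0 sM1).
    - exists (c + e); first exact: smemD.
      by rewrite mulrDl opprD addrACA; exact: (submodD sM1).
    - exists (a * c); first exact: smemM.
      by rewrite -mulrA -mulrBr; exact: (submodZ sM1).
  have [p [l [dp dl qE]]] :=
    dim_exists_mod ssM1 (kmod_subspace sM'') M1M'' M''M' dq.
  have Qp : Q p.
    apply/asboolP; split; last by exists M''; split=> // x /M''M'; exact: M'2.
    rewrite lt0n; apply/eqP => p0; move: dp; rewrite p0 => /dim0_sub M''1.
    apply/nbv/M''1; exists 1; first exact: smem1.
    by rewrite mul1r subrr; exact: (submod0 sM1).
  move: (qmin p Qp); rewrite qE -{2}[p]addn0 leq_add2l leqn0 => /eqP l0.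
  by move: dl; rewrite l0 => /dim0_sub.
(* The annihilator of [v] modulo [M1], so that [M' / M1] is a copy of [B / m]. *)
pose m b := B b /\ M1 (b * v).
have m1 : ~ m 1 by move=> [_]; rewrite mul1r.
have m_max b : B b -> ~ m b -> exists c, [/\ B c & m (1 - c * b)].
  move=> Bb mb; have [|c Bc Mc] := M'gen b Bb _ v M'v.
    by move=> Mbv; apply: mb.
  exists c; split=> //; split; last by rewrite mulrBl mul1r -mulrA.
  by apply: smemD; [exact: smem1 | apply: smemN; exact: smemM].
have M'1 x : M' x -> exists2 c, B c & M1 (x - c * v).
  move=> M'x; have [|c Bc Mc] := M'gen 1 (smem1 B) _ x M'x; first by rewrite mul1r.
  by exists c => //; rewrite -[v]mul1r.
have [e0 [M'e ie eM']] := dq; pose e : 'I_q -> C := e0.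
have /choice[f fP] : forall i, exists c, B c /\ M1 (e i - c * v).
  by move=> i; have [c] := M'1 _ (M'e i); exists c.
have [||r rd [y yC]] := generators_mod cpl m1 m_max (f := f).
- by move=> i; have [] := fP i.
- move=> b Bb; have [|c Mc] := eM' (b * v); first exact: (submodZ sM').
  exists c; change (m (b - \sum_i kstr C (c i) * f i)); split.
    apply: smemD => //; apply: smemN.
    elim/big_ind: _ => [|*|i _]; [exact: smem0 | exact: smemD | ].
    by apply: smemM => //; have [] := fP i.
  have -> : (b - \sum_i kstr C (c i) * f i) * v
      = (b * v - \sum_i kstr C (c i) * e i)
        + \sum_i kstr C (c i) * (e i - f i * v).
    rewrite [X in _ = _ + X](eq_bigr (fun i => kstr C (c i) * e i -
      kstr C (c i) * (f i * v))); last by move=> i _; rewrite mulrBr.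
    rewrite sumrB addrA subrK mulrBl mulr_suml; congr (_ - _).
    by apply: eq_bigr => i _; rewrite mulrA.
  apply: (submodD sM1) Mc _; apply: (submod_sum sM1) => i _.
  by apply: (submodZ sM1) => //; have [] := fP i.
pose L' l := exists c, L1 (l - c *: phi v).
have sL' : submod (full_subring C) L'.
  split=> [|x z [c Lx] [a Lz]|a x _ [c Lx]].
  - by exists 0; rewrite scale0r subr0; exact: (submod0 sL1).
  - by exists (c + a); rewrite scalerDl opprD addrACA; exact: (submodD sL1).
  - by exists (a * c); rewrite -scalerA -scalerBr; exact: (submodZ sL1).
have phiL' x : M' x -> L' (phi x).
  move=> /M'1[c Bc Mc]; exists c; rewrite -phiM // -[phi x](addrK (phi (c * v))).
  have phiN z : phi (- z) = - phi z.
    by apply/eqP; rewrite -addr_eq0 -phiD addNr -(mul0r 0) phiM ?scale0r //; exact: smem0.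
  by rewrite addrK -phiN -phiD; exact: phiL1.
have [p [l [dp dl nE]]] := dim_exists_mod ssM1 ssM' M1' M'2 dn.
have pq := dim_unique ssM1 dp dq; rewrite {p}pq in dp nE.
have ln : (l < n)%N by rewrite nE -{1}[l]add0n ltn_add2r.
have [L2 [sL2 phiL2 [N [Nd [z zL2]]]]] := IHn l ln M' L' sM' sM2 M'2 dl sL' phiL'.
exists L2; split=> //; exists (#|{: 'I_q * 'I_r}| + N)%N; split.
  rewrite nE mulnDr leq_add // card_prod !card_ord mulnC.
  by rewrite leq_mul2r rd orbT.
exists (fcat (fun i => (y (enum_val i) : C) *: phi v : base_module L) z) => x L2x.
apply: span_trans (zL2 x L2x) => {L2x}x [c Lc].
apply: (@span_reindex _ _ _ _ (fun i => (y i : C) *: phi v : base_module L)).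
have [a Ia] := yC c; exists a.
have -> : (x : base_module L) - \sum_i a i *: ((y i : C) *: phi v : base_module L)
  = (x - c *: phi v) + ((c - \sum_i kstr C (a i) * (y i : C)) *: phi v).
  rewrite scalerBl addrA subrK scaler_suml; congr (_ - _).
  by apply: eq_bigr => i _; rewrite base_scaleE scalerA.
apply: (submodD sL1) Lc _; elim: Ia => [|s t u [Bs Ms] _ IH].
  by rewrite scale0r; exact: (submod0 sL1).
rewrite scalerDl; apply: (submodD sL1) IH.
by rewrite mulrC -scalerA -phiM //; apply: (submodZ sL1) => //; exact: phiL1.
Qed.

End Chain.

(** Together the next results say that [C] has dimension [d * b] when [B] has
    dimension [b].  The lower bound is where it matters that [B] is a subring of
    [C], and not just mapped to it. *)
Section Count.
Variables (F : fieldType) (C : kalg F) (B : subring C).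
Hypothesis FB : forall c, B (kstr C c).
Variables (d : nat) (delta : 'I_d -> C -> C).

(** The module [C] is [C (x)_B B]. *)
Lemma dim_full_le b : complete B delta ->
  has_dim_in (B : kmod C -> Prop) b ->
  exists2 c, (c <= d * b)%N & has_dim_in (@whole _ (kmod C)) c.
Proof.
move=> cpl dB.
have s0 : submod B ((fun x => x = 0) : C^o -> Prop).
  split=> [//|x y -> ->|a x _ ->]; [by rewrite addr0 | by rewrite scaler0].
have s0' : submod (full_subring C) ((fun x => x = 0) : C^o -> Prop).
  split=> [//|x y -> ->|a x _ ->]; [by rewrite addr0 | by rewrite scaler0].
have sB : submod B (B : C^o -> Prop).
  by split=> [|x y|a x]; [exact: smem0 | exact: smemD | exact: smemM].
have [||||] := @chain_bound _ _ _ FB _ _ cpl C^o (fun x => x) b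
  (fun x => x = 0) B (fun x => x = 0) _ _ s0 sB _ dB s0'; try by [].
  by move=> x ->; exact: smem0.
move=> L2 [sL2 BL2 [N [Nb [y yL2]]]].
have [|c cN dc] := @dim_exists _ (kmod C) zero_space (@whole _ (kmod C)) _ y
  (zero_subspace _).
  move=> x _; apply: yL2; rewrite -[x](mulr1 (x : C)).
  by apply: (submodZ sL2) => //; apply: BL2; exact: smem1.
by exists c => //; rewrite (leq_trans cN) // card_ord.
Qed.

Let row_delta (x : C) : 'rV[C]_d := \row_i delta i x.

(** The basis dual to the coordinates [delta] is a combination of their values. *)
Lemma coframe_span (L2 : 'rV[C]_d -> Prop) : coframe B delta ->
  submod (full_subring C) L2 -> (forall x, L2 (row_delta x)) -> forall l, L2 l.
Proof.
move=> cof sL2 L2d l; rewrite [l]row_sum_delta.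
apply: (submod_sum sL2) => i _; apply: (submodZ sL2) => //.
have [s sP] := coframe_dual cof i.
have -> : delta_mx ord0 i = \sum_(z <- s) z.1 *: row_delta z.2.
  apply/rowP => j; rewrite mxE eqxx /= eq_sym -sP summxE.
  by apply: eq_bigr => z _; rewrite !mxE.
by apply: (submod_sum sL2) => z _; apply: (submodZ sL2).
Qed.

Lemma dim_row_ge c n (y : 'I_n -> base_module 'rV[C]_d) :
  has_dim_in (@whole _ (kmod C)) c ->
  (forall l, span_mod zero_space y l) -> (d * c <= n)%N.
Proof.
move=> [e [_ ie _]] yL; pose a (ij : 'I_d * 'I_c) : base_module 'rV[C]_d :=
  (e ij.2 : C) *: delta_mx ord0 ij.1.
rewrite -(card_ord n) -[d]card_ord -[c]card_ord -card_prod.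
apply: (indep_le (zero_subspace _) (a := a)) => [f /rowP f0 [i j]|ij //].
apply: (ie (fun j => f (i, j))); move: (f0 i); rewrite !mxE summxE.
move=> f0i; apply: etrans f0i; apply/esym.
pose g i' j : C := (f (i', j) *: a (i', j) : 'rV[C]_d) ord0 i.
rewrite (eq_bigr (fun ij => g ij.1 ij.2)) => [|[]//].
rewrite -(pair_bigA _ g) /g /= (bigD1 i) //= [X in _ + X]big1 ?addr0 => [|i' ni]; last first.
  rewrite big1 // => j' _; rewrite base_scaleE !mxE eqxx /= eq_sym (negPf ni).
  by rewrite !mulr0.
by apply: eq_bigr => j' _; rewrite base_scaleE !mxE !eqxx mulr1.
Qed.

(** Both [C (x)_B C = C^d] and [C (x)_B B = C] are known exactly, while
    [C (x)_B C / B] has dimension at most [d * (c - b)] by [chain_bound].  Hence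
    [d * c <= c + d * (c - b)]. *)
Lemma dim_full_ge b c : coframe B delta -> complete B delta ->
  has_dim_in (B : kmod C -> Prop) b -> has_dim_in (@whole _ (kmod C)) c ->
  (d * b <= c)%N.
Proof.
move=> cof cpl dB dC.
have sB : submod B (B : C^o -> Prop).
  by split=> [|x y|a x]; [exact: smem0 | exact: smemD | exact: smemM].
have sC : submod B ((fun=> True) : C^o -> Prop) by split.
have [p [n [dp dn cE]]] := dim_exists_mod (zero_subspace _) (kmod_subspace FB sB)
  (fun x (x0 : zero_space x) => eq_ind_r (fun x => B x) (smem0 B) x0)
  (fun x _ => I) dC.
have pb := dim_unique (zero_subspace _) dp dB; rewrite {p}pb in dp cE.
pose L1 (l : 'rV[C]_d) := exists x, l = x *: row_delta 1.
have sL1 : submod (full_subring C) L1.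
  split=> [|_ _ [x ->] [y ->]|a _ _ [x ->]].
  - by exists 0; rewrite scale0r.
  - by exists (x + y); rewrite scalerDl.
  - by exists (a * x); rewrite scalerA.
have [||||] := @chain_bound _ _ _ FB _ _ cpl 'rV[C]_d row_delta n B (@whole _ (kmod C)) L1
  _ _ sB sC _ dn sL1; try by [].
- by move=> x y; apply/rowP => i; rewrite !mxE (coframeD cof).
- by move=> x y Bx; apply/rowP => i; rewrite !mxE (coframeM cof).
- move=> x Bx; exists x; apply/rowP => i; rewrite !mxE -(coframeM cof) //.
  by rewrite mulr1.
move=> L2 [sL2 dL2 [N [Nn [z zL2]]]].
have [e [_ _ eC]] := dC.
have spanL l : span_mod zero_space
    (fcat (fun i => (e i : C) *: row_delta 1 : base_module 'rV[C]_d) z) l.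
  apply: span_trans (zL2 l (coframe_span cof sL2 (fun x => dL2 x I) l)).
  move=> _ [x ->]; have [f] := eC x I; move/subr0_eq => ->; exists f.
  apply/subr0_eq; rewrite subr0; apply/eqP; rewrite subr_eq0; apply/eqP.
  by rewrite scaler_suml; apply: eq_bigr => i _; rewrite base_scaleE scalerA.
move: (dim_row_ge dC spanL) Nn cE; clear.
by move=> le1 le2 cE; move: le1; rewrite cE mulnDr; lia.
Qed.

(** The [C]-module [C^d] is generated by the values of [delta] on a basis of [C],
    so its dimension [d * c] is at most [c * c]. *)
Lemma coframe_le c : coframe B delta -> (1 : C) != 0 ->
  has_dim_in (@whole _ (kmod C)) c -> (d <= c)%N.
Proof.
move=> cof nz dC; have [e0 [_ ie eC]] := dC; pose e : 'I_c -> C := e0.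
have c_gt0 : (0 < c)%N.
  rewrite lt0n; apply/eqP => c0; case/eqP: nz; have [f] := eC 1 I.
  by move/subr0_eq=> ->; apply: big1 => i _; move: (ltn_ord i); rewrite [X in (_ < X)%N]c0.
pose y (ij : 'I_c * 'I_c) : base_module 'rV[C]_d := e ij.1 *: row_delta (e ij.2).
suff spanL l : span_mod zero_space (fun i : 'I_#|{: 'I_c * 'I_c}| => y (enum_val i)) l.
  have := dim_row_ge dC spanL; rewrite card_prod !card_ord leq_mul2r.
  by rewrite eqn0Ngt c_gt0.
apply: span_reindex.
pose L2 (l : 'rV[C]_d) := exists x : 'I_c -> C, l = \sum_j x j *: row_delta (e j).
have deltaE x i (f : 'I_c -> F) : x = \sum_j kstr C (f j) * e j ->
    delta i x = \sum_j kstr C (f j) * delta i (e j).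
  have d0 : delta i 0 = 0.
    by rewrite -{1}(mul0r 0) (coframeM cof) ?mul0r //; exact: smem0.
  move=> ->; rewrite (big_morph _ (coframeD cof i) d0).
  by apply: eq_bigr => j _; rewrite (coframeM cof).
have : L2 l.
  apply: (coframe_span cof) => [|x].
    split=> [|_ _ [x ->] [z ->]|a _ _ [x ->]].
    - by exists (fun=> 0); rewrite big1 // => j _; rewrite scale0r.
    - exists (fun j => x j + z j); rewrite -big_split.
      by apply: eq_bigr => j _; rewrite scalerDl.
    - exists (fun j => a * x j); rewrite scaler_sumr.
      by apply: eq_bigr => j _; rewrite scalerA.
  have [f /subr0_eq xE] := eC x I; exists (fun j => kstr C (f j)).
  apply/rowP => i; rewrite mxE (deltaE _ _ _ xE) summxE.
  by apply: eq_bigr => j _; rewrite !mxE.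
move=> [x lE]; have /choice[f fE] : forall j, exists f : 'I_c -> F,
    x j = \sum_i kstr C (f i) * e i.
  by move=> j; have [f /subr0_eq] := eC (x j) I; exists f.
exists (fun ij => f ij.2 ij.1); rewrite /zero_space lE; apply/eqP.
rewrite subr_eq0; apply/eqP.
pose g i j : 'rV[C]_d := kstr C (f j i) *: (e i *: row_delta (e j)).
rewrite (eq_bigr (fun ij => g ij.1 ij.2)) => [|[]//].
rewrite -(pair_bigA _ g) /g /=.
rewrite exchange_big /=; apply: eq_bigr => j _; rewrite fE scaler_suml.
by apply: eq_bigr => i _; rewrite scalerA.
Qed.

End Count.

(** * Subrings as rings, and localization *)

Section Sub.
Variables (T : comPzRingType) (B : subring T).

Definition sub_pred : {pred T} := fun x => `[< B x >].
Fact sub_closed : subring_closed sub_pred.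
Proof.
split=> [|x y /asboolP Bx /asboolP By|x y /asboolP Bx /asboolP By]; apply/asboolP.
- exact: smem1.
- by apply: smemD => //; exact: smemN.
- exact: smemM.
Qed.

Definition carrier : Type := {x : T | x \in sub_pred}.
HB.instance Definition _ := SubChoice.copy carrier {x : T | x \in sub_pred}.
HB.instance Definition _ :=
  GRing.SubChoice_isSubComPzRing.Build T sub_pred carrier sub_closed.

Lemma subP (x : carrier) : B (val x).
Proof. by have /asboolP := valP x. Qed.

Definition to_sub (x : T) (Bx : B x) : carrier := Sub x (asboolT Bx : x \in sub_pred).

Lemma to_subK x (Bx : B x) : val (to_sub Bx) = x.
Proof. exact: SubK. Qed.

Lemma val_subD (x y : carrier) : val (x + y) = val x + val y.
Proof. by []. Qed.
Lemma val_subM (x y : carrier) : val (x * y) = val x * val y.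
Proof. by []. Qed.
Lemma val_sub_sum (I : Type) (s : seq I) (f : I -> carrier) :
  val (\sum_(i <- s) f i) = \sum_(i <- s) val (f i).
Proof. exact: (big_morph val val_subD). Qed.

Section Corestrict.
Variables (Y : pzRingType) (f : {rmorphism Y -> T}) (Bf : forall y, B (f y)).
Definition corestrict (y : Y) : carrier := to_sub (Bf y).
Fact corestrict_nmod : nmod_morphism corestrict.
Proof.
by split=> [|x y]; apply: val_inj; rewrite !to_subK ?rmorph0 ?rmorphD //= !to_subK.
Qed.
Fact corestrict_monoid : monoid_morphism corestrict.
Proof.
by split=> [|x y]; apply: val_inj; rewrite !to_subK ?rmorph1 ?rmorphM //= !to_subK.
Qed.
HB.instance Definition _ := GRing.isNmodMorphism.Build Y carrier corestrict corestrict_nmod.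
HB.instance Definition _ :=
  GRing.isMonoidMorphism.Build Y carrier corestrict corestrict_monoid.
End Corestrict.
End Sub.

(** Localizations are used through these properties alone, because the rings that
    matter are subrings of a common ring of fractions. *)
Record localizes (C D : comPzRingType) (S : C -> Prop) (l : {rmorphism C -> D}) :
    Prop := Localizes {
  loc_one : S 1;
  loc_mul : forall s t, S s -> S t -> S (s * t);
  loc_unit : forall s, S s -> exists y, l s * y = 1;
  loc_frac : forall x, exists c s, S s /\ l s * x = l c;
  loc_eq : forall x y, l x = l y -> exists2 s, S s & s * x = s * y }.

Section LocalCoframe.
Variables (C D : comPzRingType) (S : C -> Prop) (l : {rmorphism C -> D}).
Hypothesis lP : localizes S l.
Variables (B : subring C) (BD : subring D).
Hypothesis SB : forall s, S s -> B s.
Hypothesis BDP : forall x, BD x <-> exists b s, [/\ B b, S s & l s * x = l b].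

Lemma loc_cancel s a b : S s -> l s * a = l s * b -> a = b.
Proof.
move=> /(loc_unit lP)[y ys] e.
by rewrite -[a]mul1r -[b]mul1r -ys -!mulrA ![y * _]mulrC !mulrA e.
Qed.

(** As [B] contains the denominators, [B]-linearity forces and allows
    [delta' (c / s) = delta c / s]. *)
Lemma coframe_localize d (delta : 'I_d -> C -> C) : coframe B delta ->
  exists delta' : 'I_d -> D -> D, coframe BD delta' /\
    (complete B delta -> complete BD delta').
Proof.
move=> cof.
have /choice[delta' dP] : forall i, exists f : D -> D, forall c s x, S s ->
    l s * x = l c -> l s * f x = l (delta i c).
  move=> i.
  have /choice[f fP] : forall x, exists y, forall c s, S s -> l s * x = l c ->
      l s * y = l (delta i c).
    move=> x; have [c0 [s0 [Ss0 e0]]] := loc_frac lP x.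
    have [y ys] := loc_unit lP Ss0; exists (l (delta i c0) * y) => c s Ss e.
    have [|t St et] := @loc_eq _ _ _ _ lP (s * c0) (s0 * c).
      by rewrite !rmorphM -e -e0 mulrCA.
    have := congr1 (delta i) et; rewrite !mulrA !(coframeM cof); last first.
    - by apply: smemM; exact: SB.
    - by apply: smemM; exact: SB.
    rewrite -!mulrA => /(congr1 l); rewrite !rmorphM => /(loc_cancel St) et'.
    by rewrite mulrA et' mulrAC ys mul1r.
  by exists f => c s x; exact: fP.
exists delta'; split.
  split.
  - move=> i x y; have [c [s [Ss ec]]] := loc_frac lP x.
    have [c' [s' [Ss' ec']]] := loc_frac lP y.
    apply: (@loc_cancel (s * s')); first exact: (loc_mul lP).
    rewrite (dP i (s' * c + s * c')).
    + rewrite (coframeD cof) !(coframeM cof); try exact: SB.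
      rewrite rmorphD !rmorphM mulrDr -(dP i c s x) // -(dP i c' s' y) //.
      ring.
    + exact: (loc_mul lP).
    + by rewrite rmorphD !rmorphM -ec -ec'; ring.
  - move=> i b x /BDP[b0 [t [Bb St eb]]]; have [c [s [Ss ec]]] := loc_frac lP x.
    apply: (@loc_cancel (t * s)); first exact: (loc_mul lP).
    rewrite (dP i (b0 * c)).
    + rewrite (coframeM cof) // !rmorphM -eb -(dP i c s x) //; ring.
    + exact: (loc_mul lP).
    + by rewrite !rmorphM -eb -ec; ring.
  - move=> i; have [s sP] := coframe_dual cof i.
    exists [seq (l z.1, l z.2) | z <- s] => j; rewrite big_map /=.
    rewrite -(rmorph_nat l) -sP rmorph_sum; apply: eq_bigr => z _ /=.
    rewrite rmorphM; congr (_ * _); rewrite -[LHS]mul1r -(rmorph1 l).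
    by apply: dP; [exact: (loc_one lP) | rewrite rmorph1 mul1r].
move=> cpl M h g gD gM.
have [||m mP] := cpl M (h \o l) (g \o l).
- by move=> x y; rewrite /= rmorphD gD.
- move=> b x Bb; rewrite /= rmorphM gM //; apply/BDP.
  by exists b, 1; split=> //; [exact: (loc_one lP) | rewrite rmorph1 mul1r].
exists m => x; have [c [s [Ss ec]]] := loc_frac lP x.
have [y ys] := loc_unit lP Ss.
have hs : h y * h (l s) = 1 by rewrite -rmorphM mulrC ys rmorph1.
rewrite -[LHS]mul1r -[RHS]mul1r -hs -!mulrA; congr (_ * _).
rewrite -gM; last first.
  apply/BDP; exists s, 1; split; [exact: SB | exact: (loc_one lP) |].
  by rewrite rmorph1 mul1r.
rewrite ec; have /= -> := mP c; rewrite mulr_sumr; apply: eq_bigr => i _.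
by rewrite mulrA -rmorphM (dP i c).
Qed.

End LocalCoframe.

(** By its presentation every element is a fraction; the kernel is controlled in
    [num_den_eqv]. *)
Section Localization.
Variables (k : fieldType) (R : kalg k) (S : R -> Prop).
Hypotheses (S1 : S 1) (SM : forall s t, S s -> S t -> S (s * t)).

Definition frac_gen : Type := (R + {s : R | S s})%type.

Inductive frac_rel : term k frac_gen -> term k frac_gen -> Prop :=
  | fraction_str c : frac_rel (TVar k (inl (kstr R c))) (TConst _ c)
  | fraction_add a b : frac_rel (TVar k (inl (a + b)))
      (TAdd (TVar k (inl a)) (TVar k (inl b)))
  | fraction_mul a b : frac_rel (TVar k (inl (a * b)))
      (TMul (TVar k (inl a)) (TVar k (inl b)))
  | fraction_inv s : frac_rel (TMul (TVar k (inl (sval s))) (TVar k (inr s)))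
      (TConst _ 1).

Definition fraction_ring : kalg k := presented frac_rel.

Definition frac_fun (a : R) : fraction_ring := gen frac_rel (inl a).
Fact frac_nmod : nmod_morphism frac_fun.
Proof.
split=> [|a b]; last exact: (gen_rel (fraction_add a b)).
rewrite -(rmorph0 (kstr R)) -(rmorph0 (kstr fraction_ring)).
exact: (gen_rel (fraction_str 0)).
Qed.
Fact frac_monoid : monoid_morphism frac_fun.
Proof.
split=> [|a b]; last exact: (gen_rel (fraction_mul a b)).
rewrite -(rmorph1 (kstr R)) -(rmorph1 (kstr fraction_ring)).
exact: (gen_rel (fraction_str 1)).
Qed.
HB.instance Definition _ :=
  GRing.isNmodMorphism.Build R fraction_ring frac_fun frac_nmod.
HB.instance Definition _ :=
  GRing.isMonoidMorphism.Build R fraction_ring frac_fun frac_monoid.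

Lemma frac_strE c : frac_fun (kstr R c) = kstr fraction_ring c.
Proof. exact: (gen_rel (fraction_str c)). Qed.

(** A fraction of elements of [R] that represents a term. *)
Fixpoint num_den (t : term k frac_gen) : R * R :=
  match t with
  | TConst c => (kstr R c, 1)
  | TVar (inl a) => (a, 1)
  | TVar (inr s) => (1, sval s)
  | TAdd t u => let: (n, d) := num_den t in let: (n', d') := num_den u in
      (n * d' + n' * d, d * d')
  | TOpp t => let: (n, d) := num_den t in (- n, d)
  | TMul t u => let: (n, d) := num_den t in let: (n', d') := num_den u in
      (n * n', d * d')
  end.

Lemma den_mem t : S (num_den t).2.
Proof.
elim: t => [c|[a|[s Ss]]|t IHt u IHu|t IHt|t IHt u IHu] //=.
- by case: (num_den t) (num_den u) IHt IHu => [n d] [n' d'] /=; exact: SM.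
- by case: (num_den t) IHt.
- by case: (num_den t) (num_den u) IHt IHu => [n d] [n' d'] /=; exact: SM.
Qed.

(** The arithmetic of fractions respects the relations of the presentation up to a
    denominator, so only elements killed by a denominator can vanish in the
    localization. *)
Lemma num_den_eqv t u : eqv frac_rel t u -> exists2 s, S s &
  s * ((num_den t).1 * (num_den u).2) = s * ((num_den u).1 * (num_den t).2).
Proof.
elim=> {t u} /= [t u|t|t u _ [s Ss IH]|t u v _ [s Ss IH1] _ [s' Ss' IH2]
  |t t' u u' _ [s Ss IH1] _ [s' Ss' IH2]|t t' _ [s Ss IH]
  |t t' u u' _ [s Ss IH1] _ [s' Ss' IH2]|c d|c d|t u v|t u|t|t|t u v|t u|t|t u v].
- case=> [c|a b|a b|[s Ss]] /=; exists 1 => //; rewrite ?rmorph1 ?rmorphD ?rmorphM; ring.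
- by exists 1; rewrite ?mul1r.
- by exists s; rewrite -?IH.
- exists (s * s' * (num_den u).2); first by apply: SM; [exact: SM | exact: den_mem].
  case: (num_den t) (num_den u) (num_den v) IH1 IH2 => [n d] [n' d'] [n'' d''] /=.
  move=> IH1 IH2.
  have -> : s * s' * d' * (n * d'') = s' * d'' * (s * (n * d')) by ring.
  have -> : s * s' * d' * (n'' * d) = s * d * (s' * (n'' * d')) by ring.
  by rewrite IH1 -IH2; ring.
- exists (s * s'); first exact: SM.
  case: (num_den t) (num_den u) (num_den t') (num_den u') IH1 IH2
    => [n d] [m e] [n' d'] [m' e'] /= IH1 IH2.
  have -> : s * s' * ((n * e + m * d) * (d' * e'))
    = s' * (e * e') * (s * (n * d')) + s * (d * d') * (s' * (m * e')) by ring.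
  by rewrite IH1 IH2; ring.
- exists s => //; case: (num_den t) (num_den t') IH => [n d] [n' d'] /= IH.
  by rewrite !mulNr !mulrN IH.
- exists (s * s'); first exact: SM.
  case: (num_den t) (num_den u) (num_den t') (num_den u') IH1 IH2
    => [n d] [m e] [n' d'] [m' e'] /= IH1 IH2.
  have -> : s * s' * (n * m * (d' * e')) = s * (n * d') * (s' * (m * e')) by ring.
  by rewrite IH1 IH2; ring.
- by exists 1 => //; rewrite rmorphD; ring.
- by exists 1 => //; rewrite rmorphM; ring.
- case: (num_den t) (num_den u) (num_den v) => [n d] [n' d'] [n'' d''] /=.
  by exists 1 => //; ring.
- by case: (num_den t) (num_den u) => [n d] [n' d'] /=; exists 1 => //; ring.
- by case: (num_den t) => [n d] /=; exists 1 => //; rewrite rmorph0; ring.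
- by case: (num_den t) => [n d] /=; exists 1 => //; rewrite rmorph0; ring.
- case: (num_den t) (num_den u) (num_den v) => [n d] [n' d'] [n'' d''] /=.
  by exists 1 => //; ring.
- by case: (num_den t) (num_den u) => [n d] [n' d'] /=; exists 1 => //; ring.
- by case: (num_den t) => [n d] /=; exists 1 => //; rewrite rmorph1; ring.
- case: (num_den t) (num_den u) (num_den v) => [n d] [n' d'] [n'' d''] /=.
  by exists 1 => //; ring.
Qed.

Lemma fraction_localizes : localizes S frac_fun.
Proof.
have unit s : S s -> exists y, frac_fun s * y = 1.
  move=> Ss; exists (gen frac_rel (inr (exist _ s Ss))).
  by rewrite -(rmorph1 (kstr fraction_ring)); exact: (gen_rel (fraction_inv (exist _ s Ss))).
split=> //; last first.
  by move=> x y /clsP/num_den_eqv[s Ss] /=; rewrite !mulr1; exists s.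
apply: presented_ind => [[a|[s Ss]]|c|p q|p|p q].
- by exists a, 1; rewrite rmorph1 mul1r.
- exists 1, s; split=> //; rewrite rmorph1 -(rmorph1 (kstr fraction_ring)).
  exact: (gen_rel (fraction_inv (exist _ s Ss))).
- exists (kstr R c), 1; split=> //; rewrite rmorph1 mul1r.
  exact: (esym (frac_strE c)).
- move=> [c [s [Ss ec]]] [c' [s' [Ss' ec']]]; exists (s' * c + s * c'), (s * s').
  by split; [exact: SM | rewrite rmorphD !rmorphM -ec -ec'; ring].
- by move=> [c [s [Ss ec]]]; exists (- c), s; rewrite rmorphN mulrN ec.
- move=> [c [s [Ss ec]]] [c' [s' [Ss' ec']]]; exists (c * c'), (s * s').
  by split; [exact: SM | rewrite !rmorphM -ec -ec'; ring].
Qed.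

End Localization.

(** * Maximal domains *)

Definition domain (T : comPzRingType) (P : subring T) :=
  forall x y, P x -> P y -> x * y = 0 -> x = 0 \/ y = 0.

Definition algebraic_over (T : comPzRingType) (P : T -> Prop) (z : T) :=
  exists n (p : nat -> T), [/\ forall i, P (p i), p n <> 0
    & \sum_(i < n.+1) p i * z ^+ i = 0].

Lemma nonzero_ring (T : comPzRingType) : 1 != 0 :> T ->
  exists N : comNzRingType, (N : comPzRingType) = T.
Proof.
move=> nz; exists (HB.pack (GRing.ComPzRing.sort T)
  (GRing.PzSemiRing_isNonZero.Build T nz) : comNzRingType).
by case: T nz.
Qed.

(** Adjoining an element that is transcendental over a domain gives a domain, since
    the leading coefficients of two polynomials have a nonzero product. *)
Section Adjoin.
Variables (N : comNzRingType) (P : subring N) (z : N).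

Definition coefs_in (p : {poly N}) := forall i, P p`_i.

Fact over_horner1 : exists2 p, coefs_in p & 1 = p.[z].
Proof.
exists 1; last by rewrite hornerC.
by move=> i; rewrite coef1; case: eqP => _; [exact: smem1 | exact: smem0].
Qed.
Fact over_hornerN1 : exists2 p, coefs_in p & -1 = p.[z].
Proof.
exists (-1); last by rewrite hornerN hornerC.
move=> i; rewrite coefN coef1; apply: smemN.
by case: eqP => _; [exact: smem1 | exact: smem0].
Qed.
Fact over_hornerD x y : (exists2 p, coefs_in p & x = p.[z]) ->
  (exists2 p, coefs_in p & y = p.[z]) -> exists2 p, coefs_in p & x + y = p.[z].
Proof.
move=> [p Pp ->] [q Pq ->]; exists (p + q); last by rewrite hornerD.
by move=> i; rewrite coefD; exact: smemD.
Qed.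
Fact over_hornerM x y : (exists2 p, coefs_in p & x = p.[z]) ->
  (exists2 p, coefs_in p & y = p.[z]) -> exists2 p, coefs_in p & x * y = p.[z].
Proof.
move=> [p Pp ->] [q Pq ->]; exists (p * q); last by rewrite hornerM.
move=> i; rewrite coefM; elim/big_ind: _ => [|x' y'|j _]; first exact: smem0.
  exact: smemD.
exact: smemM.
Qed.

Definition adjoin : subring N :=
  SubRing over_horner1 over_hornerN1 over_hornerD over_hornerM.

Lemma adjoin_domain : domain P -> ~ algebraic_over P z -> domain adjoin.
Proof.
move=> domP nz.
have root0 p : coefs_in p -> p.[z] = 0 -> p = 0.
  move=> Pp pz; have [//|p0] := eqVneq p 0; case: nz.
  exists (size p).-1, (fun i => p`_i); split=> //.
    by apply/eqP; rewrite -lead_coefE lead_coef_eq0.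
  by rewrite prednK ?lt0n ?size_poly_eq0 // -horner_coef.
move=> _ _ [p Pp ->] [q Pq ->] pq0.
have : p * q = 0.
  apply: root0; last by rewrite hornerM.
  move=> i; rewrite coefM; elim/big_ind: _ => [|x' y'|j _]; first exact: smem0.
    exact: smemD.
  exact: smemM.
have [->|p0] := eqVneq p 0; first by left; rewrite horner0.
have [->|q0] := eqVneq q 0; first by right; rewrite horner0.
have [l0|l0] := eqVneq (lead_coef p * lead_coef q) 0.
  have [/eqP|/eqP] := domP _ _ (Pp _) (Pq _) l0; rewrite lead_coef_eq0.
    by rewrite (negPf p0).
  by rewrite (negPf q0).
move=> pq; have := lead_coef_proper_mul l0; rewrite pq lead_coef0 => l00.
by rewrite -l00 eqxx in l0.
Qed.

Lemma adjoin_mem : adjoin z.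
Proof.
exists 'X; last by rewrite hornerX.
by move=> i; rewrite coefX; case: eqP => _; [exact: smem1 | exact: smem0].
Qed.

Lemma adjoin_sub x : P x -> adjoin x.
Proof.
move=> Px; exists x%:P; last by rewrite hornerC.
by move=> i; rewrite coefC; case: eqP => _ //; exact: smem0.
Qed.

Lemma adjoin_min (X : subring N) : (forall x, P x -> X x) -> X z ->
  forall x, adjoin x -> X x.
Proof.
move=> PX Xz _ [p Pp ->]; rewrite horner_coef.
have Xpow i : X (z ^+ i).
  by elim: i => [|i IH]; [exact: smem1 | rewrite exprS; exact: smemM].
elim/big_ind: _ => [|x' y'|j _]; [exact: smem0 | exact: smemD |].
by apply: smemM => //; exact: PX.
Qed.
End Adjoin.

Section MaximalDomain.
Local Open Scope classical_set_scope.

(** A maximal domain exists by Zorn's lemma, and adjoining a transcendental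
    element to it would give a larger one.  This plays the role of a polynomial
    ring on a transcendence basis, as in Noether normalization, but [X] may have
    zero divisors and nilpotent elements. *)
Lemma maximal_domain (T : comPzRingType) (K X : subring T) : 1 != 0 :> T ->
  domain K -> (forall x, K x -> X x) ->
  exists P : subring T, [/\ domain P, forall x, K x -> P x,
    forall x, P x -> X x & forall z, X z -> algebraic_over P z].
Proof.
move=> /nonzero_ring[N EN]; case: T / EN in K X *; move=> domK KX.
pose good (W : set N) := exists P : subring N, [/\ (P : N -> Prop) = W, domain P,
  forall x, K x -> P x & forall x, P x -> X x].
have chain (F : set (set N)) : F `<=` [set W | W = set0 \/ good W] ->
    total_on F subset -> (\bigcup_(W in F) W = set0) \/ good (\bigcup_(W in F) W).
  move=> Fgood Ftot; have [[W0 FW0 W00]|noW] := pselect (exists2 W, F W & W <> set0).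
    have gW W x : F W -> W x -> good W.
      by move=> FW Wx; have [W0'|] := Fgood _ FW; first by rewrite W0' in Wx.
    have two x y : (\bigcup_(W in F) W) x -> (\bigcup_(W in F) W) y ->
        exists P : subring N, [/\ F P, domain P, P x & P y].
      move=> [W1 FW1 W1x] [W2 FW2 W2y]; have [le12|le21] := Ftot _ _ FW1 FW2.
        have [P [EP domP _ _]] := gW _ _ FW2 W2y; exists P.
        by split=> //; rewrite EP //; exact: le12.
      have [P [EP domP _ _]] := gW _ _ FW1 W1x; exists P.
      by split=> //; rewrite EP //; exact: le21.
    have [|[P0 [EP0 _ KP0 _]]] := Fgood _ FW0; first by [].
    have U1 : (\bigcup_(W in F) W) 1 by exists W0; rewrite // -EP0; exact: smem1.
    have UN1 : (\bigcup_(W in F) W) (-1).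
      by exists W0; rewrite // -EP0; exact: smemN1.
    have UD x y : (\bigcup_(W in F) W) x -> (\bigcup_(W in F) W) y ->
        (\bigcup_(W in F) W) (x + y).
      by move=> Ux Uy; have [P [FP _ Px Py]] := two x y Ux Uy; exists P => //; exact: smemD.
    have UM x y : (\bigcup_(W in F) W) x -> (\bigcup_(W in F) W) y ->
        (\bigcup_(W in F) W) (x * y).
      by move=> Ux Uy; have [P [FP _ Px Py]] := two x y Ux Uy; exists P => //; exact: smemM.
    right; exists (SubRing U1 UN1 UD UM); split=> //=.
    - by move=> x y Ux Uy; have [P [_ domP Px Py]] := two x y Ux Uy; exact: domP.
    - by move=> x Kx; exists W0; rewrite // -EP0; exact: KP0.
    - move=> x [W FW Wx]; have [P [EP _ _ PX]] := gW _ _ FW Wx.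
      by apply: PX; rewrite EP.
  left; rewrite -subset0 => v [W FW Wv].
  by have [W0|W0] := pselect (W = set0); [rewrite -W0 | case: noW; exists W].
have goodK : good K by exists K.
(* As the union of the empty chain, [set0] had to be admitted; it is not maximal. *)
have [W [PW Wmax]] := Zorn_bigcup chain.
case: PW => [W0|[P [EP domP KP PX]]].
  have WK : W `<` (K : set N).
    rewrite W0; split; first by move=> x [].
    by move=> /(_ 1); apply; exact: smem1.
  by case: (Wmax K WK); right.
exists P; split=> // z Xz; apply: contrapT => nz'.
have domA := @adjoin_domain N P z domP nz'.
have subA := @adjoin_sub N P z; have minA := @adjoin_min N P z X PX Xz.
apply: (Wmax (@adjoin N P z : N -> Prop)).
  rewrite -EP; split; first exact: subA.
  move=> /(_ z (@adjoin_mem N P z)) Pz; apply: nz'.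
  exists 1%N, (fun i => if i is 0 then - z else 1); split.
  - by case=> [|i]; [exact: smemN | exact: smem1].
  - by apply/eqP; rewrite oner_eq0.
  - by rewrite big_ord_recl big_ord_recl big_ord0 /= addr0 expr0 mulr1 mul1r expr1 addNr.
right; exists (@adjoin N P z); split=> // x Kx; exact/subA/KP.
Qed.
End MaximalDomain.

(** * Generic dimension *)

Section DimTransfer.
Variables (F : fieldType) (V V' : lmodType F) (f : V -> V').
Hypotheses (fD : forall x y, f (x + y) = f x + f y)
  (fZ : forall a x, f (a *: x) = a *: f x) (f_inj : injective f).
Variables (X : V -> Prop) (X' : V' -> Prop).
Hypotheses (XX' : forall x, X x -> X' (f x))
  (X'X : forall y, X' y -> exists2 x, X x & f x = y).

Let fsum (I : finType) (c : I -> F) (b : I -> V) :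
  f (\sum_i c i *: b i) = \sum_i c i *: f (b i).
Proof.
have f0 : f 0 = 0 by rewrite -(scale0r 0) fZ scale0r.
by rewrite (big_morph f fD f0); apply: eq_bigr => i _; exact: fZ.
Qed.

Lemma dim_image n : has_dim_in X n -> has_dim_in X' n.
Proof.
move=> [b [Xb ib bX]]; exists (fun i => f (b i)); split.
- by move=> i; exact: XX'.
- by move=> c; rewrite /zero_space -fsum -(scale0r (f 0)) -fZ scale0r => /f_inj/ib.
- move=> _ /X'X[x /bX[c /subr0_eq xE] <-]; exists c.
  by rewrite {1}xE fsum subrr.
Qed.

Lemma dim_preimage n : has_dim_in X' n -> has_dim_in X n.
Proof.
move=> [b [Xb ib bX]]; have /choice[a aP] : forall i, exists x, X x /\ f x = b i.
  by move=> i; have [x] := X'X (Xb i); exists x.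
have bE i : b i = f (a i) by have [_] := aP i.
exists a; split.
- by move=> i; have [] := aP i.
- move=> c c0; apply: ib; under eq_bigr do rewrite bE.
  by rewrite -fsum c0 -(scale0r 0) fZ scale0r.
- move=> x /XX'/bX[c /subr0_eq xE]; exists c; apply/eqP; rewrite subr_eq0.
  by apply/eqP/f_inj; rewrite xE fsum; apply: eq_bigr => i _; rewrite bE.
Qed.
End DimTransfer.

(** The products of powers [t ^ j] below the degrees of the algebraic elements [t]
    span a space containing 1 and stable under every [t]. *)
Lemma fin_stable (F : fieldType) (A : kalg F) (ts : seq A) :
  (forall t, t \in ts -> exists n (a : 'I_n -> F),
    t ^+ n = \sum_i kstr A (a i) * t ^+ i) ->
  exists (I : finType) (y : I -> A), let span v :=
    exists c : I -> F, v = \sum_i kstr A (c i) * y i in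
  span 1 /\ forall t, t \in ts -> forall i, span (t * y i).
Proof.
elim: ts => [|t ts IH] alg.
  exists unit, (fun=> 1); split=> //; exists (fun=> 1).
  by rewrite big_const card_unit /= addr0 rmorph1 mul1r.
have [|I [y [[c1 y1] yts]]] := IH.
  by move=> u uts; apply: alg; rewrite in_cons uts orbT.
have [|n [a ta]] := alg t; first by rewrite mem_head.
pose z (p : I * 'I_n) := y p.1 * t ^+ p.2.
exists (I * 'I_n)%type, z => span.
have span0 : span 0.
  by exists (fun=> 0); rewrite big1 // => i _; rewrite rmorph0 mul0r.
have spanD u v : span u -> span v -> span (u + v).
  move=> [c ->] [d ->]; exists (fun i => c i + d i); rewrite -big_split.
  by apply: eq_bigr => i _; rewrite rmorphD mulrDl.
have spanZ e u : span u -> span (kstr A e * u).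
  move=> [c ->]; exists (fun i => e * c i); rewrite mulr_sumr.
  by apply: eq_bigr => i _; rewrite rmorphM mulrA.
have spanS (J : finType) (c : J -> F) (w : J -> A) :
    (forall j, span (w j)) -> span (\sum_j kstr A (c j) * w j).
  by move=> sw; elim/big_ind: _ => // j _; exact: spanZ.
have spanP i j : span (y i * t ^+ j).
  elim/ltn_ind: j => j IHj; have [jn|nj] := ltnP j n.
    exists (fun p => (p == (i, Ordinal jn))%:R).
    rewrite (bigD1 (i, Ordinal jn)) //= eqxx rmorph1 mul1r big1 ?addr0 //.
    by move=> p /negPf->; rewrite rmorph0 mul0r.
  rewrite -(subnK nj) exprD ta mulr_sumr mulr_sumr.
  have -> : \sum_(l < n) y i * (t ^+ (j - n) * (kstr A (a l) * t ^+ l))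
     = \sum_(l < n) kstr A (a l) * (y i * t ^+ (j - n + l)).
    by apply: eq_bigr => l _; rewrite exprD; ring.
  apply: spanS => l; apply: IHj.
  by rewrite -[X in (_ < X)%N](subnK nj) ltn_add2l.
split.
  rewrite y1; apply: spanS => i.
  by rewrite -[y i]mulr1 -(expr0 t).
move=> u; rewrite in_cons => /orP[/eqP->|uts] [i j]; rewrite /z /=.
  by rewrite mulrCA -exprS.
rewrite mulrA; have [c ->] := yts u uts i; rewrite mulr_suml.
have -> : \sum_i0 kstr A (c i0) * y i0 * t ^+ j
    = \sum_i0 kstr A (c i0) * (y i0 * t ^+ j).
  by apply: eq_bigr => i0 _; rewrite mulrA.
exact: spanS.
Qed.

Section FractionField.
Variables (k : fieldType) (R : kalg k) (P : subring R).
Hypotheses (domP : domain P) (R1 : 1 != 0 :> R).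

Definition denom (s : R) := P s /\ s != 0.

Fact denom1 : denom 1.
Proof. by split; [exact: smem1 | ]. Qed.
Fact denomM s t : denom s -> denom t -> denom (s * t).
Proof.
move=> [Ps s0] [Pt t0]; split; first exact: smemM.
by apply/eqP => /(domP Ps Pt)[]; exact/eqP.
Qed.

Definition fractions : kalg k := fraction_ring denom.
Definition frac_map : {rmorphism R -> fractions} := @frac_fun _ R denom.
Lemma frac_mapP : localizes denom frac_map.
Proof. exact: fraction_localizes denom1 denomM. Qed.

Let l := frac_map.
Let lP := frac_mapP.

Lemma frac1_neq0 : 1 != 0 :> fractions.
Proof.
apply/eqP => e; have [|t [Pt /eqP t0]] := @loc_eq _ _ _ _ lP 1 0.
  by rewrite rmorph0 rmorph1.
by rewrite mulr1 mulr0.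
Qed.

Section FracSub.
Variable X : subring R.
Hypothesis PX : forall x, P x -> X x.

Definition frac_mem (x : fractions) := exists a s, [/\ X a, denom s & l s * x = l a].

Fact frac_mem1 : frac_mem 1.
Proof. by exists 1, 1; split; [exact: smem1 | exact: denom1 | rewrite mulr1]. Qed.
Fact frac_memN1 : frac_mem (-1).
Proof.
exists (-1), 1; split; [exact: smemN1 | exact: denom1 |].
by rewrite rmorphN rmorph1 mul1r.
Qed.
Fact frac_memD x y : frac_mem x -> frac_mem y -> frac_mem (x + y).
Proof.
move=> [a [s [Xa Ss ea]]] [b [t [Xb St eb]]]; exists (t * a + s * b), (s * t); split.
- by apply: smemD; apply: smemM => //; apply: PX; [case: St | case: Ss].
- exact: denomM.
- by rewrite rmorphD !rmorphM -ea -eb; ring.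
Qed.
Fact frac_memM x y : frac_mem x -> frac_mem y -> frac_mem (x * y).
Proof.
move=> [a [s [Xa Ss ea]]] [b [t [Xb St eb]]]; exists (a * b), (s * t); split.
- exact: smemM.
- exact: denomM.
- by rewrite !rmorphM -ea -eb; ring.
Qed.
Definition frac_sub : subring fractions :=
  SubRing frac_mem1 frac_memN1 frac_memD frac_memM.
End FracSub.

Definition Psub : subring fractions := frac_sub (fun x Px => Px).

Fact frac_field_nz : 1 != 0 :> carrier Psub.
Proof. by apply/eqP => /(congr1 val) /= e; case/eqP: frac1_neq0. Qed.

Fact frac_field_inv : exists inv : carrier Psub -> carrier Psub,
  (forall x, x != 0 -> inv x * x = 1) /\ inv 0 = 0.
Proof.
have /choice[f fP] : forall x : carrier Psub,
    exists y, (x != 0 -> y * x = 1) /\ (x = 0 -> y = 0).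
  move=> x; have [->|x0] := eqVneq x 0; first by exists 0; split; rewrite ?eqxx.
  have [p [s [Pp Ss e]]] := subP x.
  have p0 : p != 0.
    apply/eqP => p0; case/eqP: x0; apply: val_inj => /=.
    by apply: (loc_cancel lP Ss); rewrite e p0 rmorph0 mulr0.
  have [y yp] := loc_unit lP (conj Pp p0 : denom p).
  have Py : Psub (l s * y).
    exists s, p; split=> //; first by case: Ss.
    by rewrite mulrCA yp mulr1.
  exists (to_sub Py); split=> [_|/eqP]; last by rewrite (negPf x0).
  by apply: val_inj; rewrite /= mulrAC e.
by exists f; split=> [x|]; [case: (fP x) | case: (fP 0) => _; exact].
Qed.

Definition frac_inv := projT1 (cid frac_field_inv).

Fact frac_mulV : forall x : carrier Psub, x != 0 -> frac_inv x * x = 1.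
Proof. by rewrite /frac_inv; case: cid => f []. Qed.
Fact frac_inv0 : frac_inv 0 = 0.
Proof. by rewrite /frac_inv; case: cid => f []. Qed.

(* The field is built on the subring of fractions [p / s] with [p] in [P], so that
   its inclusion in the ring of all fractions is a morphism by construction. *)
Definition frac_field_ring : comNzRingType :=
  HB.pack (carrier Psub) (GRing.PzSemiRing_isNonZero.Build (carrier Psub) frac_field_nz).

Definition frac_field : fieldType :=
  HB.pack (carrier Psub) frac_field_ring
    (GRing.ComNzRing_isField.Build frac_field_ring frac_mulV frac_inv0).

Definition frac_field_val : {rmorphism frac_field -> fractions} :=
  (val : {rmorphism carrier Psub -> fractions}).

Definition frac_alg : kalg frac_field := KAlg frac_field_val.

(** For [X] containing [P] this is the rank of [X] as a module over [P]. *)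
Definition generic_dim (X : subring R) n :=
  has_dim_in (frac_mem X : kmod frac_alg -> Prop) n.

(** The dimension counts along a coframe, transported to fractions. *)
Section Step.
Variables X X' : subring R.
Hypotheses (PX : forall x, P x -> X x) (XX' : forall x, X x -> X' x).

Let PX' x : P x -> X' x. Proof. by move=> /PX/XX'. Qed.

Lemma frac_mem_sub x : frac_mem X x -> frac_mem X' x.
Proof. by move=> [a [s [Xa Ss e]]]; exists a, s; split=> //; exact: XX'. Qed.

Fact base_mem1 : X (val (1 : carrier X')). Proof. exact: smem1. Qed.
Fact base_memN1 : X (val (-1 : carrier X')). Proof. exact: smemN1. Qed.
Fact base_memD (x y : carrier X') : X (val x) -> X (val y) -> X (val (x + y)).
Proof. exact: smemD. Qed.
Fact base_memM (x y : carrier X') : X (val x) -> X (val y) -> X (val (x * y)).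
Proof. exact: smemM. Qed.
Definition base_sub : subring (carrier X') :=
  @SubRing (carrier X') (fun x => X (val x)) base_mem1 base_memN1 base_memD base_memM.

Let D : comPzRingType := carrier (frac_sub PX').

Fact frac_str_mem (c : frac_field) : frac_mem X (frac_field_val c).
Proof.
by have [a [s [Pa Ss e]]] := subP (c : carrier Psub); exists a, s; split=> //; exact: PX.
Qed.
Fact frac_str_mem' (c : frac_field) : frac_sub PX' (frac_field_val c).
Proof. exact/frac_mem_sub/frac_str_mem. Qed.
Definition step_alg : kalg frac_field := @KAlg _ D (corestrict frac_str_mem').

Fact frac_base_mem1 : frac_mem X (val (1 : step_alg)). Proof. exact: frac_mem1. Qed.
Fact frac_base_memN1 : frac_mem X (val (-1 : step_alg)). Proof. exact: frac_memN1. Qed.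
Fact frac_base_memD (x y : step_alg) :
  frac_mem X (val x) -> frac_mem X (val y) -> frac_mem X (val (x + y)).
Proof. exact: frac_memD. Qed.
Fact frac_base_memM (x y : step_alg) :
  frac_mem X (val x) -> frac_mem X (val y) -> frac_mem X (val (x * y)).
Proof. exact: frac_memM. Qed.
Definition frac_base : subring step_alg :=
  @SubRing step_alg (fun x => frac_mem X (val x))
    frac_base_mem1 frac_base_memN1 frac_base_memD frac_base_memM.

Fact step_map_mem (x : carrier X') : frac_sub PX' ((l \o val) x).
Proof.
exists (val x), 1; split; [exact: subP | exact: denom1 |].
by rewrite rmorph1 mul1r.
Qed.
Definition step_map : {rmorphism carrier X' -> step_alg} := corestrict step_map_mem.

Lemma step_localizes : localizes (fun s : carrier X' => denom (val s)) step_map.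
Proof.
split=> [|s t|s Ss|x|x y].
- exact: denom1.
- exact: denomM.
- have [y ys] := loc_unit lP Ss.
  have Xy : frac_sub PX' y.
    exists 1, (val s); split=> //; first exact: smem1.
    by rewrite ys rmorph1.
  by exists (to_sub Xy); apply: val_inj.
- have [a [s [Xa Ss e]]] := subP x.
  exists (to_sub Xa), (to_sub (PX' (proj1 Ss))); split; first exact: Ss.
  exact: val_inj.
- move=> /(congr1 val) /= /(loc_eq lP)[s Ss e].
  exists (to_sub (PX' (proj1 Ss))); first exact: Ss.
  exact: val_inj.
Qed.

Lemma frac_baseP (x : step_alg) : frac_base x <-> exists b s : carrier X',
  [/\ base_sub b, denom (val s) & step_map s * x = step_map b].
Proof.
split=> [[a [s [Xa Ss e]]]|[b [s [Xb Ss /(congr1 val) e]]]].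
  exists (to_sub (XX' Xa)), (to_sub (PX' (proj1 Ss))); split=> //.
  exact: val_inj.
by exists (val b), (val s).
Qed.

Lemma generic_dim_base b : generic_dim X b ->
  has_dim_in (frac_base : kmod step_alg -> Prop) b.
Proof.
apply: (@dim_preimage _ (kmod step_alg) (kmod frac_alg) val); try by [].
- exact: val_inj.
- move=> y Xy; exists (to_sub (frac_mem_sub Xy : frac_sub PX' y)) => //.
Qed.

Lemma generic_dim_full c : generic_dim X' c <->
  has_dim_in (@whole _ (kmod step_alg)) c.
Proof.
split.
  apply: (@dim_preimage _ (kmod step_alg) (kmod frac_alg) val); try by [].
  - exact: val_inj.
  - by move=> x _; exact: (subP (x : D)).
  - by move=> y Xy; exists (to_sub (Xy : frac_sub PX' y)).
apply: (@dim_image _ (kmod step_alg) (kmod frac_alg) val); try by [].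
- exact: val_inj.
- by move=> x _; exact: (subP (x : D)).
- by move=> y Xy; exists (to_sub (Xy : frac_sub PX' y)).
Qed.

Let FB (c : frac_field) : frac_base (kstr step_alg c).
Proof. exact: frac_str_mem. Qed.

Let coframe_step d (delta : 'I_d -> carrier X' -> carrier X') :
  coframe base_sub delta -> exists delta' : 'I_d -> step_alg -> step_alg,
  coframe frac_base delta' /\ (complete base_sub delta -> complete frac_base delta').
Proof.
apply: (coframe_localize step_localizes _ frac_baseP) => s [Ps _]; exact: PX.
Qed.

Lemma generic_dim_le d (delta : 'I_d -> carrier X' -> carrier X') b :
  coframe base_sub delta -> complete base_sub delta -> generic_dim X b ->
  exists2 c, (c <= d * b)%N & generic_dim X' c.
Proof.
move=> /coframe_step[delta' [_ cpl']] /cpl' {}cpl' /generic_dim_base dB.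
have [c cb dc] := @dim_full_le _ step_alg frac_base FB _ _ _ cpl' dB; exists c => //.
exact/generic_dim_full.
Qed.

Lemma generic_dim_ge d (delta : 'I_d -> carrier X' -> carrier X') b c :
  coframe base_sub delta -> complete base_sub delta ->
  generic_dim X b -> generic_dim X' c -> (d * b <= c)%N.
Proof.
move=> /coframe_step[delta' [cof' cpl']] /cpl' {}cpl' /generic_dim_base dB.
by move=> /generic_dim_full; exact: (@dim_full_ge _ step_alg frac_base FB _ _ _ _ cof' cpl' dB).
Qed.

Lemma coframe_generic_dim d (delta : 'I_d -> carrier X' -> carrier X') c :
  coframe base_sub delta -> generic_dim X' c -> (d <= c)%N.
Proof.
move=> /coframe_step[delta' [cof' _]] /generic_dim_full.
apply: (@coframe_le _ step_alg frac_base FB _ _ _ cof'); apply/eqP => /(congr1 val) e.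
by case/eqP: frac1_neq0.
Qed.

End Step.

Lemma generic_dim_mono (X X' : subring R) b c : (forall x, X x -> X' x) ->
  generic_dim X b -> generic_dim X' c -> (b <= c)%N.
Proof.
move=> XX'; apply: (dim_le (zero_subspace _)) => x; exact: frac_mem_sub.
Qed.

Lemma generic_dim_sub (X X' : subring R) c : (forall x, X x -> X' x) ->
  generic_dim X' c -> exists b, generic_dim X b.
Proof.
move=> XX' dc; have sub x : frac_mem X x -> frac_mem X' x by exact: frac_mem_sub.
have [b _ db] := @dim_sub _ (kmod frac_alg) _ (frac_mem X) _ _ (zero_subspace _) sub dc.
by exists b.
Qed.

Lemma generic_dim_gt0 (X : subring R) b : generic_dim X b -> (0 < b)%N.
Proof.
rewrite lt0n => db; apply/eqP => b0; rewrite b0 in db.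
by have /eqP := dim0_sub db (frac_mem1 X); rewrite (negPf frac1_neq0).
Qed.


(** Every generator of [X] becomes integral over the field of fractions of [P] once
    its leading coefficient is inverted. *)
Lemma generic_dim_exists (X : subring R) (zs : seq R) :
  (forall x, P x -> X x) -> (forall c, P (kstr R c)) ->
  (forall z, z \in zs -> algebraic_over P z) ->
  (forall x, X x -> generated (fun z => z \in zs) x) ->
  exists n, generic_dim X n.
Proof.
move=> PX kP algz genX.
have scalar p s : P p -> denom s -> exists c : frac_field, l s * frac_field_val c = l p.
  move=> Pp Ss; have [y ys] := loc_unit lP Ss.
  have Py : Psub (y * l p).
    by exists p, s; split=> //; rewrite mulrA ys mul1r.
  by exists (to_sub Py : carrier Psub); rewrite /= mulrA ys mul1r.
have [t|I [y [y1 yts]]] := @fin_stable frac_field frac_alg [seq l z | z <- zs].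
  move=> /mapP[z /algz[n [p [Pp /eqP pn p0]]] ->]; exists n.
  have Sn : denom (p n) by [].
  have /choice[a aP] : forall i : 'I_n, exists a : frac_field,
      l (p n) * frac_field_val a = l (- p i).
    by move=> i; apply: scalar => //; exact: smemN.
  exists a; apply: (loc_cancel lP Sn); rewrite mulr_sumr.
  have -> : \sum_(i < n) l (p n) * (kstr frac_alg (a i) * l z ^+ i)
      = \sum_(i < n) l (- p i * z ^+ i).
    by apply: eq_bigr => i _; rewrite mulrA aP rmorphM rmorphXn.
  rewrite -rmorph_sum -rmorphXn -rmorphM; congr (l _).
  move: p0; rewrite big_ord_recr /= addrC => /eqP; rewrite addr_eq0 => /eqP ->.
  by rewrite -sumrN; apply: eq_bigr => i _; rewrite mulNr.
pose span v := exists c : I -> frac_field, v = \sum_i kstr frac_alg (c i) * y i.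
have spanD u v : span u -> span v -> span (u + v).
  move=> [c ->] [d ->]; exists (fun i => c i + d i); rewrite -big_split.
  by apply: eq_bigr => i _; rewrite rmorphD mulrDl.
have spanZ e u : span u -> span (kstr frac_alg e * u).
  move=> [c ->]; exists (fun i => e * c i); rewrite mulr_sumr.
  by apply: eq_bigr => i _; rewrite rmorphM mulrA.
have span0 : span 0.
  by exists (fun=> 0); rewrite big1 // => i _; rewrite rmorph0 mul0r.
pose stable u := forall i, span (u * y i).
have stable_span u v : stable u -> span v -> span (u * v).
  move=> su [c ->]; rewrite mulr_sumr; elim/big_ind: _ => // i _.
  by rewrite mulrCA; apply: spanZ; exact: su.
have stableX x : generated (fun z => z \in zs) x -> stable (l x).
  elim=> {x} [z zz|c|u v _ su _ sv|u v _ su _ sv] i.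
  - by apply: yts; exact: map_f.
  - have [e ee] := scalar (kstr R c) 1 (kP c) denom1.
    move: ee; rewrite rmorph1 mul1r => <-; apply: spanZ.
    have yE : y i = 1 * y i by rewrite mul1r.
    exists (fun j => (j == i)%:R); rewrite (bigD1 i) //= eqxx rmorph1 mul1r.
    by rewrite big1 ?addr0 // => j /negPf->; rewrite rmorph0 mul0r.
  - by rewrite rmorphD mulrDl; exact: spanD.
  - by rewrite rmorphM -mulrA; apply: stable_span => //; exact: sv.
have [|n _ dn] := @dim_exists _ (kmod frac_alg) zero_space (frac_mem X) I y
  (zero_subspace _); last by exists n.
move=> x [a [s [Xa Ss e]]].
have [c ce] := scalar 1 s (smem1 P) Ss.
have xE : x = frac_field_val c * l a.
  apply: (loc_cancel lP Ss); rewrite e mulrA ce rmorph1 mul1r.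
  by [].
have [f fE] : span x.
  rewrite xE; apply: (spanZ c); rewrite -[l a]mulr1.
  by apply: stable_span => //; exact/stableX/genX.
exists f; apply/eqP; rewrite subr_eq0; apply/eqP; exact: fE.
Qed.
End FractionField.

(** * Bilinear maps on the tensor product of two algebras *)

Section Tensor2.
Variables (k : fieldType) (A1 A2 : kalg k).

Definition factors (b : bool) : kalg k := if b then A1 else A2.
Definition tensor2 : kalg k := tensor factors.
Definition tens1 : khom A1 tensor2 := @tensor_in k bool factors true.
Definition tens2 : khom A2 tensor2 := @tensor_in k bool factors false.

Record bilinear (M : zmodType) (beta : A1 -> A2 -> M) : Prop := Bilinear {
  bilinDl : forall a a' b, beta (a + a') b = beta a b + beta a' b;
  bilinDr : forall a b b', beta a (b + b') = beta a b + beta a b';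
  bilinZ : forall c a b, beta (kstr A1 c * a) b = beta a (kstr A2 c * b) }.

Definition expand_var (x : {j : bool & kcar (factors j)}) : seq (A1 * A2) :=
  let: existT j a := x in
  (if j as j return kcar (factors j) -> seq (A1 * A2)
   then fun a => [:: (a, 1)] else fun a => [:: (1, a)]) a.

(** The pure tensors whose sum is the value of a term. *)
Fixpoint expand (t : term k {j : bool & kcar (factors j)}) : seq (A1 * A2) :=
  match t with
  | TConst c => [:: (kstr A1 c, 1)]
  | TVar x => expand_var x
  | TAdd t u => expand t ++ expand u
  | TOpp t => [seq (- x.1, x.2) | x <- expand t]
  | TMul t u => [seq (x.1 * y.1, x.2 * y.2) | x <- expand t, y <- expand u]
  end.

Definition bsum (M : zmodType) (beta : A1 -> A2 -> M) (s : seq (A1 * A2)) : M :=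
  \sum_(x <- s) beta x.1 x.2.

Section Laws.
Variables (M : zmodType) (beta : A1 -> A2 -> M).
Hypothesis bil : bilinear beta.

Lemma bilin0l b : beta 0 b = 0.
Proof. by apply: (@addrI _ (beta 0 b)); rewrite -bilinDl // !addr0. Qed.
Lemma bilinNl a b : beta (- a) b = - beta a b.
Proof. by apply: (@addrI _ (beta a b)); rewrite -bilinDl // !subrr bilin0l. Qed.

Lemma bilinear_shift a b : bilinear (fun x y => beta (x * a) (y * b)).
Proof.
split=> [x x' y|x y y'|c x y].
- by rewrite mulrDl (bilinDl bil).
- by rewrite mulrDl (bilinDr bil).
- by rewrite -!mulrA (bilinZ bil).
Qed.

Lemma bsum_cat s t : bsum beta (s ++ t) = bsum beta s + bsum beta t.
Proof. exact: big_cat. Qed.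
Lemma bsum_opp s : bsum beta [seq (- x.1, x.2) | x <- s] = - bsum beta s.
Proof.
by rewrite /bsum big_map -sumrN; apply: eq_bigr => x _; rewrite bilinNl.
Qed.
Lemma bsum_mul s t : bsum beta [seq (x.1 * y.1, x.2 * y.2) | x <- s, y <- t]
  = \sum_(y <- t) bsum (fun a b => beta (a * y.1) (b * y.2)) s.
Proof. by rewrite /bsum big_allpairs_dep exchange_big. Qed.
Lemma bsum_mul' s t : bsum beta [seq (x.1 * y.1, x.2 * y.2) | x <- s, y <- t]
  = \sum_(x <- s) bsum (fun a b => beta (a * x.1) (b * x.2)) t.
Proof.
rewrite /bsum big_allpairs_dep; apply: eq_bigr => x _; apply: eq_bigr => y _.
by rewrite [x.1 * _]mulrC [x.2 * _]mulrC.
Qed.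
End Laws.

(** For products the induction needs all bilinear maps at once, since a factor is
    absorbed by [bilinear_shift]. *)
Lemma expand_eqv t u : eqv (@tensor_rel k bool factors) t u ->
  forall (M : zmodType) (beta : A1 -> A2 -> M), bilinear beta ->
  bsum beta (expand t) = bsum beta (expand u).
Proof.
elim=> {t u} [t u r|t|t u _ IH|t u v _ IH1 _ IH2|t t' u u' _ IH1 _ IH2
  |t t' _ IH|t t' u u' _ IH1 _ IH2|c d|c d|t u v|t u|t|t|t u v|t u|t|t u v]
  M beta bil.
- case: r => [[] c|[] a b|[] a b] /=; rewrite /bsum !big_seq1 ?big_cons ?big_nil ?addr0 /=.
  + by [].
  + by rewrite -[kstr A2 c]mulr1 -bilinZ // mulr1.
  + by rewrite bilinDl.
  + by rewrite bilinDr.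
  + by rewrite mulr1.
  + by rewrite mulr1.
- by [].
- by rewrite IH.
- by rewrite IH1 // IH2.
- by rewrite /= !bsum_cat IH1 // IH2.
- by rewrite /= !bsum_opp // IH.
- rewrite /= bsum_mul [RHS]bsum_mul'.
  transitivity (\sum_(y <- expand u) bsum (fun a b => beta (a * y.1) (b * y.2))
    (expand t')).
    by apply: eq_bigr => y _; apply: IH1; exact: bilinear_shift.
  rewrite -(bsum_mul beta (expand t') (expand u)) bsum_mul'.
  apply: eq_bigr => x _; apply: IH2.
  exact: bilinear_shift.
- by rewrite /= /bsum !big_cons !big_nil !addr0 rmorphD bilinDl.
- by rewrite /= /bsum !big_cons !big_nil !addr0 /= rmorphM mulr1.
- by rewrite /= !bsum_cat addrA.
- by rewrite /= !bsum_cat addrC.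
- by rewrite /= /bsum big_cons /= rmorph0 bilin0l // add0r.
- by rewrite /= bsum_cat bsum_opp // addNr /bsum big_seq1 /= rmorph0 bilin0l.
- rewrite /= !bsum_mul'; rewrite /bsum big_allpairs_dep; apply: eq_bigr => x _.
  rewrite big_allpairs_dep; apply: eq_bigr => y _; apply: eq_bigr => z _.
  by congr (beta _ _); rewrite /=; ring.
- by rewrite /= bsum_mul bsum_mul'.
- rewrite /= /bsum cats0 big_map; apply: eq_bigr => x _; rewrite /= rmorph1.
  by rewrite !mul1r.
- by rewrite /= bsum_cat !bsum_mul' big_cat.
Qed.

(** The tensor product is presented as an algebra, so its universal property
    concerns morphisms of algebras; this is the universal property that it has as a
    vector space. *)
Lemma bilinear_lift (M : zmodType) (beta : A1 -> A2 -> M) : bilinear beta ->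
  exists f : tensor2 -> M, (forall x y, f (x + y) = f x + f y) /\
    forall a b, f (tens1 a * tens2 b) = beta a b.
Proof.
move=> bil.
pose f (p : tensor2) := bsum beta (expand (repr (p : pres (@tensor_rel k bool factors)))).
have fE t : f (cls _ t) = bsum beta (expand t).
  by apply: expand_eqv => //; exact: reprP.
exists f; split=> [x y|a b].
  by rewrite -[x]clsK -[y]clsK -clsD !fE /= bsum_cat.
have -> : tens1 a * tens2 b = cls (@tensor_rel k bool factors)
    (TMul (TVar k (existT (fun j => kcar (factors j)) true a))
          (TVar k (existT (fun j => kcar (factors j)) false b))).
  by rewrite clsM.
by rewrite fE /= /bsum big_cons big_nil /= addr0 mul1r mulr1.
Qed.

Lemma tensor2_ind (Q : tensor2 -> Prop) : (forall a b, Q (tens1 a * tens2 b)) ->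
  (forall x y, Q x -> Q y -> Q (x + y)) -> forall x, Q x.
Proof.
move=> Qp QD; pose Q' (x : tensor2) :=
  exists s : seq (A1 * A2), x = \sum_(z <- s) tens1 z.1 * tens2 z.2.
have Q0 : Q 0 by rewrite -(mul0r (tens2 0)) -(rmorph0 tens1).
suff Q'x x : Q' x.
  by move=> x; have [s ->] := Q'x x; elim/big_ind: _ => // z _; exact: Qp.
move: x; apply: (presented_ind (Q := Q')) => [[[] a]|c|x y|x|x y].
- by exists [:: (a, 1)]; rewrite big_seq1 rmorph1 mulr1.
- by exists [:: (1, a)]; rewrite big_seq1 rmorph1 mul1r.
- by exists [:: (kstr A1 c, 1)]; rewrite big_seq1 rmorph1 mulr1 kfunE.
- by move=> [s ->] [t ->]; exists (s ++ t); rewrite big_cat.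
- move=> [s ->]; exists [seq (- z.1, z.2) | z <- s]; rewrite big_map -sumrN.
  by apply: eq_bigr => z _; rewrite rmorphN mulNr.
- move=> [s ->] [t ->]; exists [seq (z.1 * w.1, z.2 * w.2) | z <- s, w <- t].
  rewrite big_allpairs_dep mulr_suml; apply: eq_bigr => z _.
  rewrite mulr_sumr; apply: eq_bigr => w _; rewrite !rmorphM.
  by rewrite mulrACA.
Qed.

Definition tensor2_lift (R : kalg k) (f : khom A1 R) (g : khom A2 R) :
  khom tensor2 R :=
  @tensor_lift k bool factors R (fun b => if b as b return khom (factors b) R then f else g).

Lemma tensor2_lift1 R f g a : @tensor2_lift R f g (tens1 a) = f a.
Proof. exact: tensor_liftE. Qed.
Lemma tensor2_lift2 R f g a : @tensor2_lift R f g (tens2 a) = g a.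
Proof. exact: tensor_liftE. Qed.

Lemma tensor2_ext (R : kalg k) (f g : khom tensor2 R) :
  (forall a, f (tens1 a) = g (tens1 a)) -> (forall a, f (tens2 a) = g (tens2 a)) ->
  f =1 g.
Proof. by move=> e1 e2; apply: tensor_ext => -[] b; [exact: e1 | exact: e2]. Qed.

End Tensor2.

(** * Dimension of algebras and base change *)

Section AlgDim.
Variable k : fieldType.

Definition alg_dim (A : kalg k) n := has_dim_in (@whole _ (kmod A)) n.

Lemma alg_dim_unique A n m : alg_dim A n -> alg_dim A m -> n = m.
Proof. exact: dim_unique (zero_subspace _). Qed.

Lemma row_dim n : has_dim_in (@whole _ 'rV[k]_n) n.
Proof.
exists (fun i => delta_mx ord0 i); split=> // [c /rowP c0 i|x _].
  move: (c0 i); rewrite summxE (bigD1 i) //= !mxE !eqxx mulr1 big1 ?addr0 //.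
  by move=> j ji; rewrite !mxE eqxx /= eq_sym (negPf ji) mulr0.
by exists (x ord0); rewrite -row_sum_delta subrr.
Qed.

Lemma has_dimP (A : kalg k) n : has_dim A n <-> alg_dim A n.
Proof.
split=> [[[f flin fbij]]|[b [_ ib bA]]].
  have fD x y : f (x + y) = f x + f y by rewrite -[x]scale1r flin !scale1r.
  have f0 : f 0 = 0 by apply: (@addrI _ (f 0)); rewrite -fD !addr0.
  apply: (@dim_preimage _ (kmod A) 'rV[k]_n f _ _ _ _ _ _ _ _ (row_dim n)) => //.
  - by move=> a x; have := flin a x 0; rewrite f0 !addr0.
  - exact: bij_inj.
  - by case: fbij => g fK gK y _; exists (g y).
have /choice[c cP] : forall v : kmod A, exists c : 'I_n -> k, v = \sum_i c i *: b i.
  by move=> v; have [c /subr0_eq ->] := bA v I; exists c.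
have uniq v d : v = \sum_i d i *: b i -> forall i, c v i = d i.
  move=> vd i; apply/subr0_eq; apply: (ib (fun i => c v i - d i)).
  under eq_bigr do rewrite scalerBl.
  by rewrite sumrB -cP -vd subrr.
constructor; exists (fun v => \row_i c v i).
  move=> a x y; apply/rowP => i; rewrite !mxE.
  apply: (uniq _ (fun i => a * c x i + c y i)).
  under eq_bigr do rewrite scalerDl -scalerA.
  by rewrite big_split -scaler_sumr -!cP.
exists (fun x : 'rV_n => \sum_i x ord0 i *: b i).
  by move=> v; rewrite [RHS]cP; apply: eq_bigr => i _; rewrite mxE.
by move=> x; apply/rowP => i; rewrite mxE; exact: uniq.
Qed.

Lemma alg_dim_iso (A B : kalg k) (f : khom A B) n : bijective f ->
  alg_dim A n <-> alg_dim B n.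
Proof.
move=> fbij; have fZ (a : k) (x : kmod A) : f (a *: x) = a *: (f x : kmod B).
  by have := rmorphM f (kstr A a) x; rewrite kfunE.
have fD (x y : kmod A) : f (x + y) = (f x : kmod B) + f y by exact: rmorphD.
have finj := bij_inj fbij; case: fbij => g fK gK.
split; [apply: (@dim_image _ (kmod A) (kmod B) f)
  | apply: (@dim_preimage _ (kmod A) (kmod B) f)] => //.
  by move=> y _; exists (g y).
by move=> y _; exists (g y).
Qed.

Section BaseChange.
Variables (t : {rmorphism k -> k}) (A : kalg k).

Let kt : kalg k := @KAlg k (kbase k) t.
Let H : kalg k := @KAlg k (tensor2 A kt) (kfun (tens2 A kt)).

(* The base change maps to the tensor product over [k] with a copy [kt] of [k] on
   which [k] acts through [t], where bilinear maps can be used. *)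
Fact bchange_tensor_str c :
  tens1 A kt (kstr A c) = kstr (twist t H) c.
Proof. by rewrite kfunE -(kfunE (tens2 A kt)). Qed.

Definition bchange_tensor : khom (bchange t A) H :=
  bchange_lift (@KHom k A (twist t H) (kfun (tens1 A kt)) bchange_tensor_str).

Lemma bchange_tensorE a : bchange_tensor (bchange_map t A a) = tens1 A kt a.
Proof. exact: bchange_liftE. Qed.

(** Functionals on [A] extend semilinearly to the base change. *)
Lemma bchange_indep n (b : 'I_n -> kmod A) : indep_mod zero_space b ->
  indep_mod zero_space (fun i => bchange_map t A (b i) : kmod (bchange t A)).
Proof.
move=> /(dual_family (zero_subspace _))[nu [nuD nuZ _ nub]] c c0 i.
have [|f [fD fP]] := @bilinear_lift k A kt k (fun a e => t (nu i a) * e).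
  split=> [a a' e|a e e'|d a e].
  - by rewrite nuD rmorphD mulrDl.
  - by rewrite mulrDr.
  - by rewrite (nuZ i d (a : kmod A)) rmorphM mulrCA mulrA.
have f0 : f 0 = 0 by apply: (@addrI _ (f 0)); rewrite -fD !addr0.
have bE j : bchange_tensor (kstr (bchange t A) (c j) * bchange_map t A (b j))
    = tens1 A kt (b j) * tens2 A kt (c j).
  rewrite mulrC rmorphM bchange_tensorE; congr (_ * _).
  exact: (kfunE bchange_tensor).
transitivity (f (bchange_tensor (\sum_j kstr (bchange t A) (c j) * bchange_map t A (b j)))).
  rewrite rmorph_sum (big_morph f fD f0) (bigD1 i) //= big1 => [|j ji].
    by rewrite addr0 bE fP nub eqxx rmorph1 mul1r.
  by rewrite bE fP nub eq_sym (negPf ji) rmorph0 mul0r.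
by rewrite [\sum_j _]c0 rmorph0.
Qed.

Lemma bchange_dim n : alg_dim A n -> alg_dim (bchange t A) n.
Proof.
move=> [b [_ ib bA]]; exists (fun i => bchange_map t A (b i)); split=> //.
  exact: bchange_indep.
pose span (x : bchange t A) := exists c : 'I_n -> k,
  x = \sum_i kstr (bchange t A) (c i) * bchange_map t A (b i).
suff spanP x : span x by move=> x _; have [c ->] := spanP x; exists c; exact: subrr.
have span0 : span 0.
  by exists (fun=> 0); rewrite big1 // => i _; rewrite rmorph0 mul0r.
have spanD u v : span u -> span v -> span (u + v).
  move=> [c ->] [d ->]; exists (fun i => c i + d i); rewrite -big_split.
  by apply: eq_bigr => i _; rewrite rmorphD mulrDl.
have spanZ e u : span u -> span (kstr (bchange t A) e * u).
  move=> [c ->]; exists (fun i => e * c i); rewrite mulr_sumr.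
  by apply: eq_bigr => i _; rewrite rmorphM mulrA.
have spanA (a : A) : span (bchange_map t A a).
  have [c /subr0_eq aE] := bA a I.
  have -> : a = \sum_i kstr A (c i) * b i by [].
  exists (fun i => t (c i)); rewrite rmorph_sum; apply: eq_bigr => i _.
  by rewrite rmorphM kfunE.
have spanM u v : span u -> span v -> span (u * v).
  move=> [c ->] [d ->]; rewrite mulr_suml; apply: (big_ind span) => // i _.
  rewrite -mulrA; apply: (spanZ); rewrite mulr_sumr; apply: (big_ind span) => // j _.
  by rewrite mulrCA; apply: (spanZ); rewrite -rmorphM.
move: x; apply: (presented_ind (Q := span)) => // [c|x sx].
  rewrite -[kstr _ c]mulr1 -(rmorph1 (bchange_map t A)); exact: spanZ.
rewrite -mulN1r -(rmorph1 (kstr (bchange t A))) -rmorphN; exact: spanZ.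
Qed.

Lemma bchange_dimV n : alg_dim (bchange t A) n -> alg_dim A n.
Proof.
move=> dn; have [e [_ _ eB]] := dn; have [m dm] : exists m, alg_dim A m.
  apply: (@dim_bounded _ _ n) => m b /bchange_indep ib.
  rewrite -(card_ord m) -(card_ord n).
  by apply: indep_le (zero_subspace _) ib _ => j; exact: eB.
by rewrite (alg_dim_unique dn (bchange_dim dm)).
Qed.
End BaseChange.
End AlgDim.

(** * Coframes of Hopf subalgebras *)

Lemma tensor2_sum (k : fieldType) (A1 A2 : kalg k) (x : tensor2 A1 A2) :
  exists s : seq (A1 * A2), x = \sum_(z <- s) tens1 A1 A2 z.1 * tens2 A1 A2 z.2.
Proof.
move: x; apply: tensor2_ind => [a b|_ _ [s ->] [t ->]].
  by exists [:: (a, b)]; rewrite big_seq1.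
by exists (s ++ t); rewrite big_cat.
Qed.

(** The Hopf algebra [R] is given by the morphism [Delta] dual to [(x, y) |-> x * y],
    the morphism [Delta'] dual to [(x, y) |-> x^-1 * y] and the counit [eps].
    Coassociativity is contained in [DeltaK] and [DeltaK']: the maps
    [(x, y) |-> (x, x * y)] and [(x, y) |-> (x, x^-1 * y)] are mutually inverse. *)
Section Hopf.
Variables (k : fieldType) (R : kalg k).
Let H := tensor2 R R.
Let in1 : khom R H := tens1 R R.
Let in2 : khom R H := tens2 R R.
Variables (Delta Delta' : khom R H) (eps : khom R (kbase k)).

Definition unit_hom : khom (kbase k) R := @KHom k (kbase k) R (kstr R) (fun=> erefl).

Hypothesis DeltaK : forall r, tensor2_lift in1 Delta (Delta' r) = in2 r.
Hypothesis DeltaK' : forall r, tensor2_lift in1 Delta' (Delta r) = in2 r.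
Hypothesis counit : forall r,
  tensor2_lift (kid R) (kcomp unit_hom eps) (Delta r) = r.
Hypothesis antipode : forall r,
  tensor2_lift (kid R) (kid R) (Delta' r) = kstr R (eps r).

(** Membership in the image of [X (x) X], which for [Delta] and [Delta'] makes [X] a
    Hopf subalgebra. *)
Definition pure (X : subring R) (h : H) := exists s : seq (carrier X * carrier X),
  h = \sum_(z <- s) in1 (val z.1) * in2 (val z.2).

Lemma lift_pure (T : kalg k) (f g : khom R T) (X : subring R)
    (s : seq (carrier X * carrier X)) :
  tensor2_lift f g (\sum_(z <- s) in1 (val z.1) * in2 (val z.2))
  = \sum_(z <- s) f (val z.1) * g (val z.2).
Proof.
rewrite rmorph_sum; apply: eq_bigr => z _.
by rewrite rmorphM tensor2_lift1 tensor2_lift2.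
Qed.

Variables X X' : subring R.
Hypothesis kX : forall c, X (kstr R c).
Hypothesis XX' : forall x, X x -> X' x.
Hypotheses (pX : forall x, X x -> pure X (Delta x))
  (pX' : forall x, X' x -> pure X' (Delta x))
  (qX : forall x, X x -> pure X (Delta' x))
  (qX' : forall x, X' x -> pure X' (Delta' x)).

Let kX' c : X' (kstr R c). Proof. exact: XX'. Qed.
Let B := base_sub X X'.

Definition aug (b : carrier X') := X (val b) /\ eps (val b) = 0.

(** This is [X^+ X'], transported to [R], where the linear algebra takes place. *)
Definition aug_ideal (r : R) := exists2 y : carrier X', ideal aug y & val y = r.

Lemma aug_ideal_subspace : subspace (aug_ideal : kmod R -> Prop).
Proof.
split=> [|_ _ [x Ix <-] [y Iy <-]|c _ _ [x Ix <-]].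
- by exists 0; [exact: ideal0 | ].
- by exists (x + y); [exact: idealD | ].
- by exists (to_sub (kX' c) * x); [exact: idealM | ].
Qed.

Lemma aug_idealM b c : X b -> X' c -> eps b = 0 -> aug_ideal (b * c).
Proof.
move=> Xb Xc eb; exists (to_sub (XX' Xb) * to_sub Xc); last by [].
by apply/idealMr/ideal_gen; split.
Qed.

Section Family.
Variables (d : nat) (n : 'I_d -> R).
Hypotheses (X'n : forall i, X' (n i))
  (ind : indep_mod (aug_ideal : kmod R -> Prop) (n : 'I_d -> kmod R)).

Lemma dual_functionals : exists nu : 'I_d -> R -> k,
  [/\ forall i x y, nu i (x + y) = nu i x + nu i y,
      forall i c x, nu i (kstr R c * x) = c * nu i x,
      forall i u, aug_ideal u -> nu i u = 0 & forall i j, nu i (n j) = (i == j)%:R].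
Proof. exact: (dual_family aug_ideal_subspace ind). Qed.

(** This is the isomorphism [X' (x)_X X' = X' (x)_k (X' / X^+ X')] given by
    [c (x) c' |-> (c (x) 1) Delta c'], which says that [Spec X' -> Spec X] is a
    torsor under its kernel.  If [nu] are coordinates on the quotient by
    [aug_ideal], then [delta c] is [(id (x) nu) (Delta c)], and the dual basis comes
    from applying [Delta'] to the [n i]. *)
Lemma coframe_exists : exists delta : 'I_d -> carrier X' -> carrier X',
  coframe B delta /\ ((forall c, X' c -> span_mod (aug_ideal : kmod R -> Prop)
    (n : 'I_d -> kmod R) c) -> complete B delta).
Proof.
have [nu [nuD nuZ nu0 nun]] := dual_functionals.
(* On [X' / X^+ X'] the subalgebra [X] acts through [eps]. *)
have nuM i b c : X b -> X' c -> nu i (b * c) = eps b * nu i c.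
  move=> Xb Xc; rewrite -nuZ; apply/subr0_eq.
  have nuN x : nu i (- x) = - nu i x.
    by rewrite -mulN1r -(rmorph1 (kstr R)) -rmorphN nuZ mulN1r.
  rewrite -nuN -nuD -mulrBl; apply/nu0/aug_idealM => //.
    by apply: smemD => //; exact: smemN.
  by rewrite rmorphB (kfunE eps) subrr.
have /choice[f fP] : forall i, exists f : H -> R,
    (forall x y, f (x + y) = f x + f y) /\
    forall a b, f (in1 a * in2 b) = a * kstr R (nu i b).
  move=> i; apply: (@bilinear_lift _ R R R (fun a b => a * kstr R (nu i b))).
  split=> [a a' b|a b b'|c a b].
  - exact: mulrDl.
  - by rewrite nuD rmorphD mulrDr.
  - by rewrite nuZ rmorphM -mulrA mulrCA.
have fD i x y : f i (x + y) = f i x + f i y by case: (fP i).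
have fE i a b : f i (in1 a * in2 b) = a * kstr R (nu i b) by case: (fP i).
have f0 i : f i 0 = 0 by apply: (@addrI _ (f i 0)); rewrite -fD !addr0.
have fS i (J : Type) (s : seq J) (h : J -> H) :
    f i (\sum_(z <- s) h z) = \sum_(z <- s) f i (h z).
  exact: (big_morph (f i) (fD i) (f0 i)).
(* [f i] is [id (x) nu i], linear over the left factor. *)
have fM i a h : f i (in1 a * h) = a * f i h.
  have [s ->] := tensor2_sum h; rewrite mulr_sumr !fS mulr_sumr.
  by apply: eq_bigr => z _; rewrite mulrA -rmorphM !fE mulrA.
have fX' i c : X' c -> X' (f i (Delta c)).
  move=> /pX'[s ->]; rewrite fS; elim/big_ind: _ => [|x y|z _].
  - exact: smem0.
  - exact: smemD.
  - by rewrite fE; apply: smemM; [exact: subP | exact: kX'].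
pose delta i (c : carrier X') : carrier X' := to_sub (fX' i _ (subP c)).
have deltaE i c : val (delta i c) = f i (Delta (val c)) by [].
exists delta; split.
  split.
  - by move=> i x y; apply: val_inj; rewrite deltaE val_subD rmorphD fD.
  - move=> i b c Xb; apply: val_inj; rewrite deltaE !val_subM rmorphM deltaE.
    have [s sE] := pX Xb; have [t tE] := pX' (subP c).
    have bE : val b = \sum_(z <- s) val z.1 * kstr R (eps (val z.2)).
      by rewrite -{1}[val b]counit sE lift_pure.
    rewrite sE bE tE fS mulr_suml fS mulr_suml; apply: eq_bigr => z _.
    rewrite !mulr_sumr fS; apply: eq_bigr => w _.
    rewrite mulrACA -!rmorphM !fE (nuM _ _ _ (subP z.2) (subP w.2)) rmorphM.
    by rewrite mulrACA.
  - move=> i; have [s sE] := qX' (X'n i); exists s => j; apply: val_inj.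
    have e : f j (in2 (n i)) = kstr R (nu j (n i)).
      by rewrite -[in2 _]mul1r -(rmorph1 in1) fE mul1r.
    have -> : val ((i == j)%:R : carrier X') = kstr R (nu j (n i)).
      by rewrite nun eq_sym; case: (j == i);
        rewrite ?rmorph_nat ?(rmorph1 (kstr R)) ?(rmorph0 (kstr R)).
    rewrite -e -DeltaK sE lift_pure fS val_sub_sum.
    by apply: eq_bigr => z _; rewrite fM.
move=> spanX' M h g gD gM.
(* The map [g] is only given on [X']; a projection [pi] extends it to [R], where
   the tensor product is available. *)
have sX' : subspace (X' : kmod R -> Prop).
  split; [exact: (@smem0 _ X') | exact: (@smemD _ X') | move=> c x _ Xx; exact: smemM].
have [p [pD pZ pX0 pid]] := linear_projection sX'.
pose pi (r : R) : carrier X' := to_sub (pX0 r).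
have piE (x : carrier X') : pi (val x) = x by apply: val_inj; exact: (pid _ (subP x)).
have piD x y : pi (x + y) = pi x + pi y by apply: val_inj; exact: pD.
have piZ c x : pi (kstr R c * x) = to_sub (kX' c) * pi x.
  by apply: val_inj; exact: pZ.
have g0 : g 0 = 0 by apply: (@addrI _ (g 0)); rewrite -gD !addr0.
have [|Ga [GaD GaE]] := @bilinear_lift _ R R M (fun a b => h (pi a) * g (pi b)).
  split=> [a a' b|a b b'|c a b].
  - by rewrite piD rmorphD mulrDl.
  - by rewrite piD gD mulrDr.
  - rewrite !piZ rmorphM gM; last exact: kX.
    by rewrite mulrCA mulrA.
have Ga0 : Ga 0 = 0 by apply: (@addrI _ (Ga 0)); rewrite -GaD !addr0.
have GaS (J : Type) (s : seq J) (x : J -> H) :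
    Ga (\sum_(z <- s) x z) = \sum_(z <- s) Ga (x z).
  exact: (big_morph Ga GaD Ga0).
have GaM (a : carrier X') x : pure X' x -> Ga (in1 (val a) * x) = h a * Ga x.
  move=> [s ->]; rewrite mulr_sumr !GaS mulr_sumr; apply: eq_bigr => z _.
  by rewrite mulrA -rmorphM -[_ * _ : R]/(val (a * z.1)) !GaE !piE rmorphM mulrA.
(* [K c] is the image of [Delta' c] under [x (x) y |-> x * g y]; it factors through
   [X' / X^+ X'], so it is determined by its values on the [n i]. *)
pose K (c : carrier X') := Ga (Delta' (val c)).
have KD x y : K (x + y) = K x + K y by rewrite /K val_subD rmorphD GaD.
have KM (b c : carrier X') : X (val b) -> K (b * c) = h (to_sub (kX' (eps (val b)))) * K c.
  move=> Xb; have [s sE] := qX Xb; have [t tE] := qX' (subP c).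
  pose up (x : carrier X) : carrier X' := to_sub (XX' (subP x)).
  have -> : to_sub (kX' (eps (val b))) = \sum_(z <- s) up z.1 * up z.2.
    apply: val_inj; rewrite to_subK -antipode sE lift_pure val_sub_sum.
    by apply: eq_bigr.
  rewrite /K val_subM rmorphM sE tE rmorph_sum !mulr_suml GaS; apply: eq_bigr => z _.
  rewrite !mulr_sumr !GaS mulr_sumr; apply: eq_bigr => w _.
  rewrite mulrACA -!rmorphM.
  rewrite -[val z.1 * _]/(val (up z.1 * w.1)) -[val z.2 * _]/(val (up z.2 * w.2)).
  by rewrite !GaE !piE gM ?rmorphM; [rewrite mulrACA mulrA | exact: (subP z.2)].
have KI c : ideal aug c -> K c = 0.
  elim=> {c} [|b c a [Xb eb] _ IH]; first by rewrite /K !rmorph0.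
  rewrite KD IH addr0 KM // (_ : to_sub _ = 0) ?rmorph0 ?mul0r //.
  by apply: val_inj; rewrite to_subK eb rmorph0.
pose nn i : carrier X' := to_sub (X'n i).
exists (fun i => K (nn i)) => c.
have KE (b : carrier X') : K b = \sum_i h (to_sub (kX' (nu i (val b)))) * K (nn i).
  have [a [y Iy yE]] := spanX' _ (subP b).
  have nub i : nu i (val b) = a i.
    have nuS (x : 'I_d -> R) : nu i (\sum_j x j) = \sum_j nu i (x j).
      apply: (big_morph (nu i) (nuD i)).
      by rewrite -(mul0r 0) -{1}(rmorph0 (kstr R)) nuZ mul0r.
    have -> : val b = val y + \sum_j kstr R (a j) * n j by rewrite yE; exact/esym/subrK.
    rewrite nuD nuS nu0 ?add0r; last by exists y.
    rewrite (bigD1 i) //= big1 ?addr0 => [|j ji]; first by rewrite nuZ nun eqxx mulr1.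
    by rewrite nuZ nun eq_sym (negPf ji) mulr0.
  have bE : b = y + \sum_j to_sub (kX' (a j)) * nn j.
    apply: val_inj; rewrite val_subD val_sub_sum yE; exact/esym/subrK.
  rewrite {1}bE KD KI // add0r.
  have KS (x : 'I_d -> carrier X') : K (\sum_j x j) = \sum_j K (x j).
    by apply: (big_morph K KD); rewrite /K !rmorph0.
  rewrite KS; apply: eq_bigr => i _; rewrite KM to_subK; last exact: kX.
  by rewrite nub (kfunE eps).
have -> : g c = Ga (in2 (val c)).
  by rewrite -[in2 _]mul1r -(rmorph1 in1) GaE piE (piE 1) rmorph1 mul1r.
have [s sE] := pX' (subP c).
rewrite -DeltaK' sE lift_pure GaS.
transitivity (\sum_(z <- s) \sum_i h (z.1 * to_sub (kX' (nu i (val z.2)))) * K (nn i)).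
  apply: eq_bigr => z _; rewrite GaM; last exact/qX'/subP.
  rewrite -/(K z.2) KE mulr_sumr; apply: eq_bigr => i _.
  by rewrite rmorphM mulrA.
rewrite exchange_big; apply: eq_bigr => i _; rewrite -mulr_suml -rmorph_sum.
congr (h _ * _); apply: val_inj; rewrite deltaE sE fS val_sub_sum.
by apply: eq_bigr => z _; rewrite fE.
Qed.
End Family.
End Hopf.

(** * The Hopf algebra of a difference algebraic group *)

(** The multiplication and the word [x^-1 * y], which inverts the shear
    [(x, y) |-> (x, x * y)], are treated together. *)
Definition word (b : bool) (Gr : groupType) (x y : Gr) : Gr :=
  ((if b then x^-1 else x) * y)%g.

Section Words.
Variables (C : category) (F : group_functor C).

Lemma fmapV (A B : C) (f : mor A B) (x : F A) : fmap f (x^-1)%g = ((fmap f x)^-1)%g.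
Proof.
by apply: (@mulgI _ (fmap f x)); rewrite -fmapM !mulgV fmap1.
Qed.

Lemma fmap_word b (A B : C) (f : mor A B) (x y : F A) :
  fmap f (word b x y) = word b (fmap f x) (fmap f y).
Proof. by rewrite /word fmapM; case: b; rewrite ?fmapV. Qed.

Lemma nat_word (E : group_functor C) (e : group_nat F E) b (A : C) (x y : F A) :
  e A (word b x y) = word b (e A x) (e A y).
Proof.
rewrite /word nat_mapM; case: b => //; congr (_ * _)%g.
apply: (@mulgI _ (e A x)); rewrite -nat_mapM !mulgV.
by apply: (@mulgI _ (e A 1%g)); rewrite -nat_mapM !mulg1.
Qed.
End Words.

Section Diff.
Variables (k : fieldType) (s : {rmorphism k -> k}).

Section SigTensor.
Variable R : sigalg s.
Let H : kalg k := tensor2 R R.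

Definition tensor_act : khom H (twist s H) :=
  @tensor2_lift k R R (twist s H)
    (kcomp (twist_map s (tens1 R R)) (sact_twist R))
    (kcomp (twist_map s (tens2 R R)) (sact_twist R)).

Definition sig_tensor : sigalg s := @SigAlg k s H (kfun tensor_act) (kfunE tensor_act).

Fact sig_tens1_subproof a : tens1 R R (sact R a) = sact sig_tensor (tens1 R R a).
Proof. exact/esym/(tensor2_lift1 (R := twist s H)). Qed.
Definition sig_tens1 : sighom R sig_tensor :=
  @SigHom k s R sig_tensor (tens1 R R) sig_tens1_subproof.

Fact sig_tens2_subproof a : tens2 R R (sact R a) = sact sig_tensor (tens2 R R a).
Proof. exact/esym/(tensor2_lift2 (R := twist s H)). Qed.
Definition sig_tens2 : sighom R sig_tensor :=
  @SigHom k s R sig_tensor (tens2 R R) sig_tens2_subproof.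

Section Lift.
Variables (Y : sigalg s) (f g : sighom R Y).
Fact sig_lift_subproof p :
  tensor2_lift f g (sact sig_tensor p) = sact Y (tensor2_lift f g p).
Proof.
pose h1 : khom H (twist s Y) := kcomp (twist_map s (tensor2_lift f g)) tensor_act.
pose h2 : khom H (twist s Y) := kcomp (sact_twist Y) (tensor2_lift f g).
suff: h1 =1 h2 by exact.
apply: tensor2_ext => a.
  change (tensor2_lift f g (tensor_act (tens1 R R a))
    = sact Y (tensor2_lift f g (tens1 R R a))).
  have -> : tensor_act (tens1 R R a) = tens1 R R (sact R a).
    exact: (tensor2_lift1 (R := twist s H)).
  by rewrite !tensor2_lift1 sfunE.
change (tensor2_lift f g (tensor_act (tens2 R R a))
  = sact Y (tensor2_lift f g (tens2 R R a))).
have -> : tensor_act (tens2 R R a) = tens2 R R (sact R a).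
  exact: (tensor2_lift2 (R := twist s H)).
by rewrite !tensor2_lift2 sfunE.
Qed.
Definition sig_lift : sighom sig_tensor Y :=
  @SigHom k s sig_tensor Y (tensor2_lift f g) sig_lift_subproof.

Lemma sig_lift1 : scomp sig_lift sig_tens1 = f.
Proof. by apply: sighom_ext => a; exact: tensor2_lift1. Qed.
Lemma sig_lift2 : scomp sig_lift sig_tens2 = g.
Proof. by apply: sighom_ext => a; exact: tensor2_lift2. Qed.
End Lift.

Definition sig_base : sigalg s := @SigAlg k s (kbase k) s (fun=> erefl).

Definition sig_unit : sighom sig_base R :=
  @SigHom k s sig_base R (unit_hom R) (fun c => esym (sactE R c)).
End SigTensor.

Section Group.
Variable G : sig_group s.
Let R := sig_coord G.
Let u : G R := universal (sig_rep G).
Let C := sigalg_category s.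
Let mk (A B : sigalg s) (f : sighom A B) : @mor C A B := f.

Let in1 : sighom R (sig_tensor R) := sig_tens1 R.
Let in2 : sighom R (sig_tensor R) := sig_tens2 R.

(** Dual to [word b]: [false] gives the comultiplication. *)
Definition coword b : sighom R (sig_tensor R) :=
  classify (sig_rep G) (word b (fmap (mk in1) u) (fmap (mk in2) u)).

Lemma fmap_coword b : fmap (mk (coword b)) u = word b (fmap (mk in1) u) (fmap (mk in2) u).
Proof. exact: classifyK. Qed.

Definition counit_hom : sighom R (sig_base) := classify (sig_rep G) (1%g : G sig_base).

(** Yoneda: evaluating the dual of a word at two points gives the word in these
    points. *)
Lemma coword_lift b (Y : sigalg s) (f g : sighom R Y) r :
  tensor2_lift f g (coword b r) =
  (classify (sig_rep G) (word b (fmap (mk f) u) (fmap (mk g) u)) : sighom R Y) r.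
Proof.
have e1 : fmap (mk (sig_lift f g)) (fmap (mk in1) u) = fmap (mk f) u.
  by rewrite -fmap_comp; congr fmap; exact: sig_lift1.
have e2 : fmap (mk (sig_lift f g)) (fmap (mk in2) u) = fmap (mk g) u.
  by rewrite -fmap_comp; congr fmap; exact: sig_lift2.
by rewrite -e1 -e2 -fmap_word (classify_natural (sig_rep G)).
Qed.

Lemma classify_fmap (Y : sigalg s) (f : sighom R Y) :
  classify (sig_rep G) (fmap (mk f) u) = f.
Proof. exact: fmapK. Qed.

Lemma word_mulK b (Gr : groupType) (x y : Gr) : word b x (word (~~ b) x y) = y.
Proof. by rewrite /word; case: b => /=; [exact: mulKg | exact: mulVKg]. Qed.

Lemma coword_cancel b r : tensor2_lift in1 (coword b) (coword (~~ b) r) = in2 r.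
Proof.
rewrite (coword_lift _ in1 (coword b)) fmap_coword -{2}[b]negbK word_mulK.
by rewrite classify_fmap.
Qed.

Lemma coword_counit r :
  tensor2_lift (kid R) (kcomp (unit_hom R) counit_hom) (coword false r) = r.
Proof.
rewrite (coword_lift false (sid R) (scomp (sig_unit R) counit_hom)) /word.
have -> : fmap (mk (scomp (sig_unit R) counit_hom)) u = 1%g.
  have -> : mk (scomp (sig_unit R) counit_hom)
    = compm (mk (sig_unit R)) (mk counit_hom) by [].
  by rewrite fmap_comp [fmap (mk counit_hom) u]classifyK fmap1.
by rewrite mulg1 classify_fmap.
Qed.

Lemma coword_antipode r :
  tensor2_lift (kid R) (kid R) (coword true r) = kstr R (counit_hom r).
Proof.
rewrite (coword_lift true (sid R) (sid R)) /word mulVg.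
have -> : (1%g : G R) = fmap (mk (sig_unit R)) (1%g : G sig_base) by rewrite fmap1.
by rewrite (classify_natural (sig_rep G)).
Qed.

End Group.
End Diff.

(** * The Hopf subalgebras cut out by an embedding *)

Section Image.
Variables (Y T : comPzRingType) (f : {rmorphism Y -> T}).
Fact image1 : exists y, f y = 1. Proof. by exists 1; exact: rmorph1. Qed.
Fact imageN1 : exists y, f y = -1. Proof. by exists (-1); rewrite rmorphN rmorph1. Qed.
Fact imageD a b : (exists y, f y = a) -> (exists y, f y = b) -> exists y, f y = a + b.
Proof. by move=> [y <-] [z <-]; exists (y + z); exact: rmorphD. Qed.
Fact imageM a b : (exists y, f y = a) -> (exists y, f y = b) -> exists y, f y = a * b.
Proof. by move=> [y <-] [z <-]; exists (y * z); exact: rmorphM. Qed.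
Definition image_subring : subring T := SubRing image1 imageN1 imageD imageM.
End Image.

Lemma quot_map_surj (k : fieldType) (A : kalg k) (S : A -> Prop) (q : quot S) :
  exists a, quot_map S a = q.
Proof.
move: q; apply: presented_ind => [a|c|_ _ [a <-] [b <-]|_ [a <-]|_ _ [a <-] [b <-]].
- by exists a.
- by exists (kstr A c); exact: (kfunE (quot_map S)).
- by exists (a + b); exact: rmorphD.
- by exists (- a); exact: rmorphN.
- by exists (a * b); exact: rmorphM.
Qed.

Lemma pure_subring (k : fieldType) (R : kalg k) (X : subring R)
    (kX : forall c, X (kstr R c)) :
  [/\ forall c, pure X (kstr (tensor2 R R) c),
      forall x y, pure X x -> pure X y -> pure X (x + y),
      forall x, pure X x -> pure X (- x)
    & forall x y, pure X x -> pure X y -> pure X (x * y)].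
Proof.
split.
- move=> c; exists [:: (to_sub (kX c), 1)].
  by rewrite big_seq1 /= rmorph1 mulr1 (kfunE (tens1 R R)).
- by move=> _ _ [t ->] [w ->]; exists (t ++ w); rewrite big_cat.
- move=> _ [t ->]; exists [seq (- z.1, z.2) | z <- t]; rewrite big_map -sumrN.
  by apply: eq_bigr => z _; rewrite /= rmorphN mulNr.
- move=> _ _ [t ->] [w ->]; exists [seq (z.1 * y.1, z.2 * y.2) | z <- t, y <- w].
  rewrite big_allpairs_dep mulr_suml; apply: eq_bigr => z _.
  rewrite mulr_sumr; apply: eq_bigr => y _; rewrite /= !rmorphM.
  by rewrite mulrACA.
Qed.

Section Diff.
Variables (k : fieldType) (s : {rmorphism k -> k}).

Section NCoord.
Variable GG : alg_group k.
Let A := alg_coord GG.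

Lemma ncoord_ind i (Q : ncoord s GG i -> Prop) :
  (forall j a, Q (nfactor_in s (GG := GG) j a)) -> (forall c, Q (kstr (ncoord s GG i) c)) ->
  (forall x y, Q x -> Q y -> Q (x + y)) -> (forall x, Q x -> Q (- x)) ->
  (forall x y, Q x -> Q y -> Q (x * y)) -> forall x, Q x.
Proof.
move=> Qn Qc QD QN QM; apply: presented_ind => // -[j b].
pose Q' b := Q (tensor_in (fun j : 'I_i.+1 => power_factor s GG j) j b).
change (Q' b); move: b.
apply: (presented_ind (Q := Q')) => [a|c|x y|x|x y]; rewrite /Q'.
- exact: Qn.
- by rewrite (kfunE (tensor_in _ j)).
- by rewrite rmorphD; exact: QD.
- by rewrite rmorphN; exact: QN.
- by rewrite rmorphM; exact: QM.
Qed.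

Lemma ncoord_in_proj i f :
  ncoord_in s GG i.+1 (proj_dual s GG i f) = ncoord_in s GG i f.
Proof.
pose h1 := kcomp (ncoord_in s GG i.+1) (proj_dual s GG i).
suff : h1 =1 ncoord_in s GG i by exact.
apply: ncoord_ext => j a.
change (ncoord_in s GG i.+1 (proj_dual s GG i (nfactor_in s j a))
  = ncoord_in s GG i (nfactor_in s j a)).
by rewrite proj_dualE !ncoord_inE.
Qed.

Lemma ncoord_in_mono i j f : (i <= j)%N ->
  exists g, ncoord_in s GG j g = ncoord_in s GG i f.
Proof.
move=> /subnK <-; elim: (j - i)%N => [|n [g <-]]; first by exists f.
by exists (proj_dual s GG (n + i) g); exact: ncoord_in_proj.
Qed.

Lemma ncoord_exhaust (p : sigcoord s GG) : exists i f, ncoord_in s GG i f = p.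
Proof.
pose Q (p : sigcoord s GG) := exists i f, ncoord_in s GG i f = p.
have two x y : Q x -> Q y -> exists i f g,
    ncoord_in s GG i f = x /\ ncoord_in s GG i g = y.
  move=> [i [f <-]] [j [g <-]].
  have [f' f'E] := ncoord_in_mono f (leq_maxl i j).
  have [g' g'E] := ncoord_in_mono g (leq_maxr i j).
  by exists (maxn i j), f', g'.
suff : Q p by [].
have QD x y : Q x -> Q y -> Q (x + y).
  move=> Qx Qy; have [i [f [g [<- <-]]]] := two x y Qx Qy.
  by exists i, (f + g); exact: rmorphD.
have QM x y : Q x -> Q y -> Q (x * y).
  move=> Qx Qy; have [i [f [g [<- <-]]]] := two x y Qx Qy.
  by exists i, (f * g); exact: rmorphM.
have QN x : Q x -> Q (- x).
  by move=> [i [f <-]]; exists i, (- f); exact: rmorphN.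
have Qc c : Q (kstr (sigcoord s GG) c).
  by exists 0%N, (kstr (ncoord s GG 0) c); exact: (kfunE (ncoord_in s GG 0)).
move: p; apply: (presented_ind (Q := Q)) => // -[j b].
exists j, (tensor_in (fun l : 'I_j.+1 => power_factor s GG l) (@ord_max j) b).
exact: tensor_liftE.
Qed.

End NCoord.

Section Embedding.
Variables (G : sig_group s) (GG : alg_group k) (e : group_nat G (forget s GG)).
Let R := sig_coord G.
Let A := alg_coord GG.
Let u : G R := universal (sig_rep G).
Let C := kalg_category k.
Let mk (B D : kalg k) (f : khom B D) : @mor C B D := f.
Let mks (B D : sigalg s) (f : sighom B D) : @mor (sigalg_category s) B D := f.

Definition base_point : GG (scar R) := e R u.
Definition base_hom : khom A R := classify (alg_rep GG) base_point.

Lemma base_hom_fmap (Y : sigalg s) (f : sighom R Y) a :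
  f (base_hom a) = (classify (alg_rep GG) (e Y (fmap (mks f) u) : GG (scar Y)) : khom A Y) a.
Proof.
have -> : (e Y (fmap (mks f) u) : GG (scar Y)) = fmap (mk (sfun f)) base_point.
  exact: (nat_natural e (mks f) u).
by rewrite (classify_natural (alg_rep GG)).
Qed.

Lemma dual_factor j a : dual e (factor_in s j a) = rpow (sact R) j (base_hom a).
Proof. exact: (sigcoord_liftE base_hom). Qed.

Definition trunc_hom i : khom (ncoord s GG i) R := kcomp (dual e) (ncoord_in s GG i).

Lemma trunc_homE i (j : 'I_i.+1) a :
  trunc_hom i (nfactor_in s j a) = rpow (sact R) j (base_hom a).
Proof. by rewrite -dual_factor -(ncoord_inE s j). Qed.

(** The coordinate ring of [G[i]], as a subring of [k{G}]. *)
Definition trunc_sub i : subring R := image_subring (trunc_hom i).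

Lemma trunc_sub_str i c : trunc_sub i (kstr R c).
Proof. by exists (kstr _ c); exact: (kfunE (trunc_hom i)). Qed.

Lemma trunc_proj i f : trunc_hom i.+1 (proj_dual s GG i f) = trunc_hom i f.
Proof. by congr (dual e _); exact: ncoord_in_proj. Qed.

Lemma trunc_subS i r : trunc_sub i r -> trunc_sub i.+1 r.
Proof. by move=> [f <-]; exists (proj_dual s GG i f); exact: trunc_proj. Qed.

Lemma trunc_sub_mono i j r : (i <= j)%N -> trunc_sub i r -> trunc_sub j r.
Proof.
move=> /subnK <-; elim: (j - i)%N => // n IH Wr.
exact/trunc_subS/IH.
Qed.

Lemma trunc_sub_act i r : trunc_sub i r -> trunc_sub i.+1 (sact R r).
Proof.
move=> [f <-]; exists (shift_dual s GG i f).
by rewrite -sfunE -ncoord_in_shift.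
Qed.

Lemma trunc_sub_rpow i j r : trunc_sub i r -> trunc_sub (j + i) (rpow (sact R) j r).
Proof. by move=> Wr; elim: j => //= j IH; exact: trunc_sub_act. Qed.

Lemma trunc_sub_factor i (j : 'I_i.+1) a : trunc_sub i (rpow (sact R) j (base_hom a)).
Proof. by rewrite -trunc_homE; eexists. Qed.

(** [base_hom] is the point of [GG] obtained from the universal point of [G]; as [e]
    preserves words, [Delta] restricts to the comultiplication of [GG]. *)
Lemma coword_base b a : exists t : seq (A * A),
  coword G b (base_hom a)
  = \sum_(z <- t) tens1 R R (base_hom z.1) * tens2 R R (base_hom z.2).
Proof.
rewrite (base_hom_fmap (coword G b)) fmap_coword nat_word.
pose psi : khom (tensor2 A A) (tensor2 R R) :=
  tensor2_lift (kcomp (tens1 R R) base_hom) (kcomp (tens2 R R) base_hom).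
pose ua := universal (alg_rep GG).
have e1 : (e _ (fmap (mks (sig_tens1 R)) u) : GG (tensor2 R R))
    = fmap (mk psi) (fmap (mk (tens1 A A)) ua).
  rewrite -fmap_comp (_ : compm _ _ = compm (mk (tens1 R R)) (mk base_hom)).
    rewrite fmap_comp [fmap (mk base_hom) ua]classifyK.
    exact: (nat_natural e (mks (sig_tens1 R)) u).
  by apply: khom_ext => x; exact: tensor2_lift1.
have e2 : (e _ (fmap (mks (sig_tens2 R)) u) : GG (tensor2 R R))
    = fmap (mk psi) (fmap (mk (tens2 A A)) ua).
  rewrite -fmap_comp (_ : compm _ _ = compm (mk (tens2 R R)) (mk base_hom)).
    rewrite fmap_comp [fmap (mk base_hom) ua]classifyK.
    exact: (nat_natural e (mks (sig_tens2 R)) u).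
  by apply: khom_ext => x; exact: tensor2_lift2.
have [t tE] := tensor2_sum ((classify (alg_rep GG)
  (word b (fmap (mk (tens1 A A)) ua) (fmap (mk (tens2 A A)) ua)) : khom A (tensor2 A A)) a).
exists t; rewrite [e _ _]e1 [e _ _]e2.
rewrite -(fmap_word b (mk psi)) (classify_natural (alg_rep GG)).
change (psi ((classify (alg_rep GG)
  (word b (fmap (mk (tens1 A A)) ua) (fmap (mk (tens2 A A)) ua)) : khom A (tensor2 A A)) a)
  = \sum_(z <- t) tens1 R R (base_hom z.1) * tens2 R R (base_hom z.2)).
rewrite tE rmorph_sum; apply: eq_bigr => z _.
by rewrite rmorphM tensor2_lift1 tensor2_lift2.
Qed.

Lemma rpow_sfun (B D : sigalg s) (f : sighom B D) j x :
  f (rpow (sact B) j x) = rpow (sact D) j (f x).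
Proof. by elim: j => //= j <-; exact: sfunE. Qed.

(** The truncations are Hopf subalgebras because they are generated by the
    [sigma^j]-images of [base_hom], and [Delta] commutes with [sigma]. *)
Lemma trunc_pure b i r : trunc_sub i r -> pure (trunc_sub i) (coword G b r).
Proof.
have [pc pD pN pM] := pure_subring (@trunc_sub_str i).
move=> [f <-]; move: f; apply: ncoord_ind => [j a|c|x y|x|x y].
- rewrite trunc_homE (rpow_sfun (coword G b)).
  have [t ->] := coword_base b a.
  exists [seq (to_sub (trunc_sub_factor j z.1), to_sub (trunc_sub_factor j z.2)) | z <- t].
  rewrite big_map rmorph_sum; apply: eq_bigr => z _; rewrite rmorphM.
  by rewrite -(rpow_sfun (sig_tens1 R)) -(rpow_sfun (sig_tens2 R)).
- by rewrite (kfunE (trunc_hom i)) (kfunE (coword G b)).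
- by rewrite !rmorphD; exact: pD.
- by rewrite !rmorphN; exact: pN.
- by rewrite !rmorphM; exact: pM.
Qed.

Lemma counit_base a :
  counit_hom G (base_hom a) = (classify (alg_rep GG) (1%g : GG (kbase k)) : khom A _) a.
Proof.
rewrite (base_hom_fmap (counit_hom G)) [fmap _ u]classifyK.
suff -> : (e _ (1%g : G (sig_base s)) : GG (kbase k)) = 1%g by [].
apply: (@mulgI _ (e _ (1%g : G (sig_base s)))).
by rewrite -nat_mapM !mulg1.
Qed.

(** The identity of [G] is sent to the identity of [GG]. *)
Lemma counit_trunc i f : counit_hom G (trunc_hom i f) = unit_point s GG i f.
Proof.
pose h : khom _ _ := kcomp (counit_hom G) (trunc_hom i).
suff : h =1 unit_point s GG i by exact.
apply: ncoord_ext => j a.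
change (counit_hom G (trunc_hom i (nfactor_in s j a)) = unit_point s GG i (nfactor_in s j a)).
rewrite trunc_homE (rpow_sfun (counit_hom G)) counit_base unit_pointE.
have str c : rpow s j (kstr (kbase k) c) = kstr (twist (rpow s j) (kbase k)) c by [].
pose sj : khom (kbase k) (twist (rpow s j) (kbase k)) :=
  @KHom k (kbase k) (twist (rpow s j) (kbase k)) (rpow s j) str.
have <- : fmap (mk sj) (1%g : GG (kbase k)) = 1%g by exact: fmap1.
by rewrite (classify_natural (alg_rep GG)).
Qed.

Section Kernel.
Variable i : nat.
Let X := trunc_sub i.
Let X' := trunc_sub i.+1.
Let aug_id := aug_ideal (counit_hom G) X X'.
Let q := quot_map (@kernel_eqs k s G GG e i.+1).

(** Functions on [G[i+1]] lift to [GG[i+1]], and [eps] is evaluation at the identity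
    of [GG[i+1]]; so modulo [trunc_ideal] the equations of the kernel generate
    [X^+ X'].  This identifies its coordinate ring with [X' / X^+ X']. *)
Lemma kernel_ideal f : q f = 0 <-> aug_id (trunc_hom i.+1 f).
Proof.
split=> [/quot_map_ker|].
  apply: (ideal_ind_closed (J := fun f => aug_id (trunc_hom i.+1 f))).
  - by rewrite rmorph0; exists 0; [exact: ideal0 | ].
  - move=> a b; rewrite rmorphD => -[x Ix <-] [y Iy <-].
    by exists (x + y); [exact: idealD | ].
  - move=> c a; rewrite rmorphM => -[x Ix <-].
    exists (to_sub (ex_intro _ c erefl : X' (trunc_hom i.+1 c)) * x).
      exact: idealM.
    by [].
  - move=> a [a0|[g g1 ->]].
      rewrite (_ : trunc_hom _ _ = 0); last exact: a0.
      by exists 0; [exact: ideal0 | ].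
    rewrite trunc_proj -[trunc_hom i g]mulr1; apply: aug_idealM.
    + by move=> r; exact: trunc_subS.
    + by exists g.
    + exact: smem1.
    + by rewrite counit_trunc.
move=> [y Iy]; elim: Iy f => {y} [|b c a [[g gb] eb] _ IH] f.
  by move=> f0; apply: quot_map0; left; exact/esym.
have [h hc] := subP c; have [f' f'a] := subP a => fE.
have rest0 : q (f - proj_dual s GG i g * h - f') = 0.
  apply: quot_map0; left.
  have : trunc_hom i.+1 (f - proj_dual s GG i g * h - f') = 0; last by [].
  rewrite !rmorphB rmorphM trunc_proj gb hc f'a -fE.
  by rewrite val_subD val_subM; ring.
have g0 : q (proj_dual s GG i g) = 0.
  by apply: quot_map0; right; exists g => //; rewrite -counit_trunc gb.
have -> : f = (f - proj_dual s GG i g * h - f') + (proj_dual s GG i g * h + f').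
  by ring.
by rewrite rmorphD rest0 add0r rmorphD rmorphM g0 mul0r add0r IH //; exact: esym.
Qed.

(** A basis of the coordinate ring of the kernel gives a complete coframe; a merely
    independent family still gives a coframe, which will exclude infinite
    kernels. *)
Lemma kernel_coframe d (m : 'I_d -> kmod (kernel_coord e i.+1)) :
  indep_mod zero_space m -> exists delta : 'I_d -> carrier X' -> carrier X',
    coframe (base_sub X X') delta /\
    ((forall x, span_mod zero_space m x) -> complete (base_sub X X') delta).
Proof.
move=> im; have /choice[f fP] : forall j, exists f, q f = m j.
  by move=> j; exact: quot_map_surj.
have sumE (c : 'I_d -> k) : trunc_hom i.+1 (\sum_j kstr _ (c j) * f j)
    = \sum_j kstr R (c j) * trunc_hom i.+1 (f j).
  rewrite rmorph_sum; apply: eq_bigr => j _.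
  by rewrite rmorphM (kfunE (trunc_hom i.+1)).
have qsumE (c : 'I_d -> k) : q (\sum_j kstr _ (c j) * f j)
    = \sum_j kstr (kernel_coord e i.+1) (c j) * (m j : kernel_coord e i.+1).
  rewrite rmorph_sum; apply: eq_bigr => j _.
  by rewrite rmorphM (kfunE q) fP.
have [||||||||||||delta [cof cpl]] := @coframe_exists k R (coword G false) (coword G true)
  (counit_hom G) _ _ _ _ X X' _ _ _ _ _ _ d (fun j => trunc_hom i.+1 (f j)).
- exact: (coword_cancel false).
- exact: (coword_cancel true).
- exact: coword_counit.
- exact: coword_antipode.
- exact: trunc_sub_str.
- by move=> r; exact: trunc_subS.
- exact: trunc_pure.
- exact: trunc_pure.
- exact: trunc_pure.
- exact: trunc_pure.
- by move=> j; eexists.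
- move=> c cI; apply: im; rewrite /zero_space -[LHS]qsumE.
  by apply/kernel_ideal; rewrite sumE.
exists delta; split=> // mspan; apply: cpl => _ [h <-].
have [c /subr0_eq cE] := mspan (q h); exists c.
change (aug_id (trunc_hom i.+1 h - \sum_j kstr R (c j) * trunc_hom i.+1 (f j))).
rewrite -sumE -rmorphB; apply/kernel_ideal; rewrite rmorphB qsumE.
by apply/eqP; rewrite subr_eq0; apply/eqP.
Qed.

End Kernel.

Lemma trunc_generated i : exists zs : seq R, (forall z, z \in zs -> trunc_sub i z) /\
  forall x, trunc_sub i x -> generated (fun z => z \in zs) x.
Proof.
have [Bs genB] := alg_fin GG.
exists [seq rpow (sact R) j (base_hom b) | j <- iota 0 i.+1, b <- Bs]; split.
  move=> _ /allpairsP[[j b] [ji _ ->]]; move: ji; rewrite mem_iota => ji.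
  exact: (trunc_sub_factor (Ordinal ji)).
set Z := (X in generated X).
have genN x : generated Z x -> generated Z (- x).
  move=> gx; rewrite -mulN1r -(rmorph1 (kstr R)) -rmorphN.
  exact: generated_mul (generated_str _ _) gx.
move=> _ [f <-]; move: f; apply: ncoord_ind => [j a|c|x y|x|x y].
- rewrite trunc_homE; elim: {a}(genB a) => [a aB|c|a b _ ga _ gb|a b _ ga _ gb].
  + by apply: generated_in; apply/allpairsP; exists (val j, a); rewrite mem_iota /= ltn_ord.
  + rewrite (kfunE base_hom) (_ : rpow _ _ _ = kstr R (rpow s j c)).
      exact: generated_str.
    by elim: (j : nat) => //= n ->; exact: sactE.
  + by rewrite !rmorphD; exact: generated_add.
  + by rewrite !rmorphM; exact: generated_mul.
- by rewrite (kfunE (trunc_hom i)); exact: generated_str.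
- by rewrite rmorphD; exact: generated_add.
- by rewrite rmorphN; exact: genN.
- by rewrite rmorphM; exact: generated_mul.
Qed.

Lemma trunc_exhaust (r : R) : sigma_closed_embedding e -> exists i, trunc_sub i r.
Proof.
move=> ce; have [p <-] := ce r; have [i [f <-]] := ncoord_exhaust p.
by exists i, f.
Qed.

End Embedding.

(** By surjectivity of the dual of [e2], the finitely many generators of [k[GG1]]
    already lie in one truncation for [e2]; applying [sigma] shifts the index. *)
Lemma trunc_cofinal (G : sig_group s) (GG1 GG2 : alg_group k)
    (e1 : group_nat G (forget s GG1)) (e2 : group_nat G (forget s GG2)) :
  sigma_closed_embedding e2 ->
  exists p, forall i r, trunc_sub e1 i r -> trunc_sub e2 (i + p) r.
Proof.
move=> ce2; have [Bs genB] := alg_fin GG1.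
have [p pP] : exists p, forall b, b \in Bs -> trunc_sub e2 p (base_hom e1 b).
  elim: Bs {genB} => [|b Bs [p IH]]; first by exists 0%N.
  have [j jP] := trunc_exhaust (base_hom e1 b) ce2.
  exists (maxn j p) => c; rewrite in_cons => /orP[/eqP->|/IH].
    exact: trunc_sub_mono (leq_maxl _ _) jP.
  exact: trunc_sub_mono (leq_maxr _ _).
have baseP a : trunc_sub e2 p (base_hom e1 a).
  elim: {a}(genB a) => [a /pP //|c|a b _ ga _ gb|a b _ ga _ gb].
  - by rewrite (kfunE (base_hom e1)); exact: trunc_sub_str.
  - by rewrite rmorphD; exact: smemD.
  - by rewrite rmorphM; exact: smemM.
exists p => i _ [f <-]; move: f; apply: ncoord_ind => [j a|c|x y|x|x y].
- rewrite trunc_homE; apply: (@trunc_sub_mono _ _ _ (j + p)).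
    by rewrite leq_add2r -ltnS.
  exact: trunc_sub_rpow.
- by rewrite (kfunE (trunc_hom e1 i)); exact: trunc_sub_str.
- by rewrite rmorphD; exact: smemD.
- by rewrite rmorphN; exact: smemN.
- by rewrite rmorphM; exact: smemM.
Qed.

End Diff.

(** * Comparison of two embeddings *)

(** If [a] were larger than [b], Bernoulli's inequality would make
    [(a / b) ^ n] unbounded. *)
Lemma growth_rate_le (a b q l : nat) :
  (forall n, a ^ n <= b ^ (n + q) * l)%N -> (a <= b)%N.
Proof.
move=> le_ab; rewrite leqNgt; apply/negP => lt_ba.
have b_gt0 : (0 < b)%N.
  case: b lt_ba le_ab => // lt0a /(_ 1%N); rewrite expn1 exp0n // mul0n.
  by rewrite leqNgt lt0a.
pose K := (b ^ q * l)%N.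
have bernoulli n : (b ^ n * (b + n) <= b * a ^ n)%N.
  elim: n => [|n IH]; first by rewrite !expn0 mul1n muln1 addn0.
  have -> : (b * a ^ n.+1 = a * (b * a ^ n))%N by rewrite expnS mulnCA.
  apply: leq_trans (leq_mul lt_ba IH).
  rewrite expnS -mulnA mulnCA [X in (_ <= X)%N]mulnCA leq_mul2l; apply/orP; right.
  by nia.
have := leq_trans (bernoulli (b * K).+1) (leq_mul (leqnn b) (le_ab (b * K).+1)).
rewrite expnD -[X in (_ <= b * X)%N]mulnA -/K mulnCA leq_pmul2l ?expn_gt0 ?b_gt0 //.
by rewrite leqNgt => /negP; apply; rewrite addnS ltnS leq_addl.
Qed.

Lemma kdimE (k : fieldType) (A : kalg k) n : alg_dim A n -> kdim A = Some n.
Proof.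
move=> dn; rewrite /kdim; case: pselect => [h|[]]; last by exists n; apply/has_dimP.
by congr Some; apply: alg_dim_unique dn; apply/has_dimP; exact: projT2 (cid h).
Qed.

Lemma kdim_infinite (k : fieldType) (A : kalg k) :
  ~ (exists n, alg_dim A n) -> kdim A = None.
Proof.
move=> nA; rewrite /kdim; case: pselect => // h.
by case: nA; have [n /has_dimP dn] := h; exists n.
Qed.

Section Compare.
Variables (k : fieldType) (s : {rmorphism k -> k}) (G : sig_group s).
Let R := sig_coord G.

Lemma kernel_dimS (GG : alg_group k) (e : group_nat G (forget s GG)) m i n :
  sigma_iso_above e m -> (m <= i)%N ->
  alg_dim (kernel_coord e i) n <-> alg_dim (kernel_coord e i.+1) n.
Proof.
move=> iso mi; rewrite -(alg_dim_iso _ (iso i mi)).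
by split; [exact: bchange_dim | exact: bchange_dimV].
Qed.

Lemma kernel_dim_above (GG : alg_group k) (e : group_nat G (forget s GG)) m i n :
  sigma_iso_above e m -> (m <= i)%N ->
  alg_dim (kernel_coord e m) n <-> alg_dim (kernel_coord e i) n.
Proof.
move=> iso /subnK <-; elim: (i - m)%N => [|j IH]; first by [].
by rewrite addSn -(kernel_dimS _ iso (leq_addl j m)).
Qed.

Lemma coord_nonzero : 1 != 0 :> R.
Proof.
apply/eqP => /(congr1 (counit_hom G)); rewrite rmorph1 rmorph0.
by apply/eqP; rewrite oner_eq0.
Qed.

Variables (GG1 GG2 : alg_group k).
Variables (e1 : group_nat G (forget s GG1)) (e2 : group_nat G (forget s GG2)).
Hypotheses (emb1 : sigma_closed_embedding e1) (emb2 : sigma_closed_embedding e2).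
Variables (m1 m2 d1 : nat).
Hypotheses (iso1 : sigma_iso_above e1 m1) (iso2 : sigma_iso_above e2 m2).
Hypothesis dim1 : alg_dim (kernel_coord e1 m1) d1.

(** Each truncation for [e1] above [m1] has generic dimension at most [d1] times
    that of the previous one, and each truncation for [e2] above [m2] at least [d2]
    times that of the previous one.  The truncations interlace with a bounded shift of
    indices, so [d2 ^ n] is at most a constant times [d1 ^ n]. *)
Lemma growth_dim_le : exists2 d2, (d2 <= d1)%N & alg_dim (kernel_coord e2 m2) d2.
Proof.
have [p sub12] := trunc_cofinal e1 emb2; have [q sub21] := trunc_cofinal e2 emb1.
pose W1 := trunc_sub e1; pose W2 := trunc_sub e2.
have [P [domP kP PW1 algP]] : exists P : subring R, [/\ domain P,
    forall x, image_subring (kstr R) x -> P x, forall x, P x -> W1 m1 x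
    & forall z, W1 m1 z -> algebraic_over P z].
  apply: maximal_domain => [||_ [c <-]]; first exact: coord_nonzero.
    move=> _ _ [c <-] [d <-]; rewrite -rmorphM => /(congr1 (counit_hom G)).
    rewrite rmorph0 (kfunE (counit_hom G)) => /eqP; rewrite mulf_eq0.
    by case/orP=> /eqP ->; [left | right]; exact: rmorph0.
  exact: trunc_sub_str.
have R1 := coord_nonzero.
have [zs [zsW genW]] := trunc_generated e1 m1.
have [l dl] : exists l, generic_dim domP R1 (W1 m1) l.
  apply: (@generic_dim_exists _ _ _ domP R1 (W1 m1) zs) => //.
  - by move=> c; apply: kP; exists c.
  - by move=> z /zsW; exact: algP.
have upper t : exists2 c, (c <= d1 ^ t * l)%N & generic_dim domP R1 (W1 (t + m1)%N) c.
  elim: t => [|t [c cl dc]]; first by exists l; rewrite ?mul1n.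
  have [b [_ ib bspan]] : alg_dim (kernel_coord e1 (t + m1).+1) d1.
    exact: (proj1 (kernel_dim_above _ iso1 (leqW (leq_addl _ _))) dim1).
  have [delta [cof cpl]] := kernel_coframe ib.
  have PW x : P x -> W1 (t + m1)%N x.
    by move=> /PW1; exact: trunc_sub_mono (leq_addl _ _).
  have WS x : W1 (t + m1)%N x -> W1 (t + m1).+1 x by exact: trunc_subS.
  have [c' c'c dc'] := generic_dim_le PW WS cof (cpl (fun x => bspan x I)) dc.
  exists c'; last exact: dc'.
  by rewrite (leq_trans c'c) // expnS -mulnA leq_mul2l cl orbT.
(* The dimensions are taken over [P], which lies in [W1 m1], hence in [W2 a]. *)
pose a := maxn m2 (m1 + p).
have PW2 n x : P x -> W2 (n + a)%N x.
  move=> /PW1/sub12; apply: trunc_sub_mono.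
  by rewrite (leq_trans (leq_maxr m2 _)) // leq_addl.
pose r := (a - m1 + q)%N.
have W21 n x : W2 (n + a)%N x -> W1 (n + r + m1)%N x.
  move=> /sub21; apply: trunc_sub_mono; rewrite /r.
  have : (m1 <= a)%N by rewrite (leq_trans (leq_addr p m1)) // leq_maxr.
  by lia.
have dimW2 n : exists2 c, (c <= d1 ^ (n + r) * l)%N & generic_dim domP R1 (W2 (n + a)%N) c.
  have [b bl db] := upper (n + r)%N.
  have [c dc] := generic_dim_sub (W21 n) db.
  by exists c => //; apply: leq_trans bl; exact: generic_dim_mono (W21 n) dc db.
have W2S n x : W2 (n + a)%N x -> W2 (n + a).+1 x by exact: trunc_subS.
(* A coframe is bounded by the generic dimension, so this kernel is finite. *)
have [d2 dd2] : exists d2, alg_dim (kernel_coord e2 a.+1) d2.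
  have [c _ dc] := dimW2 1%N.
  apply: (@dim_bounded _ _ c) => n b /kernel_coframe[delta [cof _]].
  exact: (@coframe_generic_dim _ _ P domP R1 (W2 a) (W2 a.+1)
    (PW2 0%N) (W2S 0%N) n _ c cof dc).
have ma : (m2 <= a)%N by exact: leq_maxl.
have dim2 : alg_dim (kernel_coord e2 m2) d2.
  exact: (proj2 (kernel_dim_above _ iso2 (leqW ma)) dd2).
exists d2 => //.
have lower n c : generic_dim domP R1 (W2 (n + a)%N) c -> (d2 ^ n <= c)%N.
  elim: n c => [|n IH] c dc; first exact: generic_dim_gt0 dc.
  have [b _ db] := dimW2 n.
  have [f [_ indf fspan]] : alg_dim (kernel_coord e2 (n + a).+1) d2.
    have man : (m2 <= (n + a).+1)%N by exact/leqW/(leq_trans ma)/leq_addl.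
    exact: (proj1 (kernel_dim_above _ iso2 man) dim2).
  have [delta [cof cpl]] := kernel_coframe indf.
  have := generic_dim_ge (PW2 n) (W2S n) cof (cpl (fun x => fspan x I)) db dc.
  by apply: leq_trans; rewrite expnS leq_mul2l (IH _ db) orbT.
apply: (@growth_rate_le _ _ r l) => n; have [c cl dc] := dimW2 n.
exact: leq_trans (lower n c dc) cl.
Qed.

End Compare.

Theorem proposition5p1 (k : fieldType) (sigma : {rmorphism k -> k})
    (G : sig_group sigma) (GG1 GG2 : alg_group k)
    (e1 : group_nat G (forget sigma GG1))
    (e2 : group_nat G (forget sigma GG2)) :
  sigma_closed_embedding e1 -> sigma_closed_embedding e2 ->
  forall m1 m2 : nat, growth_index e1 m1 -> growth_index e2 m2 ->
  kdim (kernel_coord e1 m1) = kdim (kernel_coord e2 m2).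
Proof.
move=> emb1 emb2 m1 m2 [iso1 _] [iso2 _].
have [[d1 dim1]|inf1] := pselect (exists d, alg_dim (kernel_coord e1 m1) d).
  have [d2 le21 dim2] := growth_dim_le emb1 emb2 iso1 iso2 dim1.
  have [d le12 dim1'] := growth_dim_le emb2 emb1 iso2 iso1 dim2.
  rewrite (kdimE dim1) (kdimE dim2); congr Some; apply/eqP.
  by rewrite eqn_leq le21 (alg_dim_unique dim1 dim1') le12.
have [[d2 dim2]|inf2] := pselect (exists d, alg_dim (kernel_coord e2 m2) d).
  have [d _ dim1] := growth_dim_le emb2 emb1 iso2 iso1 dim2.
  by case: inf1; exists d.
by rewrite !kdim_infinite.
Qed.
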